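(* Let $X\sim\mathcal N_k(\theta,I_k)$ with $\theta\in\mathbb R^k$ unknown, to be estimated under the loss $L(\theta,\delta)=\|\delta-\theta\|^2$. Assume that the prior on $\theta$ is spherically symmetric with density of the radius $\lambda$ on $(0,\infty)$, and that the Bayes risk of the corresponding Bayes estimate is finite. 1. Let $f(r)=r^{(1-k)/2}\exp(-r^2/2)\,\lambda(r)$ for $r>0$, and let $F=\mathcal I_{(k-2)/2}[f]$ be its $I$-transform of order $(k-2)/2$. A sufficient condition for the corresponding spherical Bayes estimator of the mean $\theta$ to be minimax is that, for all $u>0$, $$ \frac{F''(u)}{F(u)}-\frac12\left(\frac{F'(u)}{F(u)}\right)^2+\frac{F'(u)}{F(u)}\left[\frac{k-1}{2}\,\frac1u-u\right]+\frac{(k-1)(7-3k)}{8}\,\frac1{u^2}+\frac12u^2-\frac{k+1}{2}\le 0. \qquad(\ast) $$ 2. Let $$\varphi(u)=\frac1{u^2}\sum_{j=0}^\infty b_j u^j$$ be any non-positive generalized series. The function $F$ defined by $$F(u)=\bigl(c_1z_1(u)+c_2z_2(u)\bigr)^2\,u^{(k-1)/2}\exp(u^2/2),$$ where $z_1$ and $z_2$ are two linearly independent solutions of the second order differential equation $$z''+\frac{k-1}{u}\,z'-\frac12\,\varphi(u)\,z=0$$ and $c_1$ and $c_2$ are arbitrary constants, satisfies $(\ast)$. Provided the function $F$ so obtained is the $I$-transform of order $(k-2)/2$ of a function, the radial density of the prior is given, for every $r>0$, by $$\lambda(r)=r^{(k-1)/2}\exp(r^2/2)\,\mathcal I^{-1}_{(k-2)/2}[F](r),$$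 where $\mathcal I^{-1}_{(k-2)/2}$ is the inverse $I$-transform of order $(k-2)/2$. If, in addition, the function $\lambda$ is integrable, then the resulting proper Bayes estimator is minimax.
   Context: Radial density: a spherically symmetric (possibly generalized, i.e. improper) prior density $\pi(\theta)=g(\|\theta\|^2)$ on $\mathbb R^k$, for some function $g$, is characterized by its radial density $\lambda(r)=\frac{2\pi^{k/2}}{\Gamma(k/2)}\,r^{k-1}g(r^2)$, $r=\|\theta\|>0$. The prior is proper if $\lambda$ is integrable (up to normalization by a constant, which does not affect the Bayes estimator). Marginal: $m(x)=(2\pi)^{-k/2}\int_{\mathbb R^k}\exp(-\tfrac12\|x-\theta\|^2)\,\pi(\theta)\,d\theta$. The (generalized) Bayes estimator is $\delta_\pi(X)=X+\nabla\log m(X)$. Risk: $R(\theta,\delta)=E_\theta\|\delta(X)-\theta\|^2$; the Bayes risk of $\delta$ is $\int R(\theta,\delta)\pi(\theta)\,d\theta$. An estimator $\delta$ is minimax if $\sup_\theta R(\theta,\delta)=\inf_{\delta'}\sup_\theta R(\theta,\delta')$; this minimax value equals $k$, the constant risk of the usual estimator $\delta_0(X)=X$. $I$-transform of order $\nu$: $\mathcal I_\nu[f](y)=\int_0^\infty f(x)\sqrt{xy}\,I_\nu(xy)\,dx$, where $I_\nu$ is the modified Bessel function of the first kind of order $\nu$. The inverse transform $\mathcal I_\nu^{-1}[F]$ is the function $f$ with $\mathcal I_\nu[f]=F$. A non-positive generalized series is a function $\varphi$ of the displayed form (real coefficients $b_j$) with $\varphi(u)\le0$ for all $u>0$. *)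

(* Defs.v *)
From HB Require Import structures.
From mathcomp Require Import all_boot all_order all_algebra.
From mathcomp Require Import all_classical all_reals all_analysis.
Import Order.TTheory GRing.Theory Num.Theory.
Import numFieldNormedType.Exports.

Set Implicit Arguments.
Unset Strict Implicit.
Unset Printing Implicit Defensive.

Local Open Scope classical_set_scope.
Local Open Scope ring_scope.

(* 'rV_n carries the sigma-algebra transported from n.-tuple (the product
   sigma-algebra); over R this is the Borel sigma-algebra. *)
Definition tuple_of_row (T : Type) n (x : 'rV[T]_n) : n.-tuple T :=
  [tuple x ord0 i | i < n].
Definition row_of_tuple (T : Type) n (t : n.-tuple T) : 'rV[T]_n :=
  \row_(i < n) tnth t i.

Lemma tuple_of_rowK T n : cancel (@tuple_of_row T n) (@row_of_tuple T n).
Proof. by move=> x; apply/rowP => i; rewrite mxE tnth_mktuple. Qed.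

Lemma row_of_tupleK T n : cancel (@row_of_tuple T n) (@tuple_of_row T n).
Proof. by move=> t; apply: eq_from_tnth => i; rewrite tnth_mktuple mxE. Qed.

Definition measure_row_display : measure_display -> measure_display.
Proof. exact. Qed.

Section measurable_row.
Context {d} {T : measurableType d}.
Variable n : nat.

Let row_meas : set (set 'rV[T]_n) :=
  preimage_set_system setT (@tuple_of_row T n) measurable.

Let row_set0 : row_meas set0.
Proof. by exists set0 => //; rewrite preimage_set0 setI0. Qed.

Let row_setC A : row_meas A -> row_meas (~` A).
Proof.
move=> [B mB] <-; exists (~` B); first exact: measurableC.
by rewrite !setTI preimage_setC.
Qed.

Let row_bigcup (F : (set 'rV[T]_n)^nat) : (forall i, row_meas (F i)) ->
  row_meas (\bigcup_i (F i)).
Proof.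
move=> mF; have /choice[G GF] : forall i, exists B : set (n.-tuple T),
    measurable B /\ @tuple_of_row T n @^-1` B = F i.
  by move=> i; have [B mB <-] := mF i; exists B; rewrite setTI.
exists (\bigcup_i G i); first by apply: bigcupT_measurable => i; have [] := GF i.
rewrite setTI preimage_bigcup; apply: eq_bigcupr => i _.
by have [] := GF i.
Qed.

HB.instance Definition _ := @isMeasurable.Build (measure_row_display d)
  'rV[T]_n row_meas row_set0 row_setC row_bigcup.

Lemma measurable_tuple_of_row : measurable_fun setT (@tuple_of_row T n).
Proof. by move=> _ B mB; exists B. Qed.

Lemma measurable_row_of_tuple : measurable_fun setT (@row_of_tuple T n).
Proof.
move=> _ _ [B mB <-]; rewrite !setTI -comp_preimage.
rewrite (_ : _ \o _ = id) ?preimage_id//.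
by apply/funext => t /=; rewrite row_of_tupleK.
Qed.

End measurable_row.

Section sigma_finite_transport.
Context {d1 d2} {T1 : measurableType d1} {T2 : measurableType d2}.
Context {R : realType}.
Variables (mu : {sigma_finite_measure set T1 -> \bar R}).
Variables (f : T1 -> T2) (g : T2 -> T1).
Hypotheses (mf : measurable_fun setT f) (mg : measurable_fun setT g).
Hypothesis fK : cancel f g.

Definition transport (_ : measurable_fun setT f) (_ : measurable_fun setT g)
  (_ : cancel f g) : set T2 -> \bar R := pushforward mu f.

Local Notation nu := (transport mf mg fK).

Let nu0 : nu set0 = 0%E.
Proof. by rewrite /transport /pushforward preimage_set0 measure0. Qed.

Let nu_ge0 A : (0 <= nu A)%E.
Proof. exact: measure_ge0. Qed.

Let nu_additive : semi_sigma_additive nu.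
Proof.
move=> F mF tF mUF; rewrite /transport /pushforward preimage_bigcup.
apply: measure_semi_sigma_additive.
- by move=> n; rewrite -[X in measurable X]setTI; exact: mf.
- apply/trivIsetP => /= i j _ _ ij; rewrite -preimage_setI.
  by move/trivIsetP : tF => /(_ _ _ _ _ ij) ->//; rewrite preimage_set0.
- by rewrite -preimage_bigcup -[X in measurable X]setTI; exact: mf.
Qed.

HB.instance Definition _ := isMeasure.Build _ _ _ nu nu0 nu_ge0 nu_additive.

Let nu_sigma_finite : sigma_finite setT nu.
Proof.
have [F TF Foo] := sigma_finiteT mu.
exists (fun i => g @^-1` (F i)).
  by rewrite -preimage_bigcup -TF preimage_setT.
move=> i; have [mFi Fioo] := Foo i; split.
  by rewrite -[X in measurable X]setTI; exact: mg.
rewrite /transport /pushforward -comp_preimage (_ : _ \o _ = id)//.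
by apply/funext => x /=; rewrite fK.
Qed.

HB.instance Definition _ :=
  @Measure_isSigmaFinite.Build _ _ _ nu nu_sigma_finite.

Definition transport_measure : {sigma_finite_measure set T2 -> \bar R} := nu.

End sigma_finite_transport.

(* m1 \x m2 under a name of its own: the library's sigma-finite instance for
   product_measure1 is only inferred for finite measures. *)
Section prod_measure.
Context {d1 d2} {T1 : measurableType d1} {T2 : measurableType d2}.
Context {R : realType}.
Variable m1 : {sigma_finite_measure set T1 -> \bar R}.
Variable m2 : {sigma_finite_measure set T2 -> \bar R}.

Definition prod_measure : set (T1 * T2) -> \bar R := (m1 \x m2)%E.

HB.instance Definition _ := Measure.on prod_measure.

Let prod_measure_sigma_finite : sigma_finite setT prod_measure.
Proof.
have /sigma_finiteP[F [TF ndF Foo]] := sigma_finiteT m1.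
have /sigma_finiteP[G [TG ndG Goo]] := sigma_finiteT m2.
exists (fun n => F n `*` G n).
  rewrite -setXTT TF TG predeqE => -[x y]; split.
    move=> [/= [n _ Fnx] [k _ Gky]]; exists (maxn n k) => //; split.
    - by move: x Fnx; exact/subsetPset/ndF/leq_maxl.
    - by move: y Gky; exact/subsetPset/ndG/leq_maxr.
  by move=> [n _ []/= ? ?]; split; exists n.
move=> k; have [? ?] := Foo k; have [? ?] := Goo k.
split; first exact: measurableX.
by rewrite /prod_measure product_measure1E// lte_mul_pinfty// ge0_fin_numE.
Qed.

HB.instance Definition _ :=
  Measure_isSigmaFinite.Build _ _ _ prod_measure prod_measure_sigma_finite.

Definition sigma_finite_prod :
  {sigma_finite_measure set (T1 * T2)%type -> \bar R} := prod_measure.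

End prod_measure.

Section lebesgue_measure_Rn.
Context {R : realType}.

(* measurableTypeR R is R, with the same measurable sets, under the display
   used by lebesgue_measure. *)
Definition tuple_cons n (p : measurableTypeR R * n.-tuple R) : n.+1.-tuple R :=
  [tuple of (p.1 : R) :: p.2].
Definition tuple_uncons n (t : n.+1.-tuple R) : measurableTypeR R * n.-tuple R :=
  (thead t, [tuple of behead t]).

Lemma tuple_consK n : cancel (@tuple_cons n) (@tuple_uncons n).
Proof.
move=> [x t]; rewrite /tuple_uncons /tuple_cons /= theadE; congr pair.
exact: val_inj.
Qed.

Lemma measurable_tuple_cons n : measurable_fun setT (@tuple_cons n).
Proof.
apply: (@measurable_cons _ _ _ R (fst : measurableTypeR R * n.-tuple R -> R)).
  exact: measurable_fst.
exact: measurable_snd.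
Qed.

Lemma measurable_tuple_uncons n : measurable_fun setT (@tuple_uncons n).
Proof.
apply/measurable_fun_pairP; split.
  exact: (@measurable_tnth _ R n.+1 ord0).
exact: (@measurable_behead _ R n).
Qed.

Fixpoint lebesgue_tuple n : {sigma_finite_measure set (n.-tuple R) -> \bar R} :=
  match n with
  | 0 => dirac [tuple]
  | n'.+1 => transport_measure (sigma_finite_prod (@lebesgue_measure R) (lebesgue_tuple n'))
      (@measurable_tuple_cons n') (@measurable_tuple_uncons n')
      (@tuple_consK n')
  end.

Definition lebesgue_row n : {sigma_finite_measure set 'rV[R]_n -> \bar R} :=
  transport_measure (lebesgue_tuple n) (@measurable_row_of_tuple _ R n)
    (@measurable_tuple_of_row _ R n) (@row_of_tupleK R n).

End lebesgue_measure_Rn.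

Section special_functions.
Context {R : realType}.
Local Notation mu := (@lebesgue_measure R).

(* Euler's integral: the Gamma function for a > 0. *)
Definition Gamma (a : R) : R :=
  \int[mu]_(t in `]0, +oo[) (t `^ (a - 1) * expR (- t)).

(* I_nu(z) = \sum_j (z/2)^(2j+nu) / (j! Gamma(nu+j+1)), for nu > -1 and z > 0. *)
Definition besselI (nu z : R) : R :=
  limn (series (fun j : nat =>
    (z / 2) `^ (j.*2%:R + nu) / (j`!%:R * Gamma (nu + j.+1%:R)))).

Definition I_kernel (nu x y : R) : R := Num.sqrt (x * y) * besselI nu (x * y).

(* F is the I-transform of order nu of f on (0,oo), the defining (Lebesgue)
   integral being convergent at every y > 0. Read from F to f, this says that f
   is an inverse I-transform of F. *)
Definition is_I_transform (nu : R) (f F : R -> R) : Prop :=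
  forall y : R, 0 < y ->
    mu.-integrable `]0, +oo[ (fun x => (f x * I_kernel nu x y)%:E) /\
    F y = \int[mu]_(x in `]0, +oo[) (f x * I_kernel nu x y).

End special_functions.

Section normal_mean.
Context {R : realType} (k : nat).
Implicit Types (x theta : 'rV[R]_k) (delta : 'rV[R]_k -> 'rV[R]_k).

Local Notation leb := (@lebesgue_row R k).

(* Squared Euclidean norm (the library's norm on 'rV_k is the sup norm). *)
Definition sqnorm x : R := \sum_(i < k) x ord0 i ^+ 2.

(* Density of N_k(theta, I_k). *)
Definition gauss_pdf theta x : R :=
  (2 * pi) `^ (- (k%:R / 2)) * expR (- (sqnorm (x - theta) / 2)).

Definition risk theta delta : \bar R :=
  \int[leb]_x (sqnorm (delta x - theta) * gauss_pdf theta x)%:E.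

Definition sup_risk delta : \bar R :=
  ereal_sup [set risk theta delta | theta in [set: 'rV[R]_k]].

Definition minimax delta : Prop :=
  measurable_fun setT delta /\
  sup_risk delta = ereal_inf
    [set sup_risk delta' | delta' in [set d | measurable_fun setT d]].

(* The spherical (generalized) prior with Lebesgue density g(|theta|^2): a
   nonnegative, nonzero density of finite or infinite mass. *)
Definition spherical_prior (g : R -> R) : Prop :=
  [/\ measurable_fun (`[0, +oo[ : set R) g,
      forall t, 0 <= t -> 0 <= g t &
      (0 < \int[leb]_theta (g (sqnorm theta))%:E)%E].

Definition radial_density (g : R -> R) (r : R) : R :=
  2 * pi `^ (k%:R / 2) / Gamma (k%:R / 2) * r ^+ k.-1 * g (r ^+ 2).

Definition marginal (g : R -> R) x : R :=
  fine (\int[leb]_theta (gauss_pdf theta x * g (sqnorm theta))%:E).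

Definition gradient (h : 'rV[R]_k -> R) x : 'rV[R]_k :=
  \row_(i < k) 'D_(delta_mx ord0 i) h x.

Definition bayes_estimator (g : R -> R) x : 'rV[R]_k :=
  x + gradient (fun y => ln (marginal g y)) x.

Definition bayes_risk (g : R -> R) delta : \bar R :=
  \int[leb]_theta (risk theta delta * (g (sqnorm theta))%:E)%E.

Definition radial_weight (lambda : R -> R) (r : R) : R :=
  r `^ ((1 - k%:R) / 2) * expR (- (r ^+ 2 / 2)) * lambda r.

Definition radial_unweight (f : R -> R) (r : R) : R :=
  r `^ ((k%:R - 1) / 2) * expR (r ^+ 2 / 2) * f r.

(* The inequality, required wherever the quotients F'/F and F''/F make sense;
   since t / 0 = 0 the guard F u != 0 cannot be left implicit. *)
Definition minimaxity_condition (F : R -> R) : Prop :=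
  forall u : R, 0 < u -> F u != 0 ->
    derive1n 2 F u / F u - 1 / 2 * (derive1 F u / F u) ^+ 2
    + derive1 F u / F u * ((k%:R - 1) / 2 * (1 / u) - u)
    + (k%:R - 1) * (7 - 3 * k%:R) / 8 * (1 / u ^+ 2)
    + 1 / 2 * u ^+ 2 - (k%:R + 1) / 2 <= 0.

Definition nonpositive_generalized_series (phi : R -> R) : Prop :=
  exists b : nat -> R, forall u : R, 0 < u ->
    [/\ cvgn (series (fun j : nat => b j * u ^+ j)),
        phi u = 1 / u ^+ 2 * limn (series (fun j : nat => b j * u ^+ j)) &
        phi u <= 0].

Definition ode_solution (phi z : R -> R) : Prop :=
  forall u : R, 0 < u ->
    [/\ derivable z u 1, derivable (derive1 z) u 1 &
        derive1n 2 z u + (k%:R - 1) / u * derive1 z u - 1 / 2 * phi u * z u = 0].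

Definition linearly_independent (z1 z2 : R -> R) : Prop :=
  forall a1 a2 : R, (forall u, 0 < u -> a1 * z1 u + a2 * z2 u = 0) ->
    a1 = 0 /\ a2 = 0.

Definition squared_solution (z1 z2 : R -> R) (c1 c2 u : R) : R :=
  (c1 * z1 u + c2 * z2 u) ^+ 2 * u `^ ((k%:R - 1) / 2) * expR (u ^+ 2 / 2).

End normal_mean.

Arguments bayes_estimator {R} k g x.

(* Main.v *)
(* Write t = |x|^2.  In polar coordinates the marginal is C e^(-t/2) P(t), where P
   is an everywhere convergent power series with nonnegative coefficients, and F is
   A u^((k-1)/2) P(u^2): up to a constant, F(u) = m(u) u^((k-1)/2) e^(u^2/2), with
   m the marginal as a function of the radius.  Under this substitution the
   condition on F says that sqrt(m) is superharmonic; for m = z^2 its left-hand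
   side is 2 (z'' + (k-1) z'/u) / z = phi, which settles the second part.

   The Bayes estimator is (1 + c(t)) x with c = 2 P'/P - 1, and the condition reads
   k c + 2 t c' + t c^2 / 2 <= 0, the nonpositivity of Stein's unbiased estimate of
   the risk minus k.  Rather than by integrating by parts, the bound risk <= k is
   obtained by comparing the integral of c(|x|^2) times the Gaussian density with
   that of its dilation by s > 1 and letting s tend to 1; no integrability of c' is
   needed.  Gaussian priors of growing variance show that no estimator has a
   maximal risk below k.

   A function with zero I-transform has, once multiplied by r^((k-1)/2), zero even
   moments, hence a zero cosine transform, hence zero integrals against the
   polynomials in cos (c r); a Hausdorff moment argument then gives zero integrals
   over the intervals [0, b[. *)

Require Import Defs.
From HB Require Import structures.
From mathcomp Require Import all_boot all_order all_algebra.
From mathcomp Require Import all_classical all_reals all_analysis.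
From mathcomp Require Import measurable_realfun ring lra.
Import Order.TTheory GRing.Theory Num.Theory.
Import numFieldNormedType.Exports.

Set Implicit Arguments.
Unset Strict Implicit.
Unset Printing Implicit Defensive.

Local Open Scope classical_set_scope.
Local Open Scope ring_scope.

(** * Determination by moments *)

(** The main obstacle is to pass from the iterated product measure on ['rV_k] to radial integrals.
    Distributions on [0, 1] with equal moments coincide; in the variable [expR (- |y|^2)] the
    moments of both sides of the polar formula are Gaussian integrals with closed forms, because the
    Gamma factors produced by the radial integrals cancel those of the Bessel coefficients. The
    injectivity of the I-transform uses the same principle with another bounded variable, so it is
    proved first, for two arbitrary measure spaces. The condition acts through [K(r) = r^k c(r^2)]:
    it makes [K] nonincreasing from [K(0) = 0], so [c <= 0], while the nonnegative coefficients of
    [P] give [c >= -1]. The bound [|c| <= 1] makes every expectation finite. The sign of [c] lets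
    the dilation formula for nonnegative integrands apply, and makes [e^u >= 1 + u] act in the
    useful direction. Since an integral transform sees functions up to null sets only, the formula
    for the radial density becomes an equivalence with an almost everywhere equality, and one of its
    directions is injectivity. *)

Lemma cvg_n_geometric (R : realType) (q : R) : 0 <= q < 1 ->
  n%:R * q ^+ n @[n --> \oo] --> 0.
Proof.
move=> /andP[q0 q1].
have [->|qn0] := eqVneq q 0.
  apply: cvg_near_cst; exists 1%N => // -[//|n] _ /=.
  by rewrite expr0n mulr0.
have {}q0 : 0 < q by rewrite lt_neqAle eq_sym qn0.
(* With [q = s ^+ 2], Bernoulli bounds [n s^n] by the constant [C], and the other factor [s^n] tends
   to 0. *)
pose s := Num.sqrt q.
have s0 : 0 < s by rewrite sqrtr_gt0.
have s1 : s < 1 by rewrite -sqrtr1 ltr_sqrt.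
have sq : q = s ^+ 2 by rewrite sqr_sqrtr ?ltW.
have si1 : 1 < s^-1 by rewrite invf_gt1.
have bern n : n%:R * (s^-1 - 1) <= s^-1 ^+ n.
  elim: n => [|n ih]; first by rewrite mul0r expr0.
  have h1 : 1 <= s^-1 ^+ n by rewrite exprn_ege1// ltW.
  rewrite exprSr -natr1 mulrDl mul1r.
  have : (s^-1 - 1) <= s^-1 ^+ n * (s^-1 - 1).
    by rewrite ler_peMl// subr_ge0 ltW.
  rewrite mulrBr mulr1 => h2; lra.
pose C := (s^-1 - 1)^-1.
have C0 : 0 < s^-1 - 1 by rewrite subr_gt0.
apply: (@squeeze_cvgr _ _ _ _ (cst 0) (fun n => C * s ^+ n)).
- apply: nearW => n; rewrite mulr_ge0 ?exprn_ge0 ?(ltW q0)//=.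
  have h : n%:R * (s^-1 - 1) * s ^+ n <= 1.
    by rewrite -ler_pdivlMr ?exprn_gt0// mul1r -exprVn.
  rewrite /C [leRHS]mulrC ler_pdivlMr// sq -exprM mulnC exprM expr2.
  have := ler_wpM2r (exprn_ge0 n (ltW s0)) h; rewrite mul1r.
  by apply: le_trans; rewrite le_eqVlt; apply/orP; left; apply/eqP; ring.
- exact: cvg_cst.
- by apply: (@cvg_geometric R C); rewrite ger0_norm// ltW.
Qed.

Lemma cvg_expRNn (R : realType) : expR (- n%:R) @[n --> \oo] --> (0 : R).
Proof. exact: (cvg_comp _ _ (@cvgr_idn R) (@cvgr_expR R)). Qed.

Definition test_exponent (R : realType) (a : R) (n : nat) : nat :=
  (Num.truncn (n%:R / a ^+ n)).+1.

(* [N = n / a^n] makes [N w^n] tend to [0] below [a] and to [+oo] from [a] on. *)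
Lemma cvg_test_polynomial (R : realType) (a w : R) : 0 < a <= 1 -> 0 <= w <= 1 ->
  (1 - w ^+ n) ^+ test_exponent a n @[n --> \oo] --> ((w < a)%R%:R : R).
Proof.
move=> /andP[a0 a1] /andP[w0 w1].
have wn n : 0 <= w ^+ n <= 1 by rewrite exprn_ge0//= exprn_ile1.
have N0 n : 0 <= n%:R / a ^+ n by rewrite divr_ge0// exprn_ge0// ltW.
have [wa|aw] := ltP w a.
(* Below [a]: [N <= n / a^n + 1], so [N w^n] is at most [n (w / a)^n + w^n], which tends to 0, and
   Bernoulli bounds the power from below by 1 minus it. *)
- have bern (x : R) N : 0 <= x <= 1 -> 1 - N%:R * x <= (1 - x) ^+ N.
    move=> /andP[x0 x1]; elim: N => [|N ih]; first by rewrite mul0r subr0 expr0.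
    rewrite exprS -natr1; apply: (@le_trans _ _ ((1 - x) * (1 - N%:R * x))).
      have : 0 <= N%:R * x * x by rewrite !mulr_ge0.
      lra.
    by rewrite ler_wpM2l// subr_ge0.
  have w1' : w < 1 by exact: lt_le_trans a1.
  apply: (@squeeze_cvgr _ _ _ _
    (fun n => 1 - (n%:R * (w / a) ^+ n + w ^+ n)) (cst 1)).
  + apply: nearW => n; have /andP[h0 h1] := wn n; apply/andP; split; last first.
      by rewrite exprn_ile1 ?subr_ge0// gerBl.
    apply: le_trans (bern _ _ (wn n)).
    rewrite lerD2l lerN2 expr_div_n -natr1 mulrDl mul1r lerD2r.
    rewrite mulrCA [leRHS]mulrC ler_wpM2r//.
    by have /andP[] := truncn_itv (N0 n).
  + rewrite -[X in _ --> X]subr0 -[X in _ - X]addr0.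
    apply: cvgB; first exact: cvg_cst.
    apply: cvgD.
      by apply: cvg_n_geometric; rewrite divr_ge0// ?(ltW a0)//= ltr_pdivrMr ?mul1r.
    have := @cvg_geometric R 1 w; rewrite ger0_norm// => /(_ w1').
    rewrite /geometric/=; under eq_fun do rewrite mul1r; exact.
  + exact: cvg_cst.
(* From [a] on: [(1 - x)^N <= e^(- N x)], and [N w^n >= n] since the successor in [test_exponent]
   rounds [n / a^n] up. *)
- apply: (@squeeze_cvgr _ _ _ _ (cst 0) (fun n => expR (- n%:R))).
  + apply: nearW => n; have /andP[h0 h1] := wn n.
    rewrite exprn_ge0 ?subr_ge0//=.
    apply: (@le_trans _ _ (expR (- w ^+ n) ^+ test_exponent a n)).
      by rewrite lerXn2r ?nnegrE ?subr_ge0 ?expR_ge0// expR_ge1Dx.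
    rewrite -expRM_natl ler_expR mulrN lerN2.
    apply: (@le_trans _ _ ((n%:R / a ^+ n) * w ^+ n)); last first.
      rewrite ler_wpM2r// ltW//; have /andP[_ h] := truncn_itv (N0 n); exact: h.
    rewrite mulrAC -mulrA -expr_div_n ler_peMr// exprn_ege1//.
    by rewrite ler_pdivlMr// mul1r.
  + exact: cvg_cst.
  + exact: cvg_expRNn.
Qed.

Section density_measure.
Context d (T : measurableType d) (R : realType).
Variables (mu : {sigma_finite_measure set T -> \bar R}) (h : T -> R).
Hypotheses (h0 : forall x, 0 <= h x) (ih : mu.-integrable setT (EFin \o h)).

(** The two proofs are arguments, so that the term itself carries what its measure and
    finite-measure instances rest on. *)
Definition density_measure (_ : forall x, 0 <= h x)
  (_ : mu.-integrable setT (EFin \o h)) (A : set T) : \bar R :=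
  (\int[mu]_(x in A) (h x)%:E)%E.
Local Notation nu := (density_measure h0 ih).

Let nu0 : nu set0 = 0%E.
Proof. exact: integral_set0. Qed.

Let nu_ge0 A : (0 <= nu A)%E.
Proof. by apply: integral_ge0 => x _; rewrite lee_fin. Qed.

Let nu_additive : semi_sigma_additive nu.
Proof.
move=> A mA tA mUA; rewrite /density_measure ge0_integral_bigcup//=; last 2 first.
- apply: (measurable_funS measurableT) => //; exact: measurable_int ih.
- by move=> x _; rewrite lee_fin.
by apply: is_cvg_ereal_nneg_natsum_cond => n _ _; exact: nu_ge0.
Qed.

HB.instance Definition _ :=
  isMeasure.Build _ _ _ nu nu0 nu_ge0 nu_additive.

Let nu_fin : fin_num_fun nu.
Proof.
move=> A mA; rewrite /density_measure; apply: integrable_fin_num => //.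
exact: integrableS ih.
Qed.

HB.instance Definition _ :=
  Measure_isFinite.Build _ _ _ nu nu_fin.

(** [h] and the Radon-Nikodym derivative of [nu] have the same integral over every measurable set,
    hence agree almost everywhere; the change of variables formula for the derivative then applies
    to [h]. *)
Lemma integral_density_measure (f : T -> \bar R) :
  (forall x, 0 <= f x)%E -> measurable_fun setT f ->
  (\int[nu]_x f x = \int[mu]_x (f x * (h x)%:E))%E.
Proof.
move=> f0 mf.
have dom : nu `<< mu.
  apply/null_content_dominatesP => A mA muA0.
  apply: null_set_integral => //; apply: measurable_funTS.
  exact: measurable_int ih.
rewrite -(Radon_Nikodym_SigmaFinite.change_of_variables dom)//.
have mRN := Radon_Nikodym_SigmaFinite.f_integrable dom.
have mh := measurable_int _ ih.
apply: ae_eq_integral => //.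
- by apply: emeasurable_funM => //; exact: measurable_int mRN.
- exact: emeasurable_funM.
apply: ae_eqe_mul2l; apply: integral_ae_eq => // E _ mE.
by rewrite -Radon_Nikodym_SigmaFinite.f_integral.
Qed.

End density_measure.

Section eq_rays.
Context d1 d2 (T1 : measurableType d1) (T2 : measurableType d2) (R : realType).
Variables (mu1 : {sigma_finite_measure set T1 -> \bar R})
          (mu2 : {sigma_finite_measure set T2 -> \bar R}).
Variables (h1 : T1 -> R) (h2 : T2 -> R) (w1 : T1 -> R) (w2 : T2 -> R).
Hypotheses (ih1 : mu1.-integrable setT (EFin \o h1))
           (ih2 : mu2.-integrable setT (EFin \o h2)).
Hypotheses (mw1 : measurable_fun setT w1) (mw2 : measurable_fun setT w2).
Hypotheses (h1_ge0 : forall x, 0 <= h1 x) (h2_ge0 : forall x, 0 <= h2 x).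
Hypothesis rays : forall a, \int[mu1]_(x in [set x | w1 x < a]) h1 x =
  \int[mu2]_(x in [set x | w2 x < a]) h2 x.

(** The hypothesis [rays] says that two finite measures on R, the pushforwards of the densities by
    [w1] and [w2], agree on open rays. These generate the Borel sets and are stable under
    intersection, so the measures are equal. *)
Lemma eq_integral_rays (H : R -> \bar R) :
  (forall t, 0 <= H t)%E -> measurable_fun setT H ->
  (\int[mu1]_x (H (w1 x) * (h1 x)%:E) = \int[mu2]_x (H (w2 x) * (h2 x)%:E))%E.
Proof.
move=> H0 mH.
rewrite -(integral_density_measure h1_ge0 ih1)//; last exact: measurableT_comp.
rewrite -(integral_density_measure h2_ge0 ih2)//; last exact: measurableT_comp.
pose nu1 := pushforward (density_measure h1_ge0 ih1) w1.
pose nu2 := pushforward (density_measure h2_ge0 ih2) w2.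
have -> : (\int[density_measure h1_ge0 ih1]_x H (w1 x) = \int[nu1]_x H x)%E.
  by rewrite /nu1 ge0_integral_pushforward//= preimage_setT.
have -> : (\int[density_measure h2_ge0 ih2]_x H (w2 x) = \int[nu2]_x H x)%E.
  by rewrite /nu2 ge0_integral_pushforward//= preimage_setT.
apply: eq_measure_integral => A mA _.
apply: (measure_unique (@RGenInftyO.G R) (fun n => `]-oo, n%:R[%classic)) => //.
- exact: RGenInftyO.measurableE.
- move=> _ _ [x ->] [y ->]; exists (Num.min x y).
  by apply/seteqP; split => z /=; rewrite !in_itv/= lt_min => /andP.
- by move=> n; exists n%:R.
- apply/seteqP; split => // x _; exists (Num.truncn `|x|).+1 => //=.
  by rewrite in_itv/= (le_lt_trans (ler_norm x))// truncnS_gt.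
- move=> _ [a ->].
  have fE d (T : measurableType d) (mu : {sigma_finite_measure set T -> \bar R})
      (h w : T -> R) (h0 : forall x, 0 <= h x)
      (ih : mu.-integrable setT (EFin \o h)) : measurable_fun setT w ->
      pushforward (density_measure h0 ih) w `]-oo, a[ =
      (\int[mu]_(x in [set x | w x < a]) h x)%:E.
    move=> mw; have mA' : measurable [set x | w x < a].
      by rewrite -[X in measurable X]setTI; exact: measurable_fun_ltr.
    rewrite fineK; last first.
      by apply: integrable_fin_num => //; exact: integrableS ih.
    rewrite /pushforward /density_measure.
    have -> // : w @^-1` `]-oo, a[%classic = [set x | w x < a].
    by apply/seteqP; split => x /=; rewrite in_itv.
  transitivity (nu1 `]-oo, a[%classic) => //.
  transitivity (nu2 `]-oo, a[%classic) => //.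
  by rewrite /nu1 /nu2 !fE// rays.
- move=> n; rewrite /= /pushforward/=.
  by rewrite ltey_eq fin_num_measure// -[X in measurable X]setTI; exact: mw1.
Qed.

End eq_rays.

Section hausdorff_moment.
Context d1 d2 (T1 : measurableType d1) (T2 : measurableType d2) (R : realType).
Variables (mu1 : {sigma_finite_measure set T1 -> \bar R})
          (mu2 : {sigma_finite_measure set T2 -> \bar R}).
Variables (h1 : T1 -> R) (h2 : T2 -> R) (w1 : T1 -> R) (w2 : T2 -> R).
Hypotheses (ih1 : mu1.-integrable setT (EFin \o h1))
           (ih2 : mu2.-integrable setT (EFin \o h2)).
Hypotheses (mw1 : measurable_fun setT w1) (mw2 : measurable_fun setT w2).
Hypotheses (w1_01 : forall x, 0 <= w1 x <= 1) (w2_01 : forall x, 0 <= w2 x <= 1).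
Hypothesis moments : forall n,
  \int[mu1]_x (h1 x * w1 x ^+ n) = \int[mu2]_x (h2 x * w2 x ^+ n).

Lemma integrable_mul_bounded d (T : measurableType d)
    (mu : {sigma_finite_measure set T -> \bar R}) (h g : T -> R) (M : R) :
  mu.-integrable setT (EFin \o h) -> measurable_fun setT g ->
  (forall x, `|g x| <= M) -> mu.-integrable setT (EFin \o (fun x => h x * g x)).
Proof.
move=> ih mg gM.
apply: (@le_integrable _ _ _ _ _ _ _ (EFin \o (fun x => M * h x))) => //.
- apply/measurable_EFinP; apply: measurable_funM => //.
  by apply/measurable_EFinP; exact: measurable_int ih.
- move=> x _ /=; rewrite lee_fin !normrM mulrC ler_wpM2r//.
  by rewrite (le_trans (gM x))// ler_norm.
- rewrite (_ : _ \o _ = (fun x => M%:E * (h x)%:E)%E); last by [].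
  exact: integrableZl.
Qed.

(** The extra factor [w ^+ n] makes the induction close: [p * 'X + c%:P] at [n] calls for [p] at
    [n.+1]. *)
Let poly_moment (p : {poly R}) n :
  \int[mu1]_x (h1 x * (p.[w1 x] * w1 x ^+ n)) =
  \int[mu2]_x (h2 x * (p.[w2 x] * w2 x ^+ n)).
Proof.
have key d (T : measurableType d) (mu : {sigma_finite_measure set T -> \bar R})
    (h w : T -> R) (q : {poly R}) m : mu.-integrable setT (EFin \o h) ->
    measurable_fun setT w -> (forall x, 0 <= w x <= 1) ->
    mu.-integrable setT (EFin \o (fun x => h x * (q.[w x] * w x ^+ m))).
  move=> ih mw w01.
  have -> : (fun x => h x * (q.[w x] * w x ^+ m)) =
            (fun x => h x * (q * 'X^m).[w x]).
    by apply/funext => x; rewrite hornerM hornerXn.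
  apply: (@integrable_mul_bounded _ _ _ _ _ (\sum_(i < size (q * 'X^m)) `|(q * 'X^m)`_i|)) => //.
    apply: measurableT_comp => //; apply: continuous_measurable_fun.
    exact: continuous_horner.
  move=> x; have /andP[x0 x1] := w01 x.
  rewrite horner_coef (le_trans (ler_norm_sum _ _ _))// ler_sum// => i _.
  by rewrite normrM ler_piMr// ger0_norm ?exprn_ge0 ?exprn_ile1.
elim/poly_ind: p n => [|p c IH] n.
  by under eq_Rintegral do rewrite horner0 mul0r mulr0; rewrite Rintegral_cst// mul0r;
     under eq_Rintegral do rewrite horner0 mul0r mulr0; rewrite Rintegral_cst// mul0r.
have e d (T : measurableType d) (mu : {sigma_finite_measure set T -> \bar R})
    (h w : T -> R) : mu.-integrable setT (EFin \o h) ->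
    measurable_fun setT w -> (forall x, 0 <= w x <= 1) ->
    \int[mu]_x (h x * ((p * 'X + c%:P).[w x] * w x ^+ n)) =
    \int[mu]_x (h x * (p.[w x] * w x ^+ n.+1)) + c * \int[mu]_x (h x * w x ^+ n).
  move=> ih mw w01.
  have i2 : mu.-integrable setT (EFin \o (fun x => h x * w x ^+ n)).
    have := key _ _ _ _ _ 1 n ih mw w01.
    by rewrite (_ : (fun x => _) = (fun x => h x * w x ^+ n))//;
      apply/funext => x; rewrite hornerC mul1r.
  rewrite -RintegralZl// -RintegralD//; last 2 first.
  - exact: key.
  - by rewrite (_ : _ \o _ = (fun x => c%:E * (h x * w x ^+ n)%:E)%E)//; exact: integrableZl.
  apply: eq_Rintegral => x _; rewrite hornerMXaddC exprS. ring.
by rewrite !e// IH moments.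
Qed.

(** The polynomials [(1 - X^n)^N] lie between 0 and 1 on [0, 1] and tend pointwise to the indicator
    of [0, a[, so dominated convergence turns moments into integrals over rays. The densities may be
    signed here, as in the cosine transform argument. *)
Lemma hausdorff_ray (a : R) : 0 < a <= 1 ->
  \int[mu1]_(x in [set x | w1 x < a]) h1 x =
  \int[mu2]_(x in [set x | w2 x < a]) h2 x.
Proof.
move=> a01.
pose q n : {poly R} := (1 - 'X^n) ^+ test_exponent a n.
have key d (T : measurableType d) (mu : {sigma_finite_measure set T -> \bar R})
    (h w : T -> R) : mu.-integrable setT (EFin \o h) ->
    measurable_fun setT w -> (forall x, 0 <= w x <= 1) ->
    \int[mu]_x (h x * ((q n).[w x] * w x ^+ 0)) @[n --> \oo] -->
    \int[mu]_(x in [set x | w x < a]) h x.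
  move=> ih mw w01.
  have qE n x : (q n).[x] = (1 - x ^+ n) ^+ test_exponent a n.
    by rewrite !hornerE.
  have mh : measurable_fun setT h by apply/measurable_EFinP; exact: measurable_int ih.
  have mq n : measurable_fun setT (fun x => (q n).[w x]).
    apply: measurableT_comp => //; apply: continuous_measurable_fun.
    exact: continuous_horner.
  have mA : measurable [set x | w x < a].
    by rewrite -[X in measurable X]setTI; exact: measurable_fun_ltr.
  rewrite [X in _ --> X]Rintegral_mkcond.
  have lim_f : {ae mu, forall x, setT x ->
     (h x * ((q n).[w x] * w x ^+ 0))%:E @[n --> \oo] -->
     ((h \_ [set x | w x < a]) x)%:E}.
    apply: aeW => x _; apply: cvg_EFin; first exact: nearW.
    rewrite patchE; under eq_fun do rewrite /= expr0 mulr1 qE.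
    rewrite (_ : (if _ then _ else _) = h x * (w x < a)%R%:R).
      by apply: cvgMr => //; apply: cvg_test_polynomial.
    case: ifPn => [/[!inE]/= ->|]; first by rewrite mulr1.
    by rewrite notin_setE/= => /negP/negbTE ->; rewrite mulr0.
  have mf_ n : measurable_fun setT (fun x => (h x * ((q n).[w x] * w x ^+ 0))%:E).
    apply/measurable_EFinP; apply: measurable_funM => //.
    by under eq_fun do rewrite expr0 mulr1; exact: mq.
  have mf : measurable_fun setT (fun x => ((h \_ [set x | w x < a]) x)%:E).
    apply/measurable_EFinP; rewrite patch_indic.
    exact: measurable_funM.
  have ia : mu.-integrable setT (fun x => `|h x|%:E) by exact: integrable_abse ih.
  have dom : {ae mu, forall x, forall n : nat, setT x ->
      (`|(h x * ((q n).[w x] * w x ^+ 0))%:E| <= `|h x|%:E)%E}.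
    apply: aeW => x n _; rewrite lee_fin normrM ler_piMr//.
    rewrite expr0 mulr1 qE; have /andP[x0 x1] := w01 x.
    have h1' : 0 <= 1 - w x ^+ n by rewrite subr_ge0 exprn_ile1.
    by rewrite ger0_norm ?exprn_ge0// exprn_ile1// gerBl exprn_ge0.
  have [ig _] := dominated_convergence measurableT mf_ mf lim_f ia dom.
  rewrite -(fineK (integrable_fin_num measurableT ig)) => /fine_cvg; exact.
have c1 := key _ _ _ _ _ ih1 mw1 w1_01.
have c2 := key _ _ _ _ _ ih2 mw2 w2_01.
move: c1; under eq_fun do rewrite poly_moment.
move=> c1.
exact: cvg_unique c1 c2.
Qed.

Hypotheses (h1_ge0 : forall x, 0 <= h1 x) (h2_ge0 : forall x, 0 <= h2 x).

Lemma hausdorff_moment (H : R -> \bar R) :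
  (forall t, 0 <= H t)%E -> measurable_fun setT H ->
  (\int[mu1]_x (H (w1 x) * (h1 x)%:E) = \int[mu2]_x (H (w2 x) * (h2 x)%:E))%E.
Proof.
apply: eq_integral_rays => // a.
have [a0|a0] := leP a 0.
  have e d (T : measurableType d) (w : T -> R) : (forall x, 0 <= w x <= 1) ->
      [set x | w x < a] = set0.
    move=> w01; apply/seteqP; split => // x /= wa.
    by have /andP[w0 _] := w01 x; have := le_lt_trans (le_trans a0 w0) wa; rewrite ltxx.
  by rewrite !e// !Rintegral_set0.
have [a1|a1] := leP a 1; first by apply: hausdorff_ray; rewrite a0.
have e d (T : measurableType d) (w : T -> R) : (forall x, 0 <= w x <= 1) ->
    [set x | w x < a] = setT.
  move=> w01; apply/seteqP; split => // x _ /=.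
  by have /andP[_ /le_lt_trans] := w01 x; exact.
rewrite !e//; have := moments 0.
under eq_Rintegral do rewrite expr0 mulr1.
by under [X in _ = X]eq_Rintegral do rewrite expr0 mulr1.
Qed.

End hausdorff_moment.

(** * Lebesgue integral on row vectors *)

Section lebesgue_row_integral.
Context {R : realType}.
Local Notation leb := (@lebesgue_measure R).
Implicit Types (n : nat).

Lemma ge0_integral_row n (f : 'rV[R]_n -> \bar R) :
  measurable_fun setT f -> (forall x, 0 <= f x)%E ->
  (\int[lebesgue_row n]_x f x = \int[lebesgue_tuple n]_t f (row_of_tuple t))%E.
Proof.
move=> mf f0.
transitivity (\int[pushforward (lebesgue_tuple n) (@row_of_tuple R n)]_x f x)%E => //.
by rewrite ge0_integral_pushforward//=; exact: measurable_row_of_tuple.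
Qed.

Lemma ge0_integral_tupleS n (f : n.+1.-tuple R -> \bar R) :
  measurable_fun setT f -> (forall x, 0 <= f x)%E ->
  (\int[lebesgue_tuple n.+1]_t f t =
   \int[leb]_x \int[lebesgue_tuple n]_t f [tuple of (x : R) :: t])%E.
Proof.
move=> mf f0.
pose pm := prod_measure leb (@lebesgue_tuple R n).
transitivity (\int[pushforward pm (@tuple_cons R n)]_x f x)%E => //.
rewrite ge0_integral_pushforward//=; last exact: measurable_tuple_cons.
transitivity (\int[(leb \x @lebesgue_tuple R n)]_z (f \o @tuple_cons R n) z)%E => //.
rewrite fubini_tonelli1//.
by apply: measurableT_comp => //; exact: measurable_tuple_cons.
by move=> x /=.
Qed.

Lemma integral_tuple_prod n (f : 'I_n -> R -> R) (c : 'I_n -> R) :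
  (forall i x, 0 <= f i x) -> (forall i, measurable_fun setT (f i)) ->
  (forall i, \int[leb]_x (f i x)%:E = (c i)%:E)%E ->
  (\int[lebesgue_tuple n]_t (\prod_(i < n) f i (tnth t i))%:E =
   (\prod_(i < n) c i)%:E)%E.
Proof.
elim: n f c => [|n IH] f c f0 mf fc.
  rewrite big_ord0; under eq_integral do rewrite big_ord0.
  by rewrite integral_dirac// diracT mul1e.
have mp m (g : 'I_m -> R -> R) : (forall i, measurable_fun setT (g i)) ->
    measurable_fun setT (fun t : m.-tuple R => (\prod_(i < m) g i (tnth t i))%:E).
  move=> mg; apply/measurable_EFinP; apply: measurable_prod => i _.
  by apply: measurableT_comp => //; exact: measurable_tnth.
rewrite ge0_integral_tupleS//; last 2 first.
- exact: mp.
- by move=> t; rewrite lee_fin prodr_ge0.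
have c0 i : 0 <= c i.
  by rewrite -lee_fin -fc integral_ge0// => x _; rewrite lee_fin.
transitivity (\int[leb]_x ((f ord0 x)%:E * (\prod_(i < n) c (lift ord0 i))%:E))%E.
  apply: eq_integral => x _.
  rewrite -(IH (fun i => f (lift ord0 i)))//.
  rewrite -ge0_integralZl//; last 3 first.
  - exact: (mp n (fun i => f (lift ord0 i))).
  - by move=> t _; rewrite lee_fin prodr_ge0.
  - by rewrite lee_fin.
  apply: eq_integral => t _; rewrite big_ord_recl tnth0 EFinM.
  congr (_ * _%:E)%E.
  by apply: eq_bigr => i _; rewrite tnthS.
rewrite (@ge0_integralZr _ _ _ leb setT measurableT (fun x => (f ord0 x)%:E))//=; last 3 first.
- by apply/measurable_EFinP; exact: mf.
- by move=> x _; rewrite lee_fin.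
- by rewrite lee_fin prodr_ge0.
by rewrite fc -EFinM big_ord_recl.
Qed.

(** By uniqueness of Lebesgue measure: the rescaled pushforward agrees with it on half-open
    intervals. *)
Lemma lebesgue_measure_scale (s : R) (A : set R) : 0 < s -> measurable A ->
  leb A = (s%:E * leb ((fun x => s * x)%R @^-1` A))%E.
Proof.
move=> s0 mA.
have ms : measurable_fun (setT : set (measurableTypeR R)) ((fun x => s * x) : measurableTypeR R -> measurableTypeR R).
  exact: measurable_funM.
pose m := mscale (NngNum (ltW s0)) (measure_function_pushforward__canonical__measure_function_Measure leb ms).
have -> : (s%:E * leb ((fun x => s * x)%R @^-1` A) = m A)%E by [].
apply: lebesgue_measure_unique => // _ [[a b]] _ <-.
have em : m `]a, b]%classic = (s%:E * leb `](a / s)%R, (b / s)%R]%classic)%E.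
  congr (_ * leb _)%E; apply/seteqP; split => x /=; rewrite !in_itv/= ltr_pdivrMr// ler_pdivlMr//.
    by rewrite [s * x]mulrC.
  by rewrite [x * s]mulrC.
rewrite [RHS]em !lebesgue_measure_itv/= !lte_fin ltr_pM2r ?invr_gt0//.
case: ifPn => _; last by rewrite mule0.
by rewrite -!EFinB -EFinM mulrBr ![s * _]mulrC !divfK// gt_eqF.
Qed.

Lemma ge0_integral_scale (s : R) (f : R -> \bar R) : 0 < s ->
  measurable_fun setT f -> (forall x, 0 <= f x)%E ->
  (\int[leb]_x f x = s%:E * \int[leb]_x f (s * x)%R)%E.
Proof.
move=> s0 mf f0.
have ms : measurable_fun (setT : set (measurableTypeR R)) ((fun x => s * x) : measurableTypeR R -> measurableTypeR R).
  exact: measurable_funM.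
transitivity (\int[mscale (NngNum (ltW s0)) (measure_function_pushforward__canonical__measure_function_Measure leb ms)]_x f x)%E.
  by apply: eq_measure_integral => A mA _; exact: lebesgue_measure_scale.
by rewrite ge0_integral_mscale//= ge0_integral_pushforward//= preimage_setT.
Qed.

Lemma ge0_integral_tuple_scale n (s : R) (f : n.-tuple R -> \bar R) : 0 < s ->
  measurable_fun setT f -> (forall x, 0 <= f x)%E ->
  (\int[lebesgue_tuple n]_t f t =
   (s ^+ n)%:E * \int[lebesgue_tuple n]_t f [tuple of map ( *%R s) t])%E.
Proof.
move=> s0; elim: n f => [|n IH] f mf f0.
  rewrite expr0 mul1e; apply: eq_integral => t _; congr f.
  by rewrite (tuple0 t); exact/val_inj.
have mmap m : measurable_fun setT (fun t : m.-tuple R => [tuple of map ( *%R s) t]).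
  apply/measurable_fun_tnthP => i.
  rewrite (_ : _ \o _ = fun t : m.-tuple R => s * tnth t i); last first.
    by apply/funext => t /=; rewrite tnth_map.
  by apply: measurable_funM => //; exact: measurable_tnth.
rewrite !ge0_integral_tupleS//; last exact: (measurableT_comp mf (mmap _)).
have mF (g : R * n.-tuple R -> \bar R) : measurable_fun setT g -> (forall z, 0 <= g z)%E ->
    measurable_fun (setT : set R) (fun x => \int[lebesgue_tuple n]_t g (x, t))%E.
  by move=> mg g0; exact: (measurable_fun_fubini_tonelli_F (m2 := lebesgue_tuple n) g).
pose G (x : R) := (\int[lebesgue_tuple n]_t f [tuple of x :: map ( *%R s) t])%E.
have mG : measurable_fun setT G.
  apply: (mF (fun z => f [tuple of z.1 :: map ( *%R s) z.2])) => //.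
  apply: (measurableT_comp mf).
  apply: (@measurable_cons _ _ _ R (fst : R * n.-tuple R -> R) n (fun z => [tuple of map ( *%R s) z.2])) => //.
  exact: (measurableT_comp (mmap n)).
have G0 x : (0 <= G x)%E by exact: integral_ge0.
transitivity (\int[leb]_x ((s ^+ n)%:E * G x))%E.
  apply: eq_integral => x _; apply: (IH (fun t => f [tuple of x :: t])) => //.
  apply: (measurableT_comp mf).
  exact: (@measurable_cons _ _ _ R (cst (x : R)) n id).
have -> : (\int[leb]_x ((s ^+ n)%:E * G x) = (s ^+ n)%:E * \int[leb]_x G x)%E.
  by apply: ge0_integralZl => //; rewrite lee_fin exprn_ge0// ltW.
rewrite exprSr EFinM -muleA; congr (_ * _)%E.
rewrite (ge0_integral_scale s0 mG G0); congr (_ * _)%E.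
apply: eq_integral => x _; apply: eq_integral => t _; congr f.
exact/val_inj.
Qed.

Lemma measurable_coord n (i : 'I_n) :
  measurable_fun setT (fun x : 'rV[R]_n => x ord0 i).
Proof.
rewrite (_ : (fun _ => _) = (fun x => tnth (tuple_of_row x) i)); last first.
  by apply/funext => x; rewrite tnth_mktuple.
exact: (measurableT_comp (measurable_tnth i) (@measurable_tuple_of_row _ R n)).
Qed.

Lemma measurable_rowP d (T : measurableType d) n (f : T -> 'rV[R]_n) :
  (forall i, measurable_fun setT (fun x => f x ord0 i)) -> measurable_fun setT f.
Proof.
move=> mf; have h : measurable_fun setT (@tuple_of_row R n \o f).
  apply/measurable_fun_tnthP => i.
  rewrite (_ : _ \o _ = fun x => f x ord0 i)//.
  by apply/funext => x; rewrite /= tnth_mktuple.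
by move=> _ _ [B mB <-]; rewrite !setTI -comp_preimage -[X in measurable X]setTI; exact: h.
Qed.

Lemma ge0_integral_row_scale n (s : R) (f : 'rV[R]_n -> \bar R) : 0 < s ->
  measurable_fun setT f -> (forall x, 0 <= f x)%E ->
  (\int[lebesgue_row n]_x f x =
   (s ^+ n)%:E * \int[lebesgue_row n]_x f (s *: x))%E.
Proof.
move=> s0 mf f0.
have mZ : measurable_fun setT (fun x : 'rV[R]_n => s *: x).
  apply: measurable_rowP => i; under eq_fun do rewrite mxE.
  by apply: measurable_funM => //; exact: measurable_coord.
rewrite !ge0_integral_row//; last exact: measurableT_comp.
rewrite (ge0_integral_tuple_scale s0)//; last first.
  by apply: measurableT_comp => //; exact: measurable_row_of_tuple.
congr (_ * _)%E; apply: eq_integral => t _; congr f.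
by apply/rowP => i; rewrite !mxE tnth_map.
Qed.

Lemma integral_row_prod n (f : 'I_n -> R -> R) (c : 'I_n -> R) :
  (forall i x, 0 <= f i x) -> (forall i, measurable_fun setT (f i)) ->
  (forall i, \int[leb]_x (f i x)%:E = (c i)%:E)%E ->
  (\int[lebesgue_row n]_x (\prod_(i < n) f i (x ord0 i))%:E =
   (\prod_(i < n) c i)%:E)%E.
Proof.
move=> f0 mf fc; rewrite ge0_integral_row//; last 2 first.
- apply/measurable_EFinP; apply: measurable_prod => i _.
  by apply: measurableT_comp => //; exact: measurable_coord.
- by move=> x; rewrite lee_fin prodr_ge0.
rewrite -(integral_tuple_prod f0 mf fc); apply: eq_integral => t _.
by congr EFin; apply: eq_bigr => i _; rewrite mxE.
Qed.

End lebesgue_row_integral.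

(** * Gaussian integrals *)

Section gaussian_integrals.
Context {R : realType}.
Local Notation leb := (@lebesgue_measure R).
Implicit Types a m d : R.

(** Unnormalised Gaussian density with mean [m] and variance [1 / (2 a)]. Using the rate [a] as
    parameter turns products of such weights into sums of rates. *)
Definition gaussw a m (x : R) : R := expR (- (a * (x - m) ^+ 2)).

Lemma gaussw_ge0 a m x : 0 <= gaussw a m x. Proof. exact: expR_ge0. Qed.

Lemma measurable_sub_sqr m : measurable_fun setT (fun x : R => (x - m) ^+ 2).
Proof. by apply: measurable_funX; exact: measurable_funB. Qed.

Lemma measurable_gaussw a m : measurable_fun setT (gaussw a m).
Proof.
apply: measurableT_comp => //; apply: measurableT_comp => //.
by apply: measurable_funM => //; exact: measurable_sub_sqr.
Qed.

Lemma sqr_gaussw_ge0 a m d x : 0 <= (x - d) ^+ 2 * gaussw a m x.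
Proof. by rewrite mulr_ge0 ?sqr_ge0 ?gaussw_ge0. Qed.

Lemma integral_gaussw a m : 0 < a ->
  (\int[leb]_x (gaussw a m x)%:E = (Num.sqrt (pi / a))%:E)%E.
Proof.
move=> a0; pose s : R := (Num.sqrt (2 * a))^-1.
have s0 : s != 0 by rewrite invr_eq0 sqrtr_eq0 -ltNge mulr_gt0.
have s2 : s ^+ 2 = (2 * a)^-1 by rewrite exprVn sqr_sqrtr// mulr_ge0// ltW.
have /esym := integral_normal_pdf m s; rewrite normal_pdfE//.
under eq_integral do rewrite EFinM.
rewrite ge0_integralZl//=; last 3 first.
- by apply/measurable_EFinP; exact: measurable_normal_fun.
- by move=> x _; rewrite lee_fin normal_fun_ge0.
- by rewrite lee_fin normal_peak_ge0.
have -> : (\int[leb]_x (normal_fun m s x)%:E = \int[leb]_x (gaussw a m x)%:E)%E.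
  apply: eq_integral => x _; congr (expR _)%:E; rewrite s2.
  by rewrite mulNr mulrC; congr (- (_ * _)); rewrite -mulr_natr; field; rewrite gt_eqF.
rewrite /normal_peak s2 (_ : _ *+ 2 = pi / a); last first.
  by rewrite -mulr_natr; field; rewrite gt_eqF.
have q0 : Num.sqrt (pi / a) != 0 :> R by rewrite sqrtr_eq0 -ltNge divr_gt0// pi_gt0.
move=> /(congr1 (fun z => (Num.sqrt (pi / a))%:E * z)%E).
by rewrite mule1 muleA -EFinM divff// mul1e.
Qed.

Lemma sqrtr_pi_div a : 0 < a -> Num.sqrt (pi / a) = Num.sqrt pi / Num.sqrt a.
Proof.
by move=> a0; rewrite sqrtrM ?pi_ge0// sqrtrV// ltW.
Qed.

(* Both bounds on the second moment come from [y <= (e^(s y) - 1) / s] and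
   [(1 - e^(- s y)) / s <= y], which only involve Gaussian integrals. *)
Lemma gaussw_moment_le a m : 0 < a ->
  (\int[leb]_x ((x - m) ^+ 2 * gaussw a m x)%:E <=
   (Num.sqrt (pi / a) / (2 * a))%:E)%E.
Proof.
move=> a0.
have m2 : measurable_fun setT (fun x : R => ((x - m) ^+ 2 * gaussw a m x)%:E).
  apply/measurable_EFinP; apply: measurable_funM; first exact: measurable_sub_sqr.
  exact: measurable_gaussw.
have I0 : (0 <= \int[leb]_x ((x - m) ^+ 2 * gaussw a m x)%:E)%E.
  by apply: integral_ge0 => x _; rewrite lee_fin sqr_gaussw_ge0.
(* Here [s = a - b]: multiplying [gaussw a m] by [e^((a - b) y)], with [y = (x - m)^2], lowers the
   rate to [b]. *)
have key b : 0 < b < a ->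
    (((a - b)%:E * \int[leb]_x ((x - m) ^+ 2 * gaussw a m x)%:E) +
     (Num.sqrt (pi / a))%:E <= (Num.sqrt (pi / b))%:E)%E.
  move=> /andP[b0 ba]; rewrite -(integral_gaussw m a0) -(integral_gaussw m b0).
  rewrite -ge0_integralZl//; last 2 first.
  - by move=> x _; rewrite lee_fin sqr_gaussw_ge0.
  - by rewrite lee_fin subr_ge0 ltW.
  rewrite -ge0_integralD//; last 4 first.
  - move=> x _; rewrite -EFinM lee_fin mulr_ge0 ?sqr_gaussw_ge0//.
    by rewrite subr_ge0 ltW.
  - exact: measurable_funeM.
  - by move=> x _; rewrite lee_fin gaussw_ge0.
  - by apply/measurable_EFinP; exact: measurable_gaussw.
  apply: ge0_le_integral => //.
  - move=> x _; rewrite -EFinM -EFinD lee_fin addr_ge0 ?gaussw_ge0//.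
    by rewrite mulr_ge0 ?sqr_gaussw_ge0// subr_ge0 ltW.
  - apply: emeasurable_funD; first exact: measurable_funeM.
    by apply/measurable_EFinP; exact: measurable_gaussw.
  - by apply/measurable_EFinP; exact: measurable_gaussw.
  - move=> x _; rewrite -EFinM -EFinD lee_fin.
    rewrite [leRHS](_ : _ = expR ((a - b) * (x - m) ^+ 2) * gaussw a m x); last first.
      by rewrite /gaussw -expRD; congr expR; ring.
    rewrite mulrA -[X in _ + X]mul1r -mulrDl ler_wpM2r ?gaussw_ge0//.
    by rewrite addrC expR_ge1Dx.
have fI : (\int[leb]_x ((x - m) ^+ 2 * gaussw a m x)%:E)%E \is a fin_num.
  rewrite ge0_fin_numE//; have b0 : 0 < a / 2 < a.
    by rewrite divr_gt0//= ltr_pdivrMr// ltr_pMr// ltr1n.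
  have := key _ b0; rewrite -leeBrDr//; case: (\int[leb]_x _)%E I0 => [r|_|]//=.
    by rewrite ltry.
  rewrite gt0_muley; last by rewrite lte_fin subr_gt0; case/andP: b0.
  by rewrite leye_eq.
move: fI key; case: (\int[leb]_x _)%E => [I _|//|//] key.
rewrite lee_fin.
have A0 : 0 < Num.sqrt a by rewrite sqrtr_gt0.
have P0 : 0 < Num.sqrt pi :> R by rewrite sqrtr_gt0 pi_gt0.
have AA : Num.sqrt a ^+ 2 = a by rewrite sqr_sqrtr// ltW.
(* In terms of [A = sqrt a] and [B = sqrt b] both sides contain the factor [A - B]. Cancelling it
   leaves an inequality that is continuous at [B = A], where the limit is taken. *)
have key2 (B : R) : 0 < B < Num.sqrt a -> I * (Num.sqrt a * B * (Num.sqrt a + B)) <= Num.sqrt pi.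
  move=> /andP[B0 BA]; have ba : 0 < B ^+ 2 < a.
    by rewrite exprn_gt0//= -AA ltrXn2r// ?nnegrE ltW.
  have := key _ ba; rewrite -EFinM -EFinD lee_fin.
  have b0 : 0 < B ^+ 2 by case/andP: ba.
  rewrite !sqrtr_pi_div// (sqrtr_sqr B) (gtr0_norm B0) -{1}AA.
  set A := Num.sqrt a in A0 BA *; set P := Num.sqrt pi in P0 *.
  move=> h.
  have h2 : (A - B) * (I * (A * B * (A + B))) <= (A - B) * P.
    have -> : (A - B) * P = (P / B - P / A) * (A * B).
      by field; rewrite !gt_eqF.
    have -> : (A - B) * (I * (A * B * (A + B))) = (A ^+ 2 - B ^+ 2) * I * (A * B) by ring.
    by rewrite ler_pM2r ?mulr_gt0// lerBrDr.
  by move: h2; rewrite ler_pM2l// subr_gt0.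
rewrite sqrtr_pi_div// -{2}AA.
set A := Num.sqrt a in A0 key2 *; set P := Num.sqrt pi in P0 key2 *.
suff h : I * (A * A * (A + A)) <= P.
  by rewrite -mulrA -invfM ler_pdivlMr ?mulr_gt0 ?exprn_gt0// (le_trans _ h)// le_eqVlt; apply/orP; left; apply/eqP; ring.
apply: (@cvgr_to_le _ (A^'-) _ _ (fun B => I * (A * B * (A + B)))).
  apply: cvg_at_left_filter; apply: cvgM; first exact: cvg_cst.
  by apply: cvgM; [apply: cvgM; [exact: cvg_cst|exact: cvg_id]|apply: cvgD; [exact: cvg_cst|exact: cvg_id]].
near=> B; apply: key2; apply/andP; split; near: B.
  exact: nbhs_left_gt.
exact: nbhs_left_lt.
Unshelve. all: by end_near. Qed.

Lemma gaussw_moment_ge a m d : 0 < a ->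
  ((Num.sqrt (pi / a) / (2 * a))%:E <=
   \int[leb]_x ((x - d) ^+ 2 * gaussw a m x)%:E)%E.
Proof.
move=> a0.
have m2 : measurable_fun setT (fun x : R => ((x - d) ^+ 2 * gaussw a m x)%:E).
  apply/measurable_EFinP; apply: measurable_funM; first exact: measurable_sub_sqr.
  exact: measurable_gaussw.
have I0 : (0 <= \int[leb]_x ((x - d) ^+ 2 * gaussw a m x)%:E)%E.
  by apply: integral_ge0 => x _; rewrite lee_fin sqr_gaussw_ge0.
have key b : a < b ->
    ((Num.sqrt (pi / a))%:E <=
    ((b - a)%:E * \int[leb]_x ((x - d) ^+ 2 * gaussw a m x)%:E) +
     (Num.sqrt (pi / b))%:E)%E.
  move=> ab; have b0 := lt_trans a0 ab.
  (* Completing the square: [a (x - m)^2 + (b - a) (x - d)^2] equals [b (x - m')^2] plus the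
     nonnegative [(b - a) a / b (m - d)^2]. Dropping the latter allows an arbitrary centre [d]. *)
  pose m' := (a * m + (b - a) * d) / b.
  rewrite -(integral_gaussw m a0) -(integral_gaussw m' b0).
  rewrite -ge0_integralZl//; last 2 first.
  - by move=> x _; rewrite lee_fin sqr_gaussw_ge0.
  - by rewrite lee_fin subr_ge0 ltW.
  rewrite -ge0_integralD//; last 4 first.
  - move=> x _; rewrite -EFinM lee_fin mulr_ge0 ?sqr_gaussw_ge0//.
    by rewrite subr_ge0 ltW.
  - exact: measurable_funeM.
  - by move=> x _; rewrite lee_fin gaussw_ge0.
  - by apply/measurable_EFinP; exact: measurable_gaussw.
  apply: ge0_le_integral => //.
  - by move=> x _; rewrite lee_fin gaussw_ge0.
  - by apply/measurable_EFinP; exact: measurable_gaussw.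
  - apply: emeasurable_funD; first exact: measurable_funeM.
    by apply/measurable_EFinP; exact: measurable_gaussw.
  - move=> x _; rewrite -EFinM -EFinD lee_fin.
    apply: (@le_trans _ _ ((b - a) * ((x - d) ^+ 2 * gaussw a m x) +
       expR (- ((b - a) * (x - d) ^+ 2)) * gaussw a m x)).
      rewrite mulrA -mulrDl ler_peMl ?gaussw_ge0//.
      have := expR_ge1Dx (- ((b - a) * (x - d) ^+ 2)); lra.
    rewrite lerD2l /gaussw -expRD ler_expR -opprD lerN2.
    rewrite -subr_ge0 (_ : _ - _ = (b - a) * a / b * (m - d) ^+ 2); last first.
      by rewrite /m'; field; rewrite gt_eqF.
    by rewrite mulr_ge0 ?sqr_ge0// divr_ge0 ?(ltW b0)// mulr_ge0 ?subr_ge0 ?(ltW a0) ?(ltW ab).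
move: I0 key; case: (\int[leb]_x _)%E => [I _|_|//] key; last by rewrite leey.
rewrite lee_fin.
have A0 : 0 < Num.sqrt a by rewrite sqrtr_gt0.
have P0 : 0 < Num.sqrt pi :> R by rewrite sqrtr_gt0 pi_gt0.
have AA : Num.sqrt a ^+ 2 = a by rewrite sqr_sqrtr// ltW.
have key2 (B : R) : Num.sqrt a < B -> Num.sqrt pi <= I * (Num.sqrt a * B * (Num.sqrt a + B)).
  move=> AB; have B0 := lt_trans A0 AB; have ba : a < B ^+ 2.
    by rewrite -AA ltrXn2r// ?nnegrE ltW.
  have := key _ ba; rewrite -EFinM -EFinD lee_fin.
  have b0 : 0 < B ^+ 2 by rewrite exprn_gt0.
  rewrite !sqrtr_pi_div// (sqrtr_sqr B) (gtr0_norm B0) -{2}AA.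
  set A := Num.sqrt a in A0 AB *; set P := Num.sqrt pi in P0 *.
  move=> h.
  have h2 : (B - A) * P <= (B - A) * (I * (A * B * (A + B))).
    have -> : (B - A) * P = (P / A - P / B) * (A * B).
      by field; rewrite !gt_eqF.
    have -> : (B - A) * (I * (A * B * (A + B))) = (B ^+ 2 - A ^+ 2) * I * (A * B) by ring.
    by rewrite ler_pM2r ?mulr_gt0// lerBlDr.
  by move: h2; rewrite ler_pM2l// subr_gt0.
rewrite sqrtr_pi_div// -{2}AA.
set A := Num.sqrt a in A0 key2 *; set P := Num.sqrt pi in P0 key2 *.
suff h : P <= I * (A * A * (A + A)).
  by rewrite -mulrA -invfM ler_pdivrMr ?mulr_gt0 ?exprn_gt0// (le_trans h)// le_eqVlt; apply/orP; left; apply/eqP; ring.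
apply: (@cvgr_to_ge _ (A^'+) _ _ (fun B => I * (A * B * (A + B)))).
  apply: cvg_at_right_filter; apply: cvgM; first exact: cvg_cst.
  by apply: cvgM; [apply: cvgM; [exact: cvg_cst|exact: cvg_id]|apply: cvgD; [exact: cvg_cst|exact: cvg_id]].
near=> B; apply: key2; near: B; exact: nbhs_right_gt.
Unshelve. all: by end_near. Qed.

End gaussian_integrals.

(** * Gaussian vectors and the lower bound on the maximal risk *)

Section gaussian_row.
Context {R : realType}.
Local Notation leb := (@lebesgue_measure R).

Lemma sqnorm_ge0 n (x : 'rV[R]_n) : 0 <= sqnorm x.
Proof. by apply: sumr_ge0 => i _; exact: sqr_ge0. Qed.

Lemma sqnormN n (x : 'rV[R]_n) : sqnorm (- x) = sqnorm x.
Proof. by apply: eq_bigr => i _; rewrite mxE sqrrN. Qed.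

Lemma measurable_sqnorm d (T : measurableType d) n (f : T -> 'rV[R]_n) :
  (forall i, measurable_fun setT (fun x => f x ord0 i)) ->
  measurable_fun setT (fun x => sqnorm (f x)).
Proof.
move=> mf; rewrite /sqnorm; apply: measurable_sum => i.
by apply: measurable_funX; exact: mf.
Qed.

Lemma measurable_sqnorm_sub n (m : 'rV[R]_n) :
  measurable_fun setT (fun x : 'rV[R]_n => sqnorm (x - m)).
Proof.
apply: measurable_sqnorm => i; under eq_fun do rewrite mxE.
by apply: measurable_funD => //; exact: measurable_coord.
Qed.

Lemma measurable_gauss_row n a (m : 'rV[R]_n) :
  measurable_fun setT (fun x : 'rV[R]_n => expR (- (a * sqnorm (x - m)))).
Proof.
apply: measurableT_comp => //; apply: measurableT_comp => //.
by apply: measurable_funM => //; exact: measurable_sqnorm_sub.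
Qed.

Lemma prod_gaussw n a (m x : 'rV[R]_n) :
  \prod_(i < n) gaussw a (m ord0 i) (x ord0 i) = expR (- (a * sqnorm (x - m))).
Proof.
rewrite /gaussw -expR_sum sumrN -mulr_sumr; congr (expR (- (_ * _))).
by apply: eq_bigr => i _; rewrite !mxE.
Qed.

Lemma integral_gauss_row n a (m : 'rV[R]_n) : 0 < a ->
  (\int[lebesgue_row n]_x (expR (- (a * sqnorm (x - m))))%:E =
   (Num.sqrt (pi / a) ^+ n)%:E)%E.
Proof.
move=> a0.
transitivity (\int[lebesgue_row n]_x (\prod_(i < n) gaussw a (m ord0 i) (x ord0 i))%:E)%E.
  by apply: eq_integral => x _; rewrite prod_gaussw.
rewrite (@integral_row_prod _ _ (fun i => gaussw a (m ord0 i)) (fun=> Num.sqrt (pi / a)))//.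
- by rewrite prodr_const card_ord.
- by move=> i x; exact: gaussw_ge0.
- by move=> i; exact: measurable_gaussw.
- by move=> i; exact: integral_gaussw.
Qed.

(** The lower bound at an arbitrary centre serves the Bayes lower bound, where [d] is an estimate;
    the upper bound at [d = m] serves the risk of the observation itself. *)
Lemma gaussw_moment a (m d : R) : 0 < a -> exists M : R,
  [/\ (\int[leb]_x ((x - d) ^+ 2 * gaussw a m x)%:E = M%:E)%E,
      Num.sqrt (pi / a) / (2 * a) <= M &
      d = m -> M <= Num.sqrt (pi / a) / (2 * a)].
Proof.
move=> a0.
have mg c : measurable_fun setT (fun x : R => ((x - c) ^+ 2 * gaussw a m x)%:E).
  apply/measurable_EFinP; apply: measurable_funM; first exact: measurable_sub_sqr.
  exact: measurable_gaussw.
have I0 : (0 <= \int[leb]_x ((x - d) ^+ 2 * gaussw a m x)%:E)%E.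
  by apply: integral_ge0 => x _; rewrite lee_fin sqr_gaussw_ge0.
have fin : (\int[leb]_x ((x - d) ^+ 2 * gaussw a m x)%:E < +oo)%E.
  apply: (@le_lt_trans _ _ (2%:E * (\int[leb]_x ((x - m) ^+ 2 * gaussw a m x)%:E) +
     (2 * (m - d) ^+ 2)%:E * (\int[leb]_x (gaussw a m x)%:E))%E).
    have mw : measurable_fun setT (fun x => (gaussw a m x)%:E).
      by apply/measurable_EFinP; exact: measurable_gaussw.
    have md0 : 0 <= 2 * (m - d) ^+ 2 by rewrite mulr_ge0// sqr_ge0.
    rewrite -!ge0_integralZl//;
      try by [exact: mg|move=> x _; rewrite lee_fin ?gaussw_ge0 ?sqr_gaussw_ge0].
    rewrite -ge0_integralD//; last 4 first.
    - by move=> x _; rewrite -EFinM lee_fin mulr_ge0 ?sqr_gaussw_ge0.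
    - by apply: measurable_funeM; exact: mg.
    - by move=> x _; rewrite -EFinM lee_fin mulr_ge0 ?gaussw_ge0.
    - exact: measurable_funeM.
    apply: ge0_le_integral => //.
    - by move=> x _; rewrite lee_fin sqr_gaussw_ge0.
    - exact: mg.
    - by apply: emeasurable_funD; apply: measurable_funeM => //; exact: mg.
    - move=> x _; rewrite -!EFinM -EFinD lee_fin mulrA -mulrDl.
      rewrite ler_wpM2r ?gaussw_ge0//.
      rewrite -subr_ge0 (_ : _ - _ = (x - m - (m - d)) ^+ 2) ?sqr_ge0//; ring.
  rewrite integral_gaussw// lte_add_pinfty//.
    by rewrite lte_mul_pinfty// (le_lt_trans (gaussw_moment_le _ a0))// ltry.
  by rewrite -EFinM ltry.
exists (fine (\int[leb]_x ((x - d) ^+ 2 * gaussw a m x)%:E)%E).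
have fE : (\int[leb]_x ((x - d) ^+ 2 * gaussw a m x)%:E)%E \is a fin_num.
  by rewrite ge0_fin_numE.
split; first by rewrite fineK.
- by rewrite -lee_fin fineK// gaussw_moment_ge.
- by move=> dm; rewrite -lee_fin fineK// dm gaussw_moment_le.
Qed.

Lemma gauss_row_moment n a (m d : 'rV[R]_n) : 0 < a -> exists M : R,
  [/\ (\int[lebesgue_row n]_x (sqnorm (x - d) * expR (- (a * sqnorm (x - m))))%:E = M%:E)%E,
      n%:R / (2 * a) * Num.sqrt (pi / a) ^+ n <= M &
      d = m -> M <= n%:R / (2 * a) * Num.sqrt (pi / a) ^+ n].
Proof.
move=> a0; set q := Num.sqrt (pi / a).
have q0 : 0 <= q by exact: sqrtr_ge0.
have /choice[M HM] : forall i : 'I_n, exists M : R,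
  [/\ (\int[leb]_x ((x - d ord0 i) ^+ 2 * gaussw a (m ord0 i) x)%:E = M%:E)%E,
      q / (2 * a) <= M & d ord0 i = m ord0 i -> M <= q / (2 * a)].
  by move=> i; exact: gaussw_moment.
have nE (c : R) (i : 'I_n) : c * q / (2 * a) * q ^+ n.-1 = c / (2 * a) * q ^+ n.
  have n0 : (0 < n)%N by case: n i {m d M HM} => [[]|].
  by rewrite -{2}(prednK n0) exprS; ring.
have mg (i : 'I_n) : measurable_fun setT (fun x : 'rV[R]_n => ((x ord0 i - d ord0 i) ^+ 2 *
    \prod_(j < n) gaussw a (m ord0 j) (x ord0 j))%:E).
  apply/measurable_EFinP; apply: measurable_funM.
    apply: (measurableT_comp (measurable_sub_sqr _)); exact: measurable_coord.
  apply: measurable_prod => j _; apply: measurableT_comp; first exact: measurable_gaussw.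
  exact: measurable_coord.
exists (\sum_(i < n) (M i * q ^+ n.-1)); split.
- transitivity (\int[lebesgue_row n]_x (\sum_(i < n) ((x ord0 i - d ord0 i) ^+ 2 *
      \prod_(j < n) gaussw a (m ord0 j) (x ord0 j))%:E))%E.
    apply: eq_integral => x _; rewrite prod_gaussw sumEFin -mulr_suml.
    by congr (_ * _)%:E; apply: eq_bigr => i _; rewrite !mxE.
  rewrite ge0_integral_sum//; last first.
    move=> i x _; rewrite lee_fin mulr_ge0 ?sqr_ge0//.
    by apply: prodr_ge0 => j _; exact: gaussw_ge0.
  rewrite -sumEFin; apply: eq_bigr => i _.
  (* The squared deviation is absorbed into the [i]-th factor, so that the integral is again one of
     a product of functions of single coordinates. *)
  transitivity (\int[lebesgue_row n]_x (\prod_(j < n) ((if j == i then (x ord0 j - d ord0 i) ^+ 2 else 1) * gaussw a (m ord0 j) (x ord0 j)))%:E)%E.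
    apply: eq_integral => x _; congr (_%:E); rewrite big_split/= [X in _ = X * _](bigD1 i)//= eqxx.
    by rewrite [X in _ = _ * X * _]big1 ?mulr1// => j /negbTE ->.
  rewrite (@integral_row_prod _ _ (fun j y => (if j == i then (y - d ord0 i) ^+ 2 else 1) * gaussw a (m ord0 j) y)
     (fun j => if j == i then M i else q)).
  + rewrite (bigD1 i)//= eqxx (eq_bigr (fun=> q)); last by move=> j /negbTE ->.
    by rewrite prodr_const cardC1 card_ord.
  + by move=> j y; rewrite mulr_ge0 ?gaussw_ge0//; case: ifP => // _; exact: sqr_ge0.
  + move=> j; apply: measurable_funM; last exact: measurable_gaussw.
    by case: (j == i) => //; exact: measurable_sub_sqr.
  + move=> j; have [->|ji] := eqVneq j i; first by have [] := HM i.
    by under eq_integral do rewrite mul1r; rewrite integral_gaussw.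
- rewrite (_ : _ * _ = \sum_(i < n) (q / (2 * a) * q ^+ n.-1)).
    apply: ler_sum => i _; rewrite ler_wpM2r ?exprn_ge0//.
    by have [] := HM i.
  rewrite (eq_bigr (fun=> (2 * a)^-1 * q ^+ n)); last first.
    by move=> i _; have := nE 1 i; rewrite !mul1r.
  by rewrite sumr_const card_ord -[RHS]mulr_natl mulrA.
- move=> dm; rewrite (_ : _ * _ = \sum_(i < n) (q / (2 * a) * q ^+ n.-1)).
    apply: ler_sum => i _; rewrite ler_wpM2r ?exprn_ge0//.
    by have [_ _] := HM i; apply; rewrite dm.
  rewrite (eq_bigr (fun=> (2 * a)^-1 * q ^+ n)); last first.
    by move=> i _; have := nE 1 i; rewrite !mul1r.
  by rewrite sumr_const card_ord -[RHS]mulr_natl mulrA.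
Qed.

Lemma gauss_const (k : nat) : (2 * pi) `^ (- (k%:R / 2)) = (Num.sqrt (2 * pi))^-1 ^+ k :> R.
Proof.
have p0 : 0 < 2 * pi :> R by rewrite mulr_gt0// pi_gt0.
rewrite powRN [k%:R / 2]mulrC powRrM powR12_sqrt ?ltW// powR_mulrn ?sqrtr_ge0//.
by rewrite exprVn.
Qed.

Lemma le_limit_1Dx (c r : R) : 0 <= r -> (forall b, 0 < b -> c <= r * (1 + b)) -> c <= r.
Proof.
move=> r0 h; rewrite leNgt; apply/negP => rc.
have b0 : 0 < (c - r) / (2 * (r + 1)).
  by rewrite divr_gt0 ?subr_gt0// mulr_gt0// ltr_wpDl.
have r1 : r + 1 != 0 by rewrite gt_eqF// ltr_wpDl.
have := h _ b0; set b := _ / _ in b0 *.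
have e : b * (2 * (r + 1)) = c - r by rewrite /b divfK// mulf_neq0.
have rb : 0 <= r * b by rewrite mulr_ge0// ltW.
move: e; rewrite !mulrDr => e; lra.
Qed.

(** The risk is integrated against [expR (- (b |th|^2))]. This is at most the maximal risk times the
    mass [Q]; after exchanging the integrals, the posterior is Gaussian, with variance
    [1 / (1 + 2 b)] in each coordinate, so it is at least [k / (1 + 2 b)] times [Q]. Then [b] tends
    to 0. *)
Lemma le_sup_risk k (delta : 'rV[R]_k -> 'rV[R]_k) : measurable_fun setT delta ->
  (k%:R%:E <= sup_risk delta)%E.
Proof.
move=> mdelta.
have risk_le th : (risk th delta <= sup_risk delta)%E by apply: ereal_sup_ubound; exists th.
have risk0 th : (0 <= risk th delta)%E.
  apply: integral_ge0 => x _; rewrite lee_fin mulr_ge0 ?sqnorm_ge0//.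
  by rewrite mulr_ge0 ?powR_ge0 ?expR_ge0.
have rho0 : (0 <= sup_risk delta)%E by rewrite (le_trans (risk0 0)).
have mcoord1 (i : 'I_k) : measurable_fun setT (fun z : 'rV[R]_k * 'rV[R]_k => z.1 ord0 i).
  exact: (measurableT_comp (measurable_coord i) measurable_fst).
have mcoord2 (i : 'I_k) : measurable_fun setT (fun z : 'rV[R]_k * 'rV[R]_k => z.2 ord0 i).
  exact: (measurableT_comp (measurable_coord i) measurable_snd).
have mdelta2 (i : 'I_k) : measurable_fun setT (fun z : 'rV[R]_k * 'rV[R]_k => delta z.2 ord0 i).
  apply: (measurableT_comp (measurable_coord i)); exact: (measurableT_comp mdelta).
have mrisk : measurable_fun setT (fun z : 'rV[R]_k * 'rV[R]_k =>
    (sqnorm (delta z.2 - z.1) * gauss_pdf z.1 z.2)%:E).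
  apply/measurable_EFinP; apply: measurable_funM.
    by apply: measurable_sqnorm => i; under eq_fun do rewrite !mxE; exact: measurable_funB.
  apply: measurable_funM => //; apply: measurableT_comp => //; apply: measurableT_comp => //.
  apply: measurable_funM => //.
  by apply: measurable_sqnorm => i; under eq_fun do rewrite !mxE; exact: measurable_funB.
have key b : 0 < b ->
    ((k%:R / (1 + 2 * b))%:E <= sup_risk delta)%E.
  move=> b0; have b1 : 0 < 1 + 2 * b by rewrite addr_gt0// mulr_gt0.
  pose w (th : 'rV[R]_k) := expR (- (b * sqnorm (th - 0))).
  have mw : measurable_fun setT w by exact: measurable_gauss_row.
  pose Q : R := Num.sqrt (pi / b) ^+ k.
  have Q0 : 0 < Q by rewrite exprn_gt0// sqrtr_gt0 divr_gt0// pi_gt0.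
  have iw : (\int[lebesgue_row k]_th (w th)%:E = Q%:E)%E by rewrite integral_gauss_row.
  pose f (z : 'rV[R]_k * 'rV[R]_k) :=
    ((sqnorm (delta z.2 - z.1) * gauss_pdf z.1 z.2)%:E * (w z.1)%:E)%E.
  have f0 z : (0 <= f z)%E.
    by rewrite /f -EFinM lee_fin !mulr_ge0 ?sqnorm_ge0 ?expR_ge0 ?powR_ge0.
  have mf : measurable_fun setT f.
    apply: emeasurable_funM => //; apply/measurable_EFinP.
    exact: (measurableT_comp mw).
  have upper : (\int[lebesgue_row k]_th \int[lebesgue_row k]_x f (th, x) <=
      sup_risk delta * Q%:E)%E.
    rewrite -iw -ge0_integralZl//; last 2 first.
    - exact/measurable_EFinP.
    - by move=> th _; rewrite lee_fin expR_ge0.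
    apply: ge0_le_integral => //.
    - by move=> th _; apply: integral_ge0.
    - exact: (measurable_fun_fubini_tonelli_F (m2 := lebesgue_row k) f).
    - by apply: measurable_funeM; exact/measurable_EFinP.
    - move=> th _; rewrite /f/= ge0_integralZr//; last 3 first.
      + exact: (measurableT_comp mrisk (pair1_measurable th)).
      + by move=> x _; rewrite lee_fin !mulr_ge0 ?sqnorm_ge0 ?expR_ge0 ?powR_ge0.
      + by rewrite lee_fin expR_ge0.
      by apply: lee_wpmul2r; [rewrite lee_fin expR_ge0|exact: risk_le].
  have lower : ((k%:R / (1 + 2 * b))%:E * Q%:E <=
      \int[lebesgue_row k]_x \int[lebesgue_row k]_th f (th, x))%E.
    (* Factorisation into marginal and posterior: [|x - th|^2 / 2 + b |th|^2 = be |x|^2 + a |th -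
       m|^2] with [m = x / (1 + 2 b)]. For fixed [x], [delta x] is just one centre for the posterior
       second moment, which is smallest about [m]. *)
    pose be := b / (1 + 2 * b).
    have be0 : 0 < be by rewrite divr_gt0.
    pose a := 1 / 2 + b.
    have a0 : 0 < a by rewrite addr_gt0.
    pose C : R := (2 * pi) `^ (- (k%:R / 2)).
    have C0 : 0 <= C by exact: powR_ge0.
    pose K := C * (k%:R / (2 * a) * Num.sqrt (pi / a) ^+ k).
    have K0 : 0 <= K.
      by rewrite mulr_ge0// mulr_ge0 ?exprn_ge0 ?sqrtr_ge0// divr_ge0// mulr_ge0// ltW.
    have KQ : k%:R / (1 + 2 * b) * Q = K * Num.sqrt (pi / be) ^+ k.
      have e1 : 2 * a = 1 + 2 * b by rewrite /a; field.
      rewrite /K /Q e1 /C gauss_const.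
      suff -> : Num.sqrt (pi / b) = (Num.sqrt (2 * pi))^-1 * Num.sqrt (pi / a) * Num.sqrt (pi / be).
        by rewrite !exprMn; ring.
      have p2 : 0 <= 2 * pi :> R by rewrite mulr_ge0// pi_ge0.
      rewrite -(sqrtrV p2) -!sqrtrM ?invr_ge0 ?mulr_ge0 ?pi_ge0 ?invr_ge0 ?(ltW a0)//.
      congr Num.sqrt; rewrite /be /a.
      move: (pi_gt0 R); move: (@pi R) => P P0; field.
      by rewrite !gt_eqF.
    rewrite -EFinM KQ EFinM -(@integral_gauss_row k be 0 be0) -ge0_integralZl//;
      try by [apply/measurable_EFinP; exact: measurable_gauss_row
             |move=> x _; rewrite lee_fin expR_ge0].
    apply: ge0_le_integral => //.
    - by move=> x _; rewrite -EFinM lee_fin mulr_ge0// expR_ge0.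
    - by apply: measurable_funeM; apply/measurable_EFinP; exact: measurable_gauss_row.
    - exact: (measurable_fun_fubini_tonelli_G (m1 := lebesgue_row k) f).
    - move=> x _.
      pose m : 'rV[R]_k := (1 + 2 * b)^-1 *: x.
      have -> : (\int[lebesgue_row k]_th f (th, x) = \int[lebesgue_row k]_th
         ((C * expR (- (be * sqnorm (x - 0))))%:E *
         (sqnorm (th - delta x) * expR (- (a * sqnorm (th - m))))%:E))%E.
        apply: eq_integral => th _; rewrite /f/= -!EFinM; congr EFin.
        rewrite /gauss_pdf -/C /w -(sqnormN (th - delta x)) opprB.
        suff e : expR (- (sqnorm (x - th) / 2)) * expR (- (b * sqnorm (th - 0))) =
            expR (- (be * sqnorm (x - 0))) * expR (- (a * sqnorm (th - m))).
          transitivity (C * sqnorm (delta x - th) * (expR (- (sqnorm (x - th) / 2)) * expR (- (b * sqnorm (th - 0))))).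
            by ring.
          by rewrite e; ring.
        rewrite -!expRD; congr expR; rewrite /sqnorm [X in - X + _]mulrC -!opprD.
        congr (- _); rewrite !mulr_sumr -!big_split/=; apply: eq_bigr => i _.
        by rewrite !mxE /be /a; field; rewrite gt_eqF.
      rewrite ge0_integralZl//; last 3 first.
      - apply/measurable_EFinP; apply: measurable_funM; first exact: measurable_sqnorm_sub.
        exact: measurable_gauss_row.
      - by move=> th _; rewrite lee_fin mulr_ge0 ?sqnorm_ge0 ?expR_ge0.
      - by rewrite lee_fin mulr_ge0// expR_ge0.
      have [M [-> HM _]] := gauss_row_moment m (delta x) a0.
      rewrite -!EFinM lee_fin /K mulrAC ler_wpM2l// mulr_ge0// expR_ge0.
  move: lower; rewrite -fubini_tonelli// => lower; have := le_trans lower upper.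
  have Qi0 : (0 <= (Q^-1)%:E)%E by rewrite lee_fin invr_ge0 ltW.
  move=> /(lee_wpmul2r Qi0).
  by rewrite -!muleA -!EFinM divff ?gt_eqF// mulr1 mule1.
move: rho0 key; case: (sup_risk delta) => [r|_ _|//]; last by rewrite leey.
rewrite lee_fin => r0 key; rewrite lee_fin; apply: le_limit_1Dx => // b b0.
have b2 : 0 < b / 2 by rewrite divr_gt0.
have := key _ b2; rewrite lee_fin mulrCA divff// mulr1 ler_pdivrMr// ltr_wpDl//.
Qed.

Lemma minimaxW k (delta : 'rV[R]_k -> 'rV[R]_k) : measurable_fun setT delta ->
  (forall th, risk th delta <= k%:R%:E)%E -> minimax delta.
Proof.
move=> md h; split => //; apply/eqP; rewrite eq_le; apply/andP; split.
  apply: (@le_trans _ _ k%:R%:E).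
    by apply: ge_ereal_sup => _ [th _ <-]; exact: h.
  by apply: le_ereal_inf_tmp => _ [d' md' <-]; exact: le_sup_risk.
by apply: ereal_inf_lbound; exists delta.
Qed.

End gaussian_row.

(** * The Gamma function *)

Section gamma_function.
Context {R : realType}.
Local Notation leb := (@lebesgue_measure R).

(** An exhaustion of the open half-line by compact intervals, on which substitution for continuous
    integrands is available. *)
Lemma bigcup_itv_pos (N : R) (u : nat -> R) : 0 < N -> (forall m, m.+1%:R <= u m) ->
  \bigcup_m `[N / u m, N * u m]%classic = `]0, +oo[%classic.
Proof.
move=> N0 hu; have u0 m : 0 < u m by rewrite (lt_le_trans _ (hu m)).
apply/seteqP; split => x /=.
  move=> [m _] /=; rewrite !in_itv/= andbT => /andP[+ _].
  by apply: lt_le_trans; rewrite divr_gt0.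
rewrite in_itv/= andbT => x0.
pose m := (Num.truncn (x / N) + Num.truncn (N / x))%N.
have h1 : x / N <= u m.
  apply: le_trans (hu m); apply: (@le_trans _ _ (Num.truncn (x / N)).+1%:R).
    by rewrite ltW// truncnS_gt.
  by rewrite ler_nat ltnS leq_addr.
have h2 : N / x <= u m.
  apply: le_trans (hu m); apply: (@le_trans _ _ (Num.truncn (N / x)).+1%:R).
    by rewrite ltW// truncnS_gt.
  by rewrite ler_nat ltnS leq_addl.
exists m => //=; rewrite in_itv/=; apply/andP; split.
  by rewrite ler_pdivrMr// mulrC -ler_pdivrMr.
by rewrite mulrC -ler_pdivrMr.
Qed.

Lemma nondecreasing_itv_pos (N : R) (u : nat -> R) : 0 < N -> (forall m, m.+1%:R <= u m) ->
  {homo u : n m / (n <= m)%N >-> n <= m} ->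
  {homo (fun m => `[N / u m, N * u m]%classic) : n m / (n <= m)%N >-> (n <= m)%O}.
Proof.
move=> N0 hu ndu n m nm; have u0 i : 0 < u i by rewrite (lt_le_trans _ (hu i)).
apply/subsetPset => x /=; rewrite !in_itv/= => /andP[h1 h2]; apply/andP; split.
  by rewrite (le_trans _ h1)// ler_pM2l// lef_pV2 ?posrE// ndu.
by rewrite (le_trans h2)// ler_pM2l// ndu.
Qed.

Lemma cvg_integral_itv_pos (N : R) (u : nat -> R) (f : R -> R) :
  0 < N -> (forall m, m.+1%:R <= u m) ->
  {homo u : n m / (n <= m)%N >-> n <= m} ->
  measurable_fun (`]0, +oo[ : set R) f -> (forall x, 0 < x -> 0 <= f x) ->
  (\int[leb]_(x in `[(N / u m)%R, (N * u m)%R]) (f x)%:E @[m --> \oo] -->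
   \int[leb]_(x in `]0%R, +oo[) (f x)%:E)%E.
Proof.
move=> N0 hu ndu mf f0; have u0 i : 0 < u i by rewrite (lt_le_trans _ (hu i)).
have sub i x : `[N / u i, N * u i]%classic x -> 0 < x.
  by rewrite /= in_itv/= => /andP[+ _]; apply: lt_le_trans; rewrite divr_gt0.
rewrite -(bigcup_itv_pos N0 hu).
have h := @ge0_nondecreasing_set_cvg_integral _ _ R
  (fun m => `[N / u m, N * u m]%classic : set (measurableTypeR R)) (EFin \o f) leb.
apply: h => //.
- exact: nondecreasing_itv_pos.
- move=> i; apply/measurable_EFinP; apply: (measurable_funS _ _ mf) => //.
  by move=> x /sub x0 /=; rewrite in_itv/= x0.
- by move=> i x /sub x0; rewrite lee_fin f0.
Qed.

Lemma measurable_itv_pos (f : R -> R) : (forall x, 0 < x -> {for x, continuous f}) ->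
  measurable_fun (`]0, +oo[ : set R) f.
Proof.
move=> cf; apply: open_continuous_measurable_fun; first exact: interval_open.
by move=> x; rewrite inE/= in_itv/= andbT; exact: cf.
Qed.

(** The map [t = N r^2] sends [[1/u, u]] onto [[N/u^2, N u^2]]. Both families exhaust the half-line,
    and monotone convergence passes to the limit in [\bar R], infinite values included. *)
Lemma integral_subst_sqr (G : R -> R) (N : R) : 0 < N ->
  (forall t, 0 < t -> {for t, continuous G}) -> (forall t, 0 < t -> 0 <= G t) ->
  (\int[leb]_(t in `]0%R, +oo[) (G t)%:E =
   \int[leb]_(r in `]0%R, +oo[) (G (N * r ^+ 2) * (2 * N * r))%:E)%E.
Proof.
move=> N0 cG G0.
pose F (r : R) : R := N * r ^+ 2.
have dF (x : R) : is_derive x 1 F (2 * N * x).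
  rewrite -[F]/(cst N * id ^+ 2 : R -> R); apply: is_derive_eq.
  by rewrite !scaler0 ?addr0 ?add0r /GRing.scale/=; ring.
have F'E : derive1 F = fun r => 2 * N * r by apply/funext => x; rewrite derive1E; exact: derive_val.
have cF : continuous F.
  by move=> x; apply: cvgM; [exact: cvg_cst|exact: exprn_continuous].
have cl : continuous (fun r : R => 2 * N * r).
  by move=> x; apply: cvgM; [exact: cvg_cst|exact: cvg_id].
have F0 r : 0 < r -> 0 < F r by move=> r0; rewrite mulr_gt0// exprn_gt0.
pose u (m : nat) : R := m.+1%:R.
have hu m : m.+1%:R <= u m by [].
have ndu : {homo u : n m / (n <= m)%N >-> n <= m} by move=> n m nm; rewrite ler_nat.
have u1 m : 1 <= u m by rewrite ler1n.
have u0 m : 0 < u m by exact: lt_le_trans (u1 m).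
pose u2 (m : nat) : R := u m ^+ 2.
have hu2 m : m.+1%:R <= u2 m.
  by rewrite /u2 expr2 ler_peMl ?(ltW (u0 m)).
have ndu2 : {homo u2 : n m / (n <= m)%N >-> n <= m}.
  by move=> n m nm; rewrite lerXn2r ?nnegrE ?(ltW (u0 _))// ndu.
have mG := measurable_itv_pos cG.
have mGF : measurable_fun (`]0, +oo[ : set R) (fun r => G (N * r ^+ 2) * (2 * N * r)).
  apply: measurable_itv_pos => x x0; apply: cvgM; last exact: cl.
  apply: (continuous_comp (f := F) (g := G)); first exact: cF.
  by apply: cG; exact: F0.
have GF0 x : 0 < x -> 0 <= G (N * x ^+ 2) * (2 * N * x).
  by move=> x0; rewrite !mulr_ge0 ?G0 ?F0 ?ltW.
have c1 := cvg_integral_itv_pos N0 hu2 ndu2 mG G0.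
have c2 := cvg_integral_itv_pos ltr01 hu ndu mGF GF0.
apply: cvg_unique c1 _ => //.
apply: cvg_trans c2; apply: near_eq_cvg; apply: nearW => m.
have ab : 1 / u m <= 1 * u m.
  by rewrite !mul1r (le_trans _ (u1 m))// invf_le1.
rewrite (_ : N / u2 m = F (1 / u m)); last first.
  by rewrite /F /u2 expr_div_n expr1n mul1r.
rewrite (_ : N * u2 m = F (1 * u m)); last by rewrite /F /u2 mul1r.
rewrite (integration_by_substitution_increasing ab) ?F'E//.
- move=> x y; rewrite !in_itv/= => /andP[x0 _] /andP[y0 _] xy.
  have ux : 0 < 1 / u m by rewrite divr_gt0.
  rewrite /F ltr_pM2l// ltrXn2r// ?nnegrE ?(le_trans (ltW ux))//.
- by apply/cvg_ex; exists (2 * N * (1 / u m)); apply: cvg_at_right_filter; exact: cl.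
- by apply/cvg_ex; exists (2 * N * (1 * u m)); apply: cvg_at_left_filter; exact: cl.
- split => [x _||]; first by apply: ex_derive.
  + by apply: cvg_at_right_filter; exact: cF.
  + by apply: cvg_at_left_filter; exact: cF.
- apply: continuous_in_subspaceT => x; rewrite inE/= in_itv/= => /andP[h _].
  by apply: cG; apply: lt_le_trans h; rewrite F0// divr_gt0.
Qed.

Lemma continuous_powR_pos (a x : R) : 0 < x -> {for x, continuous (fun y : R => y `^ a)}.
Proof.
move=> x0; apply/differentiable_continuous/derivable1_diffP.
by have [] := is_derive1_powR a x0.
Qed.

Lemma integral_gamma_sqr (p : nat) (N : R) : 0 < N ->
  (\int[leb]_(r in `]0%R, +oo[) (r ^+ p * expR (- (N * r ^+ 2)))%:E * (2 * N `^ (p.+1%:R / 2))%:E =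
   \int[leb]_(t in `]0%R, +oo[) (t `^ (p.+1%:R / 2 - 1) * expR (- t))%:E)%E.
Proof.
move=> N0; rewrite [RHS](integral_subst_sqr N0); last 2 first.
- move=> t t0; apply: cvgM; first exact: (@continuous_powR_pos _ _ t0).
  apply: (@continuous_comp _ _ _ (fun t : R => - t) expR); last exact: continuous_expR.
  by apply: cvgN; exact: cvg_id.
- by move=> t _; rewrite mulr_ge0 ?powR_ge0 ?expR_ge0.
rewrite -ge0_integralZr//; last 3 first.
- apply/measurable_EFinP; apply: measurable_funTS; apply: measurable_funM => //.
  apply: measurableT_comp => //; apply: measurableT_comp => //.
  by apply: measurable_funM.
- by move=> r; rewrite /= in_itv/= andbT => r0; rewrite lee_fin mulr_ge0 ?expR_ge0 ?exprn_ge0 ?ltW.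
- by rewrite lee_fin mulr_ge0 ?powR_ge0.
apply: eq_integral => r; rewrite inE/= in_itv/= andbT => r0; rewrite -EFinM; congr EFin.
rewrite powRM ?exprn_ge0 ?ltW//.
have -> : N `^ (p.+1%:R / 2) = N * N `^ (p.+1%:R / 2 - 1).
  by rewrite -{2}(powRr1 (ltW N0)) -powRD ?(gt_eqF N0) ?implybT//; congr powR; ring.
have <- : (r ^+ 2) `^ (p.+1%:R / 2 - 1) * r = r ^+ p.
  rewrite -powR_mulrn ?(ltW r0)// -powRrM -{2}(powRr1 (ltW r0)) -powRD ?(gt_eqF r0) ?implybT//.
  rewrite -powR_mulrn ?(ltW r0)//; congr powR; by rewrite -natr1; field.
ring.
Qed.

End gamma_function.

Section gamma_bounds.
Context {R : realType}.
Local Notation leb := (@lebesgue_measure R).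

Lemma exprn_le_expR (x : R) n : 0 <= x -> x ^+ n <= n`!%:R * expR x.
Proof.
move=> x0; case: n => [|n].
  by rewrite expr0 fact0 mul1r; have := expR_ge1Dx x; lra.
rewrite [leRHS]mulrC -ler_pdivrMr ?ltr0n ?fact_gt0//.
have := expR_ge1Dxn n x0; lra.
Qed.

Lemma measurable_mono_gauss (p : nat) (N : R) :
  measurable_fun setT (fun r : R => r ^+ p * expR (- (N * r ^+ 2))).
Proof.
apply: measurable_funM => //; apply: measurableT_comp => //.
by apply: measurableT_comp => //; apply: measurable_funM.
Qed.

(** Half of the exponent absorbs the monomial: [r^p <= 1 + r^(2p)], and
    [(N r^2 / 2)^p <= p! e^(N r^2 / 2)]. This is the origin of [C]. *)
Lemma integral_mono_gauss_lty (p : nat) (N : R) : 0 < N ->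
  (\int[leb]_(r in `]0%R, +oo[) (r ^+ p * expR (- (N * r ^+ 2)))%:E < +oo)%E.
Proof.
move=> N0; have N20 : 0 < N / 2 by rewrite divr_gt0.
pose C := 1 + p`!%:R / (N / 2) ^+ p.
have C0 : 0 <= C by rewrite addr_ge0// divr_ge0// exprn_ge0// ltW.
apply: (@le_lt_trans _ _ (\int[leb]_r (C * gaussw (N / 2) 0 r)%:E)%E).
  apply: (@le_trans _ _ (\int[leb]_(r in `]0%R, +oo[) (C * gaussw (N / 2) 0 r)%:E)%E).
    apply: ge0_le_integral => //.
    - by move=> r; rewrite /= in_itv/= andbT => r0; rewrite lee_fin mulr_ge0 ?expR_ge0 ?exprn_ge0 ?ltW.
    - by apply: measurable_funTS; apply/measurable_EFinP; exact: measurable_mono_gauss.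
    - apply: measurable_funTS; apply/measurable_EFinP; apply: measurable_funM => //.
      exact: measurable_gaussw.
    - move=> r; rewrite /= in_itv/= andbT => r0; rewrite lee_fin.
      have -> : expR (- (N * r ^+ 2)) = expR (- (N / 2 * r ^+ 2)) * gaussw (N / 2) 0 r.
        by rewrite /gaussw -expRD subr0; congr expR; field.
      rewrite mulrA ler_wpM2r ?gaussw_ge0//.
      rewrite expRN ler_pdivrMr ?expR_gt0// /C mulrDl mul1r.
      have y0 : 0 <= N / 2 * r ^+ 2 by rewrite mulr_ge0 ?sqr_ge0// ltW.
      have h := exprn_le_expR p y0.
      have h1 : r ^+ p <= 1 + r ^+ p ^+ 2.
        have : 0 <= (r ^+ p - 1 / 2) ^+ 2 by exact: sqr_ge0.
        by rewrite sqrrB; lra.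
      apply: (le_trans h1); apply: lerD.
        by have := expR_ge1Dx (N / 2 * r ^+ 2); lra.
      rewrite mulrAC ler_pdivlMr ?exprn_gt0// -exprM mulnC exprM -exprMn mulrC.
      exact: h.
  apply: ge0_subset_integral => //.
  - apply/measurable_EFinP; apply: measurable_funM => //; exact: measurable_gaussw.
  - by move=> r _; rewrite lee_fin mulr_ge0 ?gaussw_ge0.
under eq_integral do rewrite EFinM.
rewrite ge0_integralZl//; last 2 first.
- by apply/measurable_EFinP; exact: measurable_gaussw.
- by move=> r _; rewrite lee_fin gaussw_ge0.
by rewrite integral_gaussw// -EFinM ltry.
Qed.

(** [Gamma] is a real-valued integral and would be 0 if Euler's integral were infinite, so
    finiteness has to be settled before the two sides can be identified. *)
Lemma Gamma_halfE (p : nat) :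
  (\int[leb]_(r in `]0%R, +oo[) (r ^+ p * expR (- r ^+ 2))%:E * 2%:E =
   (Gamma (p.+1%:R / 2 : R))%:E)%E.
Proof.
have h1 := @integral_gamma_sqr R p 1 ltr01.
rewrite powR1 mulr1 in h1.
have e : (\int[leb]_(r in `]0%R, +oo[) (r ^+ p * expR (- r ^+ 2))%:E =
   \int[leb]_(r in `]0%R, +oo[) (r ^+ p * expR (- (1 * r ^+ 2)))%:E)%E.
  by apply: eq_integral => r _; rewrite mul1r.
have fin : (\int[leb]_(r in `]0%R, +oo[) (r ^+ p * expR (- (1 * r ^+ 2)))%:E)%E \is a fin_num.
  rewrite ge0_fin_numE ?integral_mono_gauss_lty//.
  apply: integral_ge0 => r; rewrite /= in_itv/= andbT => r0.
  by rewrite lee_fin mulr_ge0 ?expR_ge0 ?exprn_ge0 ?ltW.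
rewrite e h1 /Gamma /Rintegral fineK; first by [].
by rewrite -h1 fin_numM.
Qed.

Lemma integral_mono_gauss (p : nat) (N : R) : 0 < N ->
  (\int[leb]_(r in `]0%R, +oo[) (r ^+ p * expR (- (N * r ^+ 2)))%:E =
   (Gamma (p.+1%:R / 2 : R) / (2 * N `^ (p.+1%:R / 2)))%:E)%E.
Proof.
move=> N0; have h1 := @integral_gamma_sqr R p 1 ltr01.
have h2 := @integral_gamma_sqr R p N N0.
have e : (Gamma (p.+1%:R / 2 : R))%:E =
  (\int[leb]_(t in `]0%R, +oo[) (t `^ (p.+1%:R / 2 - 1) * expR (- t))%:E)%E.
  rewrite -h1 -Gamma_halfE powR1 mulr1.
  by under [in RHS]eq_integral do rewrite mul1r.
have c0 : 0 < 2 * N `^ (p.+1%:R / 2) by rewrite mulr_gt0// powR_gt0.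
by rewrite EFinM e -h2 -muleA -EFinM divff ?(gt_eqF c0) ?mule1.
Qed.

(** On [1, 2] the integrand is at least [e^(-4)], whatever [p]. A lower bound uniform in [p] is
    enough to compare the Bessel series with an exponential series. *)
Lemma Gamma_half_ge (p : nat) : 2 * expR (- 4) <= Gamma (p.+1%:R / 2 : R).
Proof.
rewrite -lee_fin -Gamma_halfE mulrC EFinM; apply: lee_wpmul2r => //.
apply: (@le_trans _ _ (\int[leb]_(r in `[1%R, 2%R]) (expR (- 4))%:E)%E).
  rewrite integral_cst//= lebesgue_measure_itv/= lte_fin ltr1n -EFinB.
  by rewrite (_ : 2 - 1 = 1 :> R) ?mule1//; lra.
apply: (@le_trans _ _ (\int[leb]_(r in `[1%R, 2%R]) (r ^+ p * expR (- r ^+ 2))%:E)%E).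
  have mf : measurable_fun (setT : set R) (fun r : R => (r ^+ p * expR (- r ^+ 2))%:E).
    apply/measurable_EFinP.
    by under eq_fun do rewrite -[X in - X]mul1r; exact: measurable_mono_gauss.
  apply: ge0_le_integral => //.
  - exact: measurable_funTS.
  - move=> r; rewrite /= in_itv/= => /andP[r1 r2]; rewrite lee_fin.
    rewrite -[leLHS]mul1r ler_pM ?expR_ge0//; first exact: exprn_ege1.
    rewrite ler_expR lerN2 (_ : 4 = 2 ^+ 2); last by rewrite -natrX.
    by rewrite lerXn2r ?nnegrE// (le_trans _ r1).
apply: ge0_subset_integral => //.
- apply: measurable_funTS; apply/measurable_EFinP.
  by under eq_fun do rewrite -[X in - X]mul1r; exact: measurable_mono_gauss.
- by move=> r; rewrite /= in_itv/= andbT => r0; rewrite lee_fin mulr_ge0 ?expR_ge0 ?exprn_ge0 ?ltW.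
- by move=> r; rewrite /= !in_itv/= andbT => /andP[r1 _]; rewrite (lt_le_trans _ r1).
Qed.

Lemma Gamma_half_gt0 (p : nat) : 0 < Gamma (p.+1%:R / 2 : R).
Proof. by apply: lt_le_trans (Gamma_half_ge p); rewrite mulr_gt0 ?expR_gt0. Qed.

(** From [r^(2j) e^(- r^2 / 2) <= 2^j j!], the other half of the exponent keeping the integral
    finite. It bounds the Bessel coefficients from below, for the comparison with the cosine
    series. *)
Lemma Gamma_half_le (p : nat) : exists2 C : R, 0 < C &
  forall j, Gamma ((p + j.*2).+1%:R / 2 : R) <= C * 2 ^+ j * j`!%:R.
Proof.
have h20 : 0 < 1 / 2 :> R by [].
pose I := (Gamma (p.+1%:R / 2 : R) / (2 * (1 / 2) `^ (p.+1%:R / 2))).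
have I0 : 0 < I by rewrite divr_gt0 ?Gamma_half_gt0// mulr_gt0 ?powR_gt0.
have IE : (I%:E = \int[leb]_(r in `]0%R, +oo[) (r ^+ p * expR (- (1 / 2 * r ^+ 2)))%:E)%E.
  by rewrite integral_mono_gauss.
clearbody I; exists (2 * I); first by rewrite mulr_gt0.
move=> j; rewrite -lee_fin -Gamma_halfE -!mulrA mulrC EFinM; apply: lee_wpmul2r => //.
have m1 : measurable_fun (`]0%R, +oo[ : set R) (fun r : R => (r ^+ p * expR (- (1 / 2 * r ^+ 2)))%:E).
  by apply: measurable_funTS; apply/measurable_EFinP; exact: measurable_mono_gauss.
have f0 (r : R) : `]0%R, +oo[%classic r -> (0 <= (r ^+ p * expR (- (1 / 2 * r ^+ 2)))%:E)%E.
  by rewrite /= in_itv/= andbT => r0; rewrite lee_fin mulr_ge0 ?expR_ge0 ?exprn_ge0 ?ltW.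
have c0 : (0 <= (2 ^+ j * j`!%:R)%:E :> \bar R)%E by rewrite lee_fin mulr_ge0// exprn_ge0.
rewrite EFinM IE muleC.
have <- : (\int[leb]_(r in `]0%R, +oo[) ((2 ^+ j * j`!%:R)%:E * (r ^+ p * expR (- (1 / 2 * r ^+ 2)))%:E) =
  (2 ^+ j * j`!%:R)%:E * \int[leb]_(r in `]0%R, +oo[) (r ^+ p * expR (- (1 / 2 * r ^+ 2)))%:E)%E.
  by rewrite ge0_integralZl.
apply: ge0_le_integral => //.
- by move=> r; rewrite /= in_itv/= andbT => r0; rewrite lee_fin mulr_ge0 ?expR_ge0 ?exprn_ge0 ?ltW.
- apply: measurable_funTS; apply/measurable_EFinP.
  by under eq_fun do rewrite -[X in - X]mul1r; exact: measurable_mono_gauss.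
- exact: measurable_funeM.
- move=> r; rewrite /= in_itv/= andbT => r0; rewrite -EFinM lee_fin exprD -muln2 mulnC exprM.
  have y0 : 0 <= 1 / 2 * r ^+ 2 by rewrite mulr_ge0// sqr_ge0.
  have := exprn_le_expR j y0; rewrite exprMn.
  have -> : expR (- r ^+ 2) = expR (- (1 / 2 * r ^+ 2)) * expR (- (1 / 2 * r ^+ 2)).
    by rewrite -expRD; congr expR; field.
  set E := expR (- _); have E0 : 0 <= E by exact: expR_ge0.
  have EE : expR (1 / 2 * r ^+ 2) * E = 1 by rewrite /E -expRD subrr expR0.
  move=> /(ler_wpM2r E0); rewrite -[X in _ <= X]mulrA EE mulr1.
  rewrite div1r exprVn => h.
  have h2 : (r ^+ 2) ^+ j * E <= 2 ^+ j * j`!%:R by rewrite -ler_pdivrMl ?exprn_gt0// mulrA.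
  rewrite [leLHS](_ : _ = (r ^+ p * E) * ((r ^+ 2) ^+ j * E)); last by ring.
  rewrite [leRHS](_ : _ = (r ^+ p * E) * (2 ^+ j * j`!%:R)); last by ring.
  by rewrite ler_wpM2l// mulr_ge0// exprn_ge0// ltW.
Qed.

End gamma_bounds.

(** * Bessel series and polar coordinates *)

Section series_EFin.
Context {R : realType}.

Lemma nneseries_EFin_lim (u : nat -> R) : cvgn (series u) ->
  (\sum_(0 <= j <oo) (u j)%:E = (limn (series u))%:E)%E.
Proof.
move=> cu; rewrite -EFin_lim//; congr (limn _); apply/funext => n /=.
by rewrite sumEFin.
Qed.

Lemma cvg_series_lty (u : nat -> R) : (forall j, 0 <= u j) ->
  (\sum_(0 <= j <oo) (u j)%:E < +oo)%E -> cvgn (series u).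
Proof.
move=> u0 h; apply: nondecreasing_is_cvgn.
  by apply/nondecreasing_seqP => n; rewrite /series/= big_nat_recr//= lerDl.
exists (fine (\sum_(0 <= j <oo) (u j)%:E)%E) => _ [n _ <-].
rewrite -lee_fin fineK; last first.
  by rewrite ge0_fin_numE// nneseries_ge0// => j _ _; rewrite lee_fin.
rewrite /series/= -sumEFin; apply: nneseries_lim_ge => j _ _.
by rewrite lee_fin.
Qed.

End series_EFin.

Section normalized_bessel.
Context {R : realType}.
Local Notation leb := (@lebesgue_measure R).
Variable k : nat.
Hypothesis k0 : (0 < k)%N.

(** With [nu = k/2 - 1], the Bessel function [I_nu(z)] is [(z/2)^nu] times [besB (z ^+ 2)]. Taking
    out the fractional power leaves a power series with positive coefficients in the square of the
    argument. *)
Definition besc (j : nat) : R := (4 ^+ j * j`!%:R * Gamma (k%:R / 2 + j%:R))^-1.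

Definition besB (w : R) : R := limn (series (fun j => besc j * w ^+ j)).

Lemma half_index (j : nat) : k%:R / 2 + j%:R = (k.-1 + j.*2).+1%:R / 2 :> R.
Proof.
by rewrite -addSn prednK// natrD -muln2 natrM; field.
Qed.

Lemma Gamma_index_gt0 j : 0 < Gamma (k%:R / 2 + j%:R : R).
Proof. by rewrite half_index Gamma_half_gt0. Qed.

Lemma besc_gt0 j : 0 < besc j.
Proof.
by rewrite /besc invr_gt0 !mulr_gt0 ?exprn_gt0 ?ltr0n ?fact_gt0// Gamma_index_gt0.
Qed.

Lemma besc_ge0 j : 0 <= besc j. Proof. exact/ltW/besc_gt0. Qed.

Lemma bescX_ge0 w j : 0 <= w -> 0 <= besc j * w ^+ j.
Proof. by move=> w0; apply: mulr_ge0; [exact: besc_ge0|exact: exprn_ge0]. Qed.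

Lemma is_cvg_besB w : 0 <= w -> cvgn (series (fun j => besc j * w ^+ j)).
Proof.
move=> w0; pose D : R := (2 * expR (- 4))^-1.
have D0 : 0 < D by rewrite invr_gt0 mulr_gt0 ?expR_gt0.
apply: (@series_le_cvg _ _ (D *: exp_coeff w)) => [j|j|j|].
- exact: bescX_ge0.
- by rewrite /GRing.scale/= mulr_ge0 ?(ltW D0)// divr_ge0// exprn_ge0.
- rewrite -[leRHS]/(D * (w ^+ j / j`!%:R)) mulrCA [leLHS]mulrC ler_wpM2l ?exprn_ge0//.
  rewrite /besc -!mulrA invfM -[leRHS]mul1r ler_pM ?invr_ge0 ?mulr_ge0 ?exprn_ge0//.
  + exact/ltW/Gamma_index_gt0.
  + by rewrite invf_le1 ?exprn_gt0// exprn_ege1// ler1n.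
  + rewrite invfM mulrC ler_wpM2r ?invr_ge0//.
    rewrite /D lef_pV2 ?posrE ?Gamma_index_gt0 ?mulr_gt0 ?expR_gt0//.
    by rewrite half_index Gamma_half_ge.
- by apply: is_cvg_seriesZ; exact: is_cvg_series_exp_coeff.
Qed.

Lemma besB_ge0 w : 0 <= w -> 0 <= besB w.
Proof.
move=> w0; apply: limr_ge; first exact: is_cvg_besB.
by apply: nearW => n; apply: sumr_ge0 => j _; exact: bescX_ge0.
Qed.

Lemma besB_EFin w : 0 <= w ->
  (besB w)%:E = (\sum_(0 <= j <oo) (besc j * w ^+ j)%:E)%E.
Proof. by move=> w0; rewrite nneseries_EFin_lim//; exact: is_cvg_besB. Qed.

Lemma measurable_besB (s : R) : 0 <= s ->
  measurable_fun setT (fun r : R => besB (r ^+ 2 * s)).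
Proof.
move=> s0; apply/measurable_EFinP.
rewrite (_ : _ \o _ = fun r : R => (\sum_(0 <= j <oo) (besc j * (r ^+ 2 * s) ^+ j)%:E)%E).
  apply: ge0_emeasurable_sum => [j r _ _|j _].
    by rewrite lee_fin bescX_ge0// mulr_ge0 ?sqr_ge0.
  apply/measurable_EFinP; apply: measurable_funM => //; apply: measurable_funX.
  by apply: measurable_funM.
by apply/funext => r; rewrite /= besB_EFin// mulr_ge0 ?sqr_ge0.
Qed.

(** The integral of [exp <x, y>] over the sphere [|y| = r] of R^k when [|x|^2 = s]; at [s = 0] it is
    the area of that sphere. [polar_exp] gives it this meaning. *)
Definition polar_kernel (s r : R) : R := 2 * pi `^ (k%:R / 2) * r ^+ k.-1 * besB (r ^+ 2 * s).

Lemma polar_kernel_ge0 s r : 0 <= s -> 0 <= r -> 0 <= polar_kernel s r.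
Proof.
move=> s0 r0; rewrite mulr_ge0 ?besB_ge0 ?mulr_ge0 ?exprn_ge0 ?powR_ge0//.
Qed.

Lemma measurable_polar_kernel s : 0 <= s -> measurable_fun setT (polar_kernel s).
Proof.
move=> s0; apply: measurable_funM; last exact: measurable_besB.
by apply: measurable_funM.
Qed.

Lemma integral_polar_series (f : R -> R) (s : R) : 0 <= s ->
  measurable_fun (`]0, +oo[ : set R) f -> (forall r, 0 < r -> 0 <= f r) ->
  (\int[leb]_(r in `]0%R, +oo[) (polar_kernel s r * f r)%:E =
   \sum_(0 <= j <oo) ((2 * pi `^ (k%:R / 2) * besc j * s ^+ j)%:E *
     \int[leb]_(r in `]0%R, +oo[) (r ^+ (k.-1 + j.*2) * f r)%:E))%E.
Proof.
move=> s0 mf f0.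
have C0 : 0 <= 2 * pi `^ (k%:R / 2) :> R by rewrite mulr_ge0 ?powR_ge0.
have mj j : measurable_fun (`]0, +oo[ : set R) (fun r => (r ^+ (k.-1 + j.*2) * f r)%:E).
  apply/measurable_EFinP; apply: measurable_funM => //.
have cj j : 0 <= 2 * pi `^ (k%:R / 2) * besc j * s ^+ j.
  by rewrite -mulrA mulr_ge0// bescX_ge0.
transitivity (\int[leb]_(r in `]0%R, +oo[) (\sum_(0 <= j <oo)
    ((2 * pi `^ (k%:R / 2) * besc j * s ^+ j)%:E * (r ^+ (k.-1 + j.*2) * f r)%:E)))%E.
  apply: eq_integral => r; rewrite inE/= in_itv/= andbT => r0.
  have r2s : 0 <= r ^+ 2 * s by rewrite mulr_ge0 ?sqr_ge0.
  rewrite /polar_kernel mulrAC EFinM besB_EFin// -nneseriesZl; last first.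
    by move=> j _; rewrite lee_fin bescX_ge0.
  apply: eq_eseriesr => j _; rewrite -!EFinM; congr EFin.
  by rewrite exprMn -exprM -mul2n exprD; ring.
rewrite integral_nneseries//; last 2 first.
- by move=> j; apply: measurable_funeM; exact: mj.
- move=> j r; rewrite /= in_itv/= andbT => r0.
  by rewrite -EFinM lee_fin mulr_ge0// mulr_ge0 ?f0// exprn_ge0// ltW.
apply: eq_eseriesr => j _; apply: ge0_integralZl => //; [exact: mj| |by rewrite lee_fin; exact: cj].
by move=> r; rewrite /= in_itv/= andbT => r0; rewrite lee_fin mulr_ge0 ?f0// exprn_ge0// ltW.
Qed.

(** The [j]-th radial integral yields [Gamma (k/2 + j)], which cancels the factor in [besc j]; what
    remains is the exponential series of [s / (4 N)]. *)
Lemma integral_polar_gauss (N s : R) : 0 < N -> 0 <= s ->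
  (\int[leb]_(r in `]0%R, +oo[) (polar_kernel s r * expR (- (N * r ^+ 2)))%:E =
   (Num.sqrt (pi / N) ^+ k * expR (s / (4 * N)))%:E)%E.
Proof.
move=> N0 s0; rewrite integral_polar_series//; last first.
  apply: measurable_funTS; apply: measurableT_comp => //.
  by apply: measurableT_comp => //; apply: measurable_funM.
rewrite EFinM /expR.
rewrite -(nneseries_EFin_lim (is_cvg_series_exp_coeff _)).
have e0 j : 0 <= exp_coeff (s / (4 * N)) j.
  by rewrite divr_ge0// exprn_ge0// divr_ge0// mulr_ge0// ltW.
rewrite -nneseriesZl; last by move=> j _; rewrite lee_fin.
apply: eq_eseriesr => j _; rewrite integral_mono_gauss// -half_index -!EFinM; congr EFin.
have G0 := Gamma_index_gt0 j; have Nk : 0 < N `^ (k%:R / 2) by rewrite powR_gt0.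
have -> : N `^ (k%:R / 2 + j%:R) = N `^ (k%:R / 2) * N ^+ j.
  by rewrite powRD ?(gt_eqF N0) ?implybT// powR_mulrn// ltW.
have -> : Num.sqrt (pi / N) ^+ k = pi `^ (k%:R / 2) / N `^ (k%:R / 2).
  have pN : 0 <= pi / N :> R by rewrite divr_ge0 ?pi_ge0// ltW.
  rewrite -powR12_sqrt// -powR_mulrn ?powR_ge0// -powRrM [2^-1 * _]mulrC.
  rewrite powRM ?pi_ge0 ?invr_ge0 ?(ltW N0)//; congr (_ * _).
  by rewrite -powR_inv1 ?(ltW N0)// -powRrM mulN1r powRN.
rewrite /besc /exp_coeff/= expr_div_n exprMn.
have f0 : j`!%:R != 0 :> R by rewrite pnatr_eq0 -lt0n fact_gt0.
have p4 : 4 ^+ j != 0 :> R by rewrite expf_neq0.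
have pN : N ^+ j != 0 by rewrite expf_neq0// gt_eqF.
move: (Gamma _) G0 (pi `^ _) (N `^ _) Nk (j`!%:R) f0 (4 ^+ j) p4 (N ^+ j) pN (s ^+ j) => G G0 P Q Q0 f f0 p4 hp4 nj hnj sj.
by field; rewrite hp4 hnj f0 !gt_eqF.
Qed.

End normalized_bessel.

Section polar.
Context {R : realType}.
Local Notation leb := (@lebesgue_measure R).

Definition dotr n (x y : 'rV[R]_n) : R := \sum_(i < n) x ord0 i * y ord0 i.

Lemma measurable_dotr n (x : 'rV[R]_n) : measurable_fun setT (dotr x).
Proof.
apply: measurable_sum => i; apply: measurable_funM => //; exact: measurable_coord.
Qed.

Lemma measurable_sqnormT n : measurable_fun setT (fun x : 'rV[R]_n => sqnorm x).
Proof. apply: measurable_sqnorm => i; exact: measurable_coord. Qed.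

Lemma sqnorm_sub n (x y : 'rV[R]_n) : sqnorm (x - y) = sqnorm x - 2 * dotr x y + sqnorm y.
Proof.
rewrite /sqnorm /dotr mulr_sumr -sumrN -!big_split/=; apply: eq_bigr => i _.
by rewrite !mxE; ring.
Qed.

Lemma sqnormZ n (a : R) (x : 'rV[R]_n) : sqnorm (a *: x) = a ^+ 2 * sqnorm x.
Proof. by rewrite /sqnorm mulr_sumr; apply: eq_bigr => i _; rewrite mxE exprMn. Qed.

Lemma dotrZr n (a : R) (x y : 'rV[R]_n) : dotr x (a *: y) = a * dotr x y.
Proof. by rewrite /dotr mulr_sumr; apply: eq_bigr => i _; rewrite mxE; ring. Qed.

Lemma dotrC n (x y : 'rV[R]_n) : dotr x y = dotr y x.
Proof. by apply: eq_bigr => i _; rewrite mulrC. Qed.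

Lemma integral_exp_dotr n (x : 'rV[R]_n) (N : R) : 0 < N ->
  (\int[lebesgue_row n]_y (expR (dotr x y - N * sqnorm y))%:E =
   (Num.sqrt (pi / N) ^+ n * expR (sqnorm x / (4 * N)))%:E)%E.
Proof.
move=> N0; rewrite EFinM -(@integral_gauss_row _ n N ((2 * N)^-1 *: x) N0) muleC.
rewrite -ge0_integralZl//;
  try by [apply/measurable_EFinP; exact: measurable_gauss_row
         |move=> y _; rewrite lee_fin expR_ge0].
apply: eq_integral => y _; rewrite -EFinM -expRD; congr (expR _)%:E.
rewrite sqnorm_sub sqnormZ dotrZr (dotrC y x); field.
by rewrite gt_eqF.
Qed.

(* The radial distributions of the two sides have the same Laplace transform,
   that is, the same moments in the variable [exp (- |y|^2)]. *)
Lemma polar_exp k (x : 'rV[R]_k) (H : R -> \bar R) : (0 < k)%N ->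
  (forall t, 0 <= H t)%E -> measurable_fun setT H ->
  (\int[lebesgue_row k]_y ((expR (dotr x y))%:E * H (sqnorm y)) =
   \int[leb]_(r in `]0%R, +oo[) ((polar_kernel k (sqnorm x) r)%:E * H (r ^+ 2)%R))%E.
Proof.
move=> k0 H0 mH; set s := sqnorm x; have s0 : 0 <= s by exact: sqnorm_ge0.
(* One factor [e^(- |y|^2)] goes into the density to make it integrable, so the [n]-th moment in
   [w1] is the Gaussian integral at rate [n.+1]. *)
pose h1 y : R := expR (dotr x y - 1 * sqnorm y).
pose w1 (y : 'rV[R]_k) : R := expR (- sqnorm y).
pose D : set R := `]0, +oo[%classic.
have mD : measurable D by exact: measurable_itv.
pose h2 : R -> R := (fun r => polar_kernel k s r * expR (- (1 * r ^+ 2))) \_ D.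
pose w2 (r : R) : R := expR (- r ^+ 2).
have ker0 r : r \in D -> 0 <= polar_kernel k s r.
  by rewrite inE /D/= in_itv/= andbT => r0; apply: polar_kernel_ge0 => //; exact: ltW.
have mg (N : R) : measurable_fun setT (fun r : R => polar_kernel k s r * expR (- (N * r ^+ 2))).
  apply: measurable_funM; first exact: measurable_polar_kernel.
  by apply: measurableT_comp => //; apply: measurableT_comp => //; exact: measurable_funM.
have mh1 : measurable_fun setT h1.
  apply: measurableT_comp => //; apply: measurable_funB; first exact: measurable_dotr.
  by apply: measurable_funM => //; exact: measurable_sqnormT.
have mh2 : measurable_fun setT h2.
  by rewrite /h2 patch_indic; exact: measurable_funM.
have mw1 : measurable_fun setT w1.
  by apply: measurableT_comp => //; apply: measurableT_comp => //; exact: measurable_sqnormT.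
have mw2 : measurable_fun setT w2.
  by apply: measurableT_comp => //; exact: measurableT_comp.
have h10 y : 0 <= h1 y by exact: expR_ge0.
have h20 r : 0 <= h2 r.
  by rewrite /h2 patchE; case: ifPn => // rD; rewrite mulr_ge0 ?ker0 ?expR_ge0.
have w101 y : 0 <= w1 y <= 1.
  by rewrite expR_ge0/= -expR0 ler_expR oppr_le0 sqnorm_ge0.
have w201 r : 0 <= w2 r <= 1.
  by rewrite expR_ge0/= -expR0 ler_expR oppr_le0 sqr_ge0.
have n0 n : 0 < n.+1%:R :> R by [].
have i1 n : (\int[lebesgue_row k]_y (h1 y * w1 y ^+ n)%:E =
    (Num.sqrt (pi / n.+1%:R) ^+ k * expR (s / (4 * n.+1%:R)))%:E)%E.
  rewrite -(integral_exp_dotr x (n0 n)); apply: eq_integral => y _; congr EFin.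
  by rewrite /h1 /w1 -expRM_natl -expRD; congr expR; rewrite -natr1; ring.
have i2 n : (\int[leb]_r (h2 r * w2 r ^+ n)%:E =
    (Num.sqrt (pi / n.+1%:R) ^+ k * expR (s / (4 * n.+1%:R)))%:E)%E.
  rewrite -(integral_polar_gauss k0 (n0 n) s0) [RHS]integral_mkcond.
  apply: eq_integral => r _; rewrite /h2 !patchE /D; case: ifPn => _; last by rewrite mul0r.
  by rewrite /w2 -expRM_natl -mulrA -expRD; congr (_ * expR _)%:E; rewrite -natr1; ring.
have ih1 : (lebesgue_row k).-integrable setT (EFin \o h1).
  apply/integrableP; split; first exact/measurable_EFinP.
  have := i1 0; under eq_integral do rewrite expr0 mulr1.
  under [X in _ -> (X < _)%E]eq_integral do rewrite /= ger0_norm//.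
  by move=> ->; rewrite ltry.
have ih2 : leb.-integrable setT (EFin \o h2).
  apply/integrableP; split; first exact/measurable_EFinP.
  have := i2 0; under eq_integral do rewrite expr0 mulr1.
  under [X in _ -> (X < _)%E]eq_integral do rewrite /= ger0_norm//.
  by move=> ->; rewrite ltry.
have moments n : \int[lebesgue_row k]_y (h1 y * w1 y ^+ n) = \int[leb]_r (h2 r * w2 r ^+ n).
  by rewrite /Rintegral i1 i2.
(* In the variable [w = e^(- |y|^2)], [- ln w] recovers [|y|^2], and the factor [expR (- ln w)]
   undoes the weight put into the densities. *)
pose H' (w : R) : \bar R := (H (- ln w)%R * (expR (- ln w))%:E)%E.
have H'0 w : (0 <= H' w)%E by rewrite mule_ge0// lee_fin expR_ge0.
have mln : measurable_fun setT (fun w : R => - ln w).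
  by apply: measurableT_comp => //; exact: measurable_ln.
have mH' : measurable_fun setT H'.
  apply: emeasurable_funM; first exact: measurableT_comp.
  by apply/measurable_EFinP; exact: measurableT_comp.
have := hausdorff_moment ih1 ih2 mw1 mw2 w101 w201 moments h10 h20 H'0 mH'.
have -> : (\int[lebesgue_row k]_y (H' (w1 y) * (h1 y)%:E) =
    \int[lebesgue_row k]_y ((expR (dotr x y))%:E * H (sqnorm y)))%E.
  apply: eq_integral => y _; rewrite /H' /w1 expRK opprK /h1 -muleA -EFinM -expRD.
  by rewrite muleC; congr ((expR _)%:E * _)%E; ring.
move=> ->; rewrite [RHS]integral_mkcond; apply: eq_integral => r _.
rewrite /h2 !patchE /D; case: ifPn => _; last by rewrite mule0.
rewrite /H' /w2 expRK opprK -muleA -EFinM mulrCA -expRD muleC; congr (_%:E * _)%E.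
by rewrite (_ : _ - _ = 0) ?expR0 ?mulr1//; ring.
Qed.

End polar.

(** * Risk bound *)

Section radial_inequality.
Context {R : realType} (k : nat) (c c' : R -> R).
Hypothesis k0 : (0 < k)%N.
Hypothesis dc : forall t : R, 0 <= t -> is_derive t 1 c (c' t).
Hypothesis cineq : forall t, 0 < t -> k%:R * c t + 2 * t * c' t + t * c t ^+ 2 / 2 <= 0.

(** Up to the area of the unit sphere, the outward flux of the vector field [c(|x|^2) x] through the
    sphere of radius [r]. *)
Let K (r : R) : R := r ^+ k * c (r ^+ 2).

Let dK (r : R) : is_derive r 1 K
  (k%:R * r ^+ k.-1 * c (r ^+ 2) + r ^+ k * (2 * r * c' (r ^+ 2))).
Proof.
have d1 : is_derive r 1 (c \o (id ^+ 2 : R -> R)) (c' (r ^+ 2) * (2 * r)).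
  apply: is_derive1_comp; first exact: dc (sqr_ge0 r).
  by apply: is_derive_eq; rewrite /GRing.scale/=; ring.
have -> : K = (id ^+ k : R -> R) * (c \o (id ^+ 2 : R -> R)).
  by apply/funext => y; rewrite /K !fctE/=.
by apply: is_derive_eq; rewrite /GRing.scale/= !fctE/=; ring.
Qed.

Let contK : continuous K.
Proof.
move=> r; apply/differentiable_continuous/derivable1_diffP.
by have [] := dK r.
Qed.

Let dK_le (r : R) : 0 < r ->
  k%:R * r ^+ k.-1 * c (r ^+ 2) + r ^+ k * (2 * r * c' (r ^+ 2)) <=
  - (r ^+ k.-1 * (r * c (r ^+ 2)) ^+ 2 / 2).
Proof.
move=> r0; have r20 : 0 < r ^+ 2 by rewrite exprn_gt0.
have rk : 0 <= r ^+ k.-1 by rewrite exprn_ge0// ltW.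
have := ler_wpM2l rk (cineq r20); rewrite mulr0.
have -> : r ^+ k = r ^+ k.-1 * r by rewrite -exprSr prednK.
by move=> h; rewrite -subr_le0; apply: le_trans h; rewrite le_eqVlt; apply/orP; left; apply/eqP; field.
Qed.

Let K_nincr (a b : R) : 0 <= a -> a <= b -> K b <= K a.
Proof.
move=> a0 ab; have [x xab e] := MVT_segment ab (fun x _ => dK x) (continuous_subspaceT contK).
rewrite -subr_le0 e; move: xab; rewrite in_itv/= => /andP[ax xb].
have [x0|x0] := ltP 0 x.
  rewrite mulr_le0_ge0 ?subr_ge0// (le_trans (dK_le x0))// oppr_le0.
  by rewrite divr_ge0// mulr_ge0 ?sqr_ge0// exprn_ge0// ltW.
(* The mean value theorem on the closed segment may return the endpoint 0, outside the range of
   [dK_le]. Then [a = 0], and the open version is used on ]0, b[. *)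
have xE : x = 0 by apply/eqP; rewrite eq_le x0 (le_trans a0 ax).
have aE : a = 0 by apply/eqP; rewrite eq_le a0 andbT -xE.
rewrite -e -aE/= /K aE expr0n (gtn_eqF k0) mul0r subr0.
have : K b <= 0; last by [].
have [b0|b0] := ltP 0 b; last first.
  have -> : b = 0 by apply/eqP; rewrite eq_le b0 -aE ab.
  by rewrite /K expr0n (gtn_eqF k0) mul0r.
have K0 : K 0 = 0 by rewrite /K expr0n (gtn_eqF k0) mul0r.
have [y yab e2] := MVT b0 (fun x _ => dK x) (continuous_subspaceT contK).
rewrite -[K b]subr0 -{1}K0 e2 subr0; move: yab; rewrite in_itv/= => /andP[y0 _].
rewrite mulr_le0_ge0 ?(ltW b0)// (le_trans (dK_le y0))// oppr_le0.
by rewrite divr_ge0// mulr_ge0 ?sqr_ge0// exprn_ge0// ltW.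
Qed.

Lemma radial_le0 t : 0 <= t -> c t <= 0.
Proof.
have pos u : 0 < u -> c u <= 0.
  move=> u0; have su : 0 < Num.sqrt u by rewrite sqrtr_gt0.
  have := K_nincr (lexx 0) (ltW su); rewrite {2}/K expr0n (gtn_eqF k0) mul0r /K.
  by rewrite pmulr_rle0 ?exprn_gt0// sqr_sqrtr// ltW.
rewrite le_eqVlt => /predU1P[<-|]; last exact: pos.
apply: (@cvgr_to_le _ (0 : R)^'+ _ _ c).
  apply: cvg_at_right_filter; apply/differentiable_continuous/derivable1_diffP.
  by have [] := dc (lexx 0).
by near=> u; apply: pos; near: u; exact: nbhs_right_gt.
Unshelve. all: by end_near. Qed.

(* Mean value theorem for [r^k c(r^2)], whose square is nondecreasing. *)
Lemma radial_dilation s t : 1 < s -> 0 <= t ->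
  s ^+ k * c (s ^+ 2 * t) - c t <=
  - ((s ^+ k.-1)^-1 * (s - 1) * (t * c t ^+ 2) / 2).
Proof.
move=> s1; have s0 : 0 < s by exact: lt_trans s1.
rewrite le_eqVlt => /predU1P[<-|t0].
  rewrite mulr0 mul0r mulr0 mul0r oppr0 -{2}[c 0]mul1r -mulrBl.
  rewrite mulr_ge0_le0 ?radial_le0// subr_ge0 exprn_ege1// ltW//.
set r := Num.sqrt t; have r0 : 0 < r by rewrite sqrtr_gt0.
have rt : t = r ^+ 2 by rewrite sqr_sqrtr// ltW.
rewrite rt -exprMn.
have rsr : r < s * r by rewrite ltr_pMl.
have [x + e] := MVT rsr (fun x _ => dK x) (continuous_subspaceT contK).
rewrite in_itv/= => /andP[rx xs]; have x0 : 0 < x by exact: lt_trans rx.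
have k1 : forall y : R, y ^+ k = y ^+ k.-1 * y by move=> y; rewrite -exprSr prednK.
have rk : 0 < r ^+ k by rewrite exprn_gt0.
rewrite -(ler_pM2l rk) mulrBr mulrA -exprMn (mulrC r).
rewrite -[X in X - _]/(K (s * r)) -[X in _ - X]/(K r) e.
have sr0 : 0 <= s * r - r by rewrite subr_ge0 ltW.
apply: (le_trans (ler_wpM2r sr0 (dK_le x0))).
have Kx : (K r) ^+ 2 <= (K x) ^+ 2.
  have Kr0 : K r <= 0.
    by have := K_nincr (lexx 0) (ltW r0); rewrite {2}/K expr0n (gtn_eqF k0) mul0r.
  have Kxr : K x <= K r by apply: K_nincr; exact: ltW.
  by rewrite -(sqrrN (K r)) -(sqrrN (K x)) lerXn2r ?nnegrE ?oppr_ge0 ?(le_trans Kxr)// lerN2.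
have xk : x ^+ k.-1 <= (s * r) ^+ k.-1 by rewrite lerXn2r ?nnegrE ?ltW// mulr_gt0.
have xk0 : 0 < x ^+ k.-1 by rewrite exprn_gt0.
have rk0 : 0 < r ^+ k.-1 by rewrite exprn_gt0.
have sk0 : 0 < s ^+ k.-1 by rewrite exprn_gt0.
(* The derivative bound at the intermediate point is rewritten through [K x]: then
   [K(x)^2 >= K(r)^2], and [x <= s r] costs the factor [(s ^+ k.-1)^-1]. *)
have e1 : x ^+ k.-1 * (x * c (x ^+ 2)) ^+ 2 = (K x) ^+ 2 / x ^+ k.-1.
  by rewrite /K k1; field; rewrite gt_eqF.
have h : (s ^+ k.-1)^-1 * (r ^+ k.-1) * (r * c (r ^+ 2)) ^+ 2 <= x ^+ k.-1 * (x * c (x ^+ 2)) ^+ 2.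
  rewrite e1 [leLHS](_ : _ = (K r) ^+ 2 / (s * r) ^+ k.-1); last first.
    by rewrite /K k1 [(s * r) ^+ _]exprMn; field; rewrite !gt_eqF.
  rewrite ler_pM ?sqr_ge0 ?invr_ge0 ?exprn_ge0 ?mulr_ge0 ?(ltW s0) ?(ltW r0)//.
  by rewrite lef_pV2 ?posrE// exprn_gt0// mulr_gt0.
rewrite mulrN mulNr lerN2 k1.
have := ler_wpM2r sr0 h.
have h20 : 0 <= 2^-1 :> R by rewrite invr_ge0.
move=> /(ler_wpM2r h20) h2.
rewrite [leRHS](_ : _ = x ^+ k.-1 * (x * c (x ^+ 2)) ^+ 2 * (s * r - r) / 2); last by ring.
apply: le_trans h2; rewrite le_eqVlt; apply/orP; left; apply/eqP; field.
by rewrite gt_eqF.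
Qed.

End radial_inequality.

Section risk_bound.
Context {R : realType} (k : nat).
Variable th : 'rV[R]_k.
Local Notation mu := (@lebesgue_row R k).
Local Notation phi := (gauss_pdf th).

Lemma gauss_pdf_ge0 x : 0 <= phi x.
Proof. by rewrite mulr_ge0 ?powR_ge0 ?expR_ge0. Qed.

Lemma measurable_gauss_pdf : measurable_fun setT phi.
Proof.
apply: measurable_funM => //.
rewrite (_ : (fun _ => _) = fun x => expR (- (2^-1 * sqnorm (x - th)))).
  exact: measurable_gauss_row.
by apply/funext => x; rewrite mulrC.
Qed.

Lemma integrable_gauss_bound (f : 'rV[R]_k -> R) (A : R) :
  measurable_fun setT f -> (forall x, `|f x| <= A * (1 + sqnorm x) ^+ 2) ->
  mu.-integrable setT (EFin \o (fun x => f x * phi x)).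
Proof.
move=> mf fA; pose C : R := (2 * pi) `^ (- (k%:R / 2)) * expR (- (sqnorm th / 2)).
have C0 : 0 <= C by rewrite mulr_ge0 ?powR_ge0 ?expR_ge0.
have A0 : 0 <= A.
  have := le_trans (normr_ge0 _) (fA 0); rewrite pmulr_lge0// exprn_gt0//.
  by rewrite ltr_pwDl// sqnorm_ge0.
(* From [y^2 <= 2 e^y] at [y = (1 + |x|^2) / 8] comes [(1 + |x|^2)^2 <= 128 e^(1/8) e^(|x|^2 / 8)].
   The Gaussian exponent 1/2 then drops to 3/8 in [G]. *)
pose B := A * (128 * expR (1 / 8)) * C.
have B0 : 0 <= B by do 2 rewrite mulr_ge0//; rewrite mulr_ge0 ?expR_ge0.
pose G (x : 'rV[R]_k) := expR (dotr th x - 3 / 8 * sqnorm x).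
have mG : measurable_fun setT G.
  apply: measurableT_comp => //; apply: measurable_funB; first exact: measurable_dotr.
  by apply: measurable_funM => //; exact: measurable_sqnormT.
have h38 : 0 < 3 / 8 :> R by lra.
have iG : mu.-integrable setT (EFin \o G).
  apply/integrableP; split; first exact/measurable_EFinP.
  under eq_integral do rewrite /= ger0_norm ?expR_ge0//.
  by rewrite (integral_exp_dotr th h38) ltry.
apply: (@le_integrable _ _ _ _ _ _ _ (fun x => B%:E * (G x)%:E)%E) => //.
- by apply/measurable_EFinP; apply: measurable_funM => //; exact: measurable_gauss_pdf.
- move=> x _ /=; rewrite lee_fin normrM (ger0_norm (gauss_pdf_ge0 _)) [leRHS]ger0_norm; last first.
    by rewrite mulr_ge0// expR_ge0.
  apply: (le_trans (ler_wpM2r (gauss_pdf_ge0 x) (fA x))).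
  have -> : phi x = C * expR (dotr th x - sqnorm x / 2).
    rewrite /gauss_pdf /C -mulrA -expRD; congr (_ * expR _).
    by rewrite sqnorm_sub (dotrC x th); field.
  have y0 : 0 <= (1 + sqnorm x) / 8 by rewrite divr_ge0// addr_ge0// sqnorm_ge0.
  have h := exprn_le_expR 2 y0.
  have h1 : (1 + sqnorm x) ^+ 2 <= 128 * expR (1 / 8) * expR (sqnorm x / 8).
    move: h; rewrite -mulrA -expRD -mulrDl.
    have -> : 2`!%:R = 2 :> R by [].
    set e := expR _; rewrite expr_div_n => h; lra.
  apply: (@le_trans _ _ (A * (128 * expR (1 / 8) * expR (sqnorm x / 8)) *
     (C * expR (dotr th x - sqnorm x / 2)))).
    apply: ler_wpM2r; first by rewrite mulr_ge0 ?expR_ge0.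
    exact: ler_wpM2l.
  rewrite le_eqVlt; apply/orP; left; apply/eqP.
  have -> : G x = expR (sqnorm x / 8) * expR (dotr th x - sqnorm x / 2).
    by rewrite /G -expRD; congr expR; field.
  by rewrite /B; ring.
- exact: integrableZl.
Qed.

Lemma abs_dotr_le (x : 'rV[R]_k) :
  `|dotr x th| <= (1 + sqnorm th) * (1 + sqnorm x).
Proof.
have h1 : 0 <= sqnorm x - 2 * dotr x th + sqnorm th by rewrite -sqnorm_sub sqnorm_ge0.
have h2 : 0 <= sqnorm x + 2 * dotr x th + sqnorm th.
  have := sqnorm_ge0 (x - (- th)); rewrite sqnorm_sub sqnormN.
  have -> : dotr x (- th) = - dotr x th.
    by rewrite /dotr -sumrN; apply: eq_bigr => i _; rewrite mxE mulrN.
  by rewrite mulrN opprK.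
have hx := sqnorm_ge0 x; have ht := sqnorm_ge0 th.
have hxt : 0 <= sqnorm th * sqnorm x by rewrite mulr_ge0.
by rewrite ler_norml; apply/andP; split; lra.
Qed.

Variables (c c' : R -> R).
Hypothesis k0 : (0 < k)%N.
Hypothesis dc : forall t : R, 0 <= t -> is_derive t 1 c (c' t).
Hypothesis cineq : forall t, 0 < t -> k%:R * c t + 2 * t * c' t + t * c t ^+ 2 / 2 <= 0.
Hypothesis c_ge : forall t, 0 <= t -> -1 <= c t.
Hypothesis mc : measurable_fun setT (fun x : 'rV[R]_k => c (sqnorm x)).

Let c_le0 t : 0 <= t -> c t <= 0.
Proof. exact: (radial_le0 k0 dc cineq). Qed.

Let c_norm (x : 'rV[R]_k) : `|c (sqnorm x)| <= 1.
Proof.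
rewrite ler_norml c_ge ?sqnorm_ge0//=.
by rewrite (le_trans (c_le0 (sqnorm_ge0 x))).
Qed.

(** A class on which [E] is finite and linear, stable under multiplication by [c] because
    [|c| <= 1]. Growth of degree four is allowed because the dilated Gaussian contributes [|x|^4] in
    [B2]. *)
Let tame (f : 'rV[R]_k -> R) := measurable_fun setT f /\
  exists A, forall x, `|f x| <= A * (1 + sqnorm x) ^+ 2.

Let tame_int f : tame f -> mu.-integrable setT (EFin \o (fun x => f x * phi x)).
Proof. by move=> [mf [A fA]]; exact: integrable_gauss_bound mf fA. Qed.

Let E f := \int[mu]_x (f x * phi x).

Let E_add f g : tame f -> tame g -> E (fun x => f x + g x) = E f + E g.
Proof.
move=> tf tg; rewrite /E -RintegralD//; [|exact: tame_int..].
by apply: eq_Rintegral => x _; rewrite mulrDl.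
Qed.

Let E_scale (a : R) f : tame f -> E (fun x => a * f x) = a * E f.
Proof.
move=> tf; rewrite /E -RintegralZl//; last exact: tame_int.
by apply: eq_Rintegral => x _; rewrite mulrA.
Qed.

Let tame_add f g : tame f -> tame g -> tame (fun x => f x + g x).
Proof.
move=> [mf [A fA]] [mg [B gB]]; split; first exact: measurable_funD.
by exists (A + B) => x; rewrite mulrDl (le_trans (ler_normD _ _))// lerD.
Qed.

Let tame_scale (a : R) f : tame f -> tame (fun x => a * f x).
Proof.
move=> [mf [A fA]]; split; first exact: measurable_funM.
by exists (`|a| * A) => x; rewrite normrM -mulrA ler_wpM2l.
Qed.

Let tame_c f : tame f -> tame (fun x => c (sqnorm x) * f x).
Proof.
move=> [mf [A fA]]; split; first exact: measurable_funM.
by exists A => x; rewrite normrM (le_trans _ (fA x))// ler_piMl.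
Qed.

Let one_le (x : 'rV[R]_k) : 1 <= 1 + sqnorm x :> R. Proof. by rewrite lerDl sqnorm_ge0. Qed.

Let tame_prod (f g : 'rV[R]_k -> R) (A B : R) : measurable_fun setT f -> measurable_fun setT g ->
  (forall x, `|f x| <= A * (1 + sqnorm x)) -> (forall x, `|g x| <= B * (1 + sqnorm x)) ->
  tame (fun x => f x * g x).
Proof.
move=> mf mg fA gB; split; first exact: measurable_funM.
exists (A * B) => x; rewrite normrM.
rewrite [leRHS](_ : _ = A * (1 + sqnorm x) * (B * (1 + sqnorm x))); last by ring.
by rewrite ler_pM.
Qed.

Let b_sq (x : 'rV[R]_k) : `|sqnorm x| <= 1 * (1 + sqnorm x) :> R.
Proof. by rewrite ger0_norm ?sqnorm_ge0// mul1r lerDr. Qed.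

Let b_one (x : 'rV[R]_k) : `|1| <= 1 * (1 + sqnorm x) :> R.
Proof. by rewrite normr1 mul1r. Qed.

Let md : measurable_fun setT (fun x => dotr x th).
Proof. by under eq_fun do rewrite dotrC; exact: measurable_dotr. Qed.

Let t_sq : tame (fun x => sqnorm x).
Proof.
have := tame_prod (@measurable_sqnormT _ k) (measurable_cst (1 : R)) b_sq b_one.
by under eq_fun do rewrite mulr1.
Qed.

Let t_dot : tame (fun x => dotr x th).
Proof.
have := tame_prod md (measurable_cst (1 : R)) abs_dotr_le b_one.
by under eq_fun do rewrite mulr1.
Qed.

Let t_sqsq : tame (fun x => sqnorm x * sqnorm x).
Proof. exact: (tame_prod (@measurable_sqnormT _ k) (@measurable_sqnormT _ k) b_sq b_sq). Qed.

Let t_sqdot : tame (fun x => sqnorm x * dotr x th).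
Proof. exact: (tame_prod (@measurable_sqnormT _ k) md b_sq abs_dotr_le). Qed.

Let cs (x : 'rV[R]_k) := c (sqnorm x).
Let A2d := E (fun x => cs x * dotr x th).
Let A4 := E (fun x => cs x * sqnorm x).
Let A3 := E (fun x => cs x * (cs x * sqnorm x)).
Let B1 := E (fun x => cs x * (cs x * (sqnorm x * dotr x th))).
Let B2 := E (fun x => cs x * (cs x * (sqnorm x * sqnorm x))).

(* Lebesgue measure being dilation-homogeneous, [s^k V(s x) - V(x)] has integral
   zero for [V = c(|x|^2) phi]; it is bounded above through [radial_dilation]
   and [phi(s x) >= phi(x) (1 + (s - 1) (<x, th> - (s + 1) |x|^2 / 2))]. *)
Let dilation s : 1 < s ->
  s ^+ k.-1 * (A4 - A2d + (s - 1) / 2 * A4) <=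
  - (A3 + (s - 1) * (B1 - (s + 1) / 2 * B2)) / 2.
Proof.
move=> s1; have s0 : 0 < s by exact: lt_trans s1.
have s10 : 0 < s - 1 by rewrite subr_gt0.
pose q := (s ^+ k.-1)^-1.
have q0 : 0 < q by rewrite invr_gt0 exprn_gt0.
pose e x := dotr x th - (s + 1) / 2 * sqnorm x.
(* Expanded form of [- b (1 + (s - 1) e) + c (s - 1) e] with [b = q (s - 1) |x|^2 c^2 / 2], arranged
   so that its expectation is a combination of [A3], [B1], [B2], [A2d] and [A4]. *)
pose D x := (- (q * (s - 1) / 2)) * (cs x * (cs x * sqnorm x)) +
   ((- (q * (s - 1) ^+ 2 / 2)) * (cs x * (cs x * (sqnorm x * dotr x th))) +
   ((q * (s - 1) ^+ 2 * (s + 1) / 4) * (cs x * (cs x * (sqnorm x * sqnorm x))) +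
   ((s - 1) * (cs x * dotr x th) + (- ((s - 1) * (s + 1) / 2)) * (cs x * sqnorm x)))).
have tD : tame D.
  by do !(apply: tame_add; first by apply: tame_scale; do ?apply: tame_c); apply: tame_scale; exact: tame_c.
have ED : E D = - (q * (s - 1) / 2) * A3 + (- (q * (s - 1) ^+ 2 / 2) * B1 +
    (q * (s - 1) ^+ 2 * (s + 1) / 4 * B2 + ((s - 1) * A2d + - ((s - 1) * (s + 1) / 2) * A4))).
  rewrite /D !E_add ?E_scale//;
  do ?[by do ?(apply: tame_add); do ?(apply: tame_scale); do ?apply: tame_c
      |by do !(apply: tame_add; first by apply: tame_scale; do ?apply: tame_c); apply: tame_scale; exact: tame_c].
have tV : tame cs.
  split => //; exists 1 => x; rewrite mul1r (le_trans (c_norm x))//.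
  exact: exprn_ege1.
pose V x := cs x * phi x.
have iV : mu.-integrable setT (EFin \o V) by exact: tame_int.
have mV : measurable_fun setT V by apply/measurable_EFinP; exact: measurable_int iV.
have mZ : measurable_fun setT (fun x : 'rV[R]_k => s *: x).
  apply: measurable_rowP => i; under eq_fun do rewrite mxE.
  by apply: measurable_funM => //; exact: measurable_coord.
(* As [c <= 0], the opposite of [V] is nonnegative and the scaling formula for nonnegative functions
   applies to it. *)
pose W1 x := - V x.
pose W2 x := s ^+ k * W1 (s *: x).
have mW1 : measurable_fun setT W1 by exact: measurableT_comp.
have mW2 : measurable_fun setT W2.
  by apply: measurable_funM => //; exact: (measurableT_comp mW1).
have W10 x : 0 <= W1 x.
  by rewrite /W1 /V -mulNr mulr_ge0 ?gauss_pdf_ge0// oppr_ge0 c_le0// sqnorm_ge0.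
have sk0 : 0 < s ^+ k by rewrite exprn_gt0.
have W20 x : 0 <= W2 x by rewrite mulr_ge0// ltW.
have scE : (\int[mu]_x (W1 x)%:E = \int[mu]_x (W2 x)%:E)%E.
  rewrite (ge0_integral_row_scale s0)//; last exact/measurable_EFinP.
  rewrite -ge0_integralZl//;
    by [apply/measurable_EFinP; exact: (measurableT_comp mW1)
       |move=> x _; rewrite lee_fin|rewrite lee_fin ltW].
have iW1 : mu.-integrable setT (EFin \o W1).
  rewrite (_ : _ \o _ = (fun x => - (V x)%:E)%E)//; exact: integrableN.
have iW2 : mu.-integrable setT (EFin \o W2).
  have := iW1 => /integrableP[_]; under eq_integral do rewrite /= ger0_norm//.
  rewrite scE => h; apply/integrableP; split; first exact/measurable_EFinP.
  by under eq_integral do rewrite /= ger0_norm//.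
have IW : \int[mu]_x W1 x = \int[mu]_x W2 x by rewrite /Rintegral scE.
have WD x : W1 x <= W2 x + D x * phi x.
  have hi := radial_dilation k0 dc cineq s1 (sqnorm_ge0 x).
  have p0 := gauss_pdf_ge0 x; have ps0 := gauss_pdf_ge0 (s *: x).
  have hii : phi x * (1 + (s - 1) * e x) <= phi (s *: x).
    have -> : phi (s *: x) = phi x * expR ((s - 1) * e x).
      rewrite /gauss_pdf -[RHS]mulrA -expRD; congr (_ * expR _).
      by rewrite !sqnorm_sub sqnormZ (dotrC (s *: x)) dotrZr (dotrC th x) /e; field.
    by rewrite ler_wpM2l// expR_ge1Dx.
  have c0 := c_le0 (sqnorm_ge0 x); have t0 := sqnorm_ge0 x.
  have b0 : 0 <= q * (s - 1) * (sqnorm x * c (sqnorm x) ^+ 2) / 2.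
    apply: divr_ge0 => //; apply: mulr_ge0; first by apply: mulr_ge0; exact: ltW.
    by apply: mulr_ge0 => //; exact: sqr_ge0.
  (* The lower bound on [phi (s *: x)] is used twice: against a term with coefficient [- b], and
     against [c]. Both coefficients are nonpositive, so both uses bound from above. *)
  have h1 := ler_wpM2r ps0 hi.
  have h2 := ler_wpM2l b0 hii.
  have h3 : c (sqnorm x) * phi (s *: x) <= c (sqnorm x) * (phi x * (1 + (s - 1) * e x)).
    by rewrite ler_wnM2l.
  rewrite /W1 /W2 /W1 /V /cs sqnormZ.
  have -> : D x = - (q * (s - 1) * (sqnorm x * c (sqnorm x) ^+ 2) / 2) * (1 + (s - 1) * e x) +
      c (sqnorm x) * ((s - 1) * e x).
    by rewrite /D /e /cs; field.
  move: h1 h2 h3; rewrite -/q.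
  move: (phi (s *: x)) (phi x) (c (s ^+ 2 * sqnorm x)) (s ^+ k) ((s - 1) * e x)
    (q * (s - 1) * (sqnorm x * c (sqnorm x) ^+ 2) / 2) (c (sqnorm x)).
  move=> ps p c1 S ep b c00; rewrite !(mulrDr, mulrDl, mulNr, mulrN, mulr1, mulrA) => h1 h2 h3; lra.
have : 0 <= E D.
  have := le_Rintegral measurableT iW1 (integrableD measurableT iW2 (tame_int tD)) (fun x _ => WD x).
  by rewrite RintegralD//; [rewrite IW lerDl|exact: tame_int].
rewrite ED => h.
have Qq : s ^+ k.-1 * q = 1 by rewrite /q divff// gt_eqF// exprn_gt0.
have Q0 : 0 <= s ^+ k.-1 by rewrite exprn_ge0// ltW.
have : 0 <= (s - 1) * (s ^+ k.-1 * (- (q / 2) * A3 - (q * (s - 1) / 2) * B1 +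
    (q * (s - 1) * (s + 1) / 4) * B2 + A2d - (s + 1) / 2 * A4)).
  rewrite mulrCA mulr_ge0//; apply: le_trans h _; rewrite le_eqVlt; apply/orP; left; apply/eqP.
  by field.
rewrite pmulr_rge0// => h2; rewrite -subr_ge0; apply: le_trans h2 _.
rewrite le_eqVlt; apply/orP; left; apply/eqP.
rewrite (_ : s ^+ k.-1 * _ = s ^+ k.-1 * q * (- A3 / 2 - (s - 1) / 2 * B1 + (s - 1) * (s + 1) / 4 * B2) +
   s ^+ k.-1 * (A2d - (s + 1) / 2 * A4)); last by field.
by rewrite Qq; field.
Qed.

(** Limit of [dilation] as [s] decreases to 1. The left-hand side is the expectation of
    [c <x, x - th>], which Stein's identity would express by the divergence of [c x]; the right-hand
    side is half the opposite of the expectation of [c^2 |x|^2]. *)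
Let stein : A4 - A2d <= - A3 / 2.
Proof.
apply: (@ler_cvg_to _ ((1 : R)^'+) _ _ (fun s => s ^+ k.-1 * (A4 - A2d + (s - 1) / 2 * A4))
  (fun s => - (A3 + (s - 1) * (B1 - (s + 1) / 2 * B2)) / 2)).
- have c1 : continuous (fun s : R => s ^+ k.-1 * (A4 - A2d + (s - 1) / 2 * A4)).
    move=> s; apply: cvgM; first exact: exprn_continuous.
    apply: cvgD; first exact: cvg_cst.
    apply: cvgM; last exact: cvg_cst.
    by apply: cvgM; [apply: cvgB; [exact: cvg_id|exact: cvg_cst]|exact: cvg_cst].
  have := cvg_at_right_filter (c1 1); rewrite expr1n subrr !mul0r addr0 mul1r; exact.
- have c1 : continuous (fun s : R => - (A3 + (s - 1) * (B1 - (s + 1) / 2 * B2)) / 2).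
    move=> s; apply: cvgM; last exact: cvg_cst.
    apply: cvgN; apply: cvgD; first exact: cvg_cst.
    apply: cvgM; first by apply: cvgB; [exact: cvg_id|exact: cvg_cst].
    apply: cvgB; first exact: cvg_cst.
    apply: cvgM; last exact: cvg_cst.
    by apply: cvgM; [apply: cvgD; [exact: cvg_id|exact: cvg_cst]|exact: cvg_cst].
  have := cvg_at_right_filter (c1 1); rewrite subrr !mul0r addr0; exact.
- by near=> s; apply: dilation; near: s; exact: nbhs_right_gt.
Unshelve. all: by end_near. Qed.

(** Expanding [|x - th + c x|^2], the risk is that of the observation plus [2 (A4 - A2d) + A3],
    which [stein] makes nonpositive. *)
Lemma risk_radial_le :
  (risk th (fun x => (1 + c (sqnorm x)) *: x) <= k%:R%:E)%E.
Proof.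
have t_one : tame (fun=> 1).
  have := tame_prod (measurable_cst (1 : R)) (measurable_cst (1 : R)) b_one b_one.
  by under eq_fun do rewrite mulr1.
pose N x : R := sqnorm x + ((-2) * dotr x th + sqnorm th * 1).
have tN : tame N by apply: tame_add => //; apply: tame_add; exact: tame_scale.
have NE x : N x = sqnorm (x - th) by rewrite /N sqnorm_sub; ring.
pose D x := N x + (2 * (cs x * sqnorm x) + ((-2) * (cs x * dotr x th) + cs x * (cs x * sqnorm x))).
have tA4 : tame (fun x => cs x * sqnorm x) by exact: tame_c.
have tA2 : tame (fun x => cs x * dotr x th) by exact: tame_c.
have tA3 : tame (fun x => cs x * (cs x * sqnorm x)) by do 2 apply: tame_c.
have tD1 : tame (fun x => (-2) * (cs x * dotr x th) + cs x * (cs x * sqnorm x)).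
  by apply: tame_add => //; exact: tame_scale.
have tD2 : tame (fun x => 2 * (cs x * sqnorm x) + ((-2) * (cs x * dotr x th) + cs x * (cs x * sqnorm x))).
  by apply: tame_add => //; exact: tame_scale.
have tD : tame D by exact: tame_add.
have ED : E D = E N + (2 * A4 + ((-2) * A2d + A3)).
  rewrite /D (E_add tN tD2) (E_add (tame_scale 2 tA4) tD1) (E_add (tame_scale (-2) tA2) tA3).
  by rewrite (E_scale 2 tA4) (E_scale (-2) tA2).
have EN : E N <= k%:R.
  have h20 : 0 < 1 / 2 :> R by lra.
  have [M [HM _ /(_ erefl) Mle]] := gauss_row_moment th th h20.
  have CE : (2 * pi) `^ (- (k%:R / 2)) * M = E N.
    apply: EFin_inj; rewrite EFinM -HM -ge0_integralZl//; last 3 first.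
    - apply/measurable_EFinP; apply: measurable_funM; first exact: measurable_sqnorm_sub.
      exact: measurable_gauss_row.
    - by move=> x _; rewrite lee_fin mulr_ge0 ?expR_ge0// sqnorm_ge0.
    - by rewrite lee_fin powR_ge0.
    rewrite /E /Rintegral fineK; last first.
      by apply: integrable_fin_num => //; exact: tame_int.
    apply: eq_integral => x _; rewrite -EFinM NE; congr EFin.
    by rewrite /gauss_pdf div1r [2^-1 * _]mulrC; ring.
  rewrite -CE; apply: (le_trans (ler_wpM2l (powR_ge0 _ _) Mle)).
  rewrite gauss_const (_ : pi / (1 / 2) = 2 * pi); last by field.
  rewrite (_ : 2 * (1 / 2) = 1); last by field.
  have p0 : Num.sqrt (2 * pi) != 0 :> R by rewrite gt_eqF// sqrtr_gt0 mulr_gt0// pi_gt0.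
  by rewrite divr1 mulrCA -exprMn mulVf// expr1n mulr1.
have -> : (risk th (fun x => (1 + c (sqnorm x)) *: x) = (E D)%:E)%E.
  rewrite /E /Rintegral fineK; last by apply: integrable_fin_num => //; exact: tame_int.
  apply: eq_integral => x _; congr (_ * _)%:E.
  rewrite /D NE /cs !sqnorm_sub sqnormZ (dotrC _ th) dotrZr (dotrC th); ring.
rewrite lee_fin ED; have := stein; move: EN; lra.
Qed.

End risk_bound.

(** * Marginal density and Bayes estimator *)

Section entire_series.
Context {R : realType}.

Definition entire (a : nat -> R) :=
  (forall j, 0 <= a j) /\ (forall K, 0 <= K -> cvgn (pseries a K)).

Lemma cvg_seriesS (w : nat -> R) : cvgn (series w) -> cvgn (series (fun i => w i.+1)).
Proof.
move=> cw.
have -> : series (fun i => w i.+1) = (fun n => series w n.+1 - w 0%N).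
  apply/funext => n; by rewrite /series/= big_nat_recl// [RHS]addrC addKr.
have /cvg_ex[l cl] := cw; apply/cvg_ex; exists (l - w 0%N).
by apply: cvgB; [rewrite (cvg_shiftS (series w))|exact: cvg_cst].
Qed.

(** The factor [i + 1] is at most [2^(i+1)], so the derived series at [K] is dominated by the
    original one at [2 (K + 1)]. *)
Lemma entire_diffs (a : nat -> R) : entire a -> entire (pseries_diffs a).
Proof.
move=> [a0 ca]; split => [j|K K0]; first by rewrite mulr_ge0.
have K1 : 0 <= 2 * (K + 1) by rewrite mulr_ge0// addr_ge0.
apply: (@series_le_cvg _ _ (fun i => a i.+1 * (2 * (K + 1)) ^+ i.+1)) => [i|i|i|].
- by rewrite mulr_ge0 ?exprn_ge0// mulr_ge0.
- by rewrite mulr_ge0 ?exprn_ge0.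
- rewrite /pseries_diffs/= mulrAC [leLHS]mulrC ler_wpM2l// exprMn ler_pM ?exprn_ge0//.
    by rewrite -natrX ler_nat ltnW// ltn_expl.
  rewrite exprSr (@le_trans _ _ ((K + 1) ^+ i))//.
    by rewrite lerXn2r ?nnegrE ?addr_ge0// lerDl.
  by rewrite ler_peMr ?exprn_ge0 ?addr_ge0// lerDr.
- exact: (cvg_seriesS (ca _ K1)).
Qed.

Lemma entire_derive (a : nat -> R) (x : R) : entire a ->
  is_derive x 1 (fun y => limn (pseries a y)) (limn (pseries (pseries_diffs a) x)).
Proof.
move=> ea; have ea1 := entire_diffs ea; have ea2 := entire_diffs ea1.
have K0 : 0 <= `|x| + 1 by rewrite addr_ge0.
apply: (@pseries_snd_diffs _ a (`|x| + 1)).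
- by case: ea => _; apply.
- by case: ea1 => _; apply.
- by case: ea2 => _; apply.
- by rewrite [ltRHS]ger0_norm// ltrDl.
Qed.

Lemma entire_ge (a : nat -> R) t : entire a -> 0 <= t -> a 0%N <= limn (pseries a t).
Proof.
move=> [a0 ca] t0; apply: limr_ge; first exact: ca.
exists 1%N => // -[//|n] _; rewrite /pseries /series/= big_nat_recl// expr0 mulr1 lerDl.
by apply: sumr_ge0 => i _; rewrite mulr_ge0 ?exprn_ge0.
Qed.

End entire_series.

Section I_transform_radial.
Context {R : realType}.
Local Notation leb := (@lebesgue_measure R).
Variable k : nat.
Hypothesis k0 : (0 < k)%N.
Local Notation nu := ((k%:R - 2) / 2 : R).

(** The square root in the kernel raises the exponent of [z = x y] from [nu] to [(k - 1) / 2], the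
    power that the weight in [radial_weight] is made to cancel. *)
Lemma I_kernelE x y : 0 < x -> 0 < y ->
  I_kernel nu x y = 2 `^ (- nu) * (x * y) `^ ((k%:R - 1) / 2) * besB k ((x * y) ^+ 2).
Proof.
move=> x0 y0; rewrite /I_kernel; set z := x * y.
have z0 : 0 < z by rewrite mulr_gt0.
have z2 : 0 < z / 2 by rewrite divr_gt0.
have -> : besselI nu z = (z / 2) `^ nu * besB k (z ^+ 2).
  rewrite /besselI /besB.
  rewrite (_ : (fun j : nat => _) = (fun j => (z / 2) `^ nu * (besc k j * (z ^+ 2) ^+ j))).
    rewrite (_ : series _ = (fun n => (z / 2) `^ nu * series (fun j => besc k j * (z ^+ 2) ^+ j) n)); last first.
      by apply/funext => n; rewrite /series/= mulr_sumr.
    apply/cvg_lim => //; apply: cvgM; first exact: cvg_cst.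
    by apply: is_cvg_besB => //; exact: sqr_ge0.
  apply/funext => j; rewrite /besc.
  have -> : nu + j.+1%:R = k%:R / 2 + j%:R by rewrite -natr1; field.
  rewrite powRD ?(gt_eqF z2) ?implybT// powR_mulrn ?(ltW z2)//.
  have -> : (z / 2) ^+ j.*2 = (z ^+ 2) ^+ j / 4 ^+ j.
    by rewrite -mul2n exprM expr_div_n expr_div_n; congr (_ / _ ^+ _); rewrite -natrX.
  have f0 : j`!%:R != 0 :> R by rewrite pnatr_eq0 -lt0n fact_gt0.
  have p4 : 4 ^+ j != 0 :> R by rewrite expf_neq0.
  have G0 := @Gamma_index_gt0 R k k0 j.
  move: (Gamma _) G0 (j`!%:R) f0 (4 ^+ j) p4 => G G0 f f0 p4 hp4.
  by field; rewrite hp4 f0 gt_eqF.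
have -> : (z / 2) `^ nu = 2 `^ (- nu) * z `^ nu.
  by rewrite powRM ?(ltW z0)// -[2^-1]powR_inv1// -powRrM mulN1r mulrC.
have <- : Num.sqrt z * z `^ nu = z `^ ((k%:R - 1) / 2).
  rewrite -powR12_sqrt ?(ltW z0)// -powRD ?(gt_eqF z0) ?implybT//.
  by congr powR; field.
by ring.
Qed.

Lemma measurable_restrict_pos (g : R -> R) : measurable_fun (`[0, +oo[ : set R) g ->
  measurable_fun setT (g \_ `[0, +oo[).
Proof. by move=> mg; apply/(measurable_restrictT _ _).1 => //; exact: measurable_itv. Qed.

Variables (g F : R -> R).
Hypothesis hg : spherical_prior k g.

(** [g] is controlled on [[0, +oo[] only; its extension by zero is nonnegative and measurable on the
    whole line. *)
Let gT := g \_ `[0, +oo[.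

Let gTE t : 0 <= t -> gT t = g t.
Proof. by move=> t0; rewrite /gT patchE ifT// inE/= in_itv/= t0. Qed.

Let gT0 t : 0 <= gT t.
Proof.
rewrite /gT patchE; case: ifPn => //; rewrite inE/= in_itv/= andbT => t0.
by case: hg => _ + _; exact.
Qed.

Let mgT : measurable_fun setT gT.
Proof. by apply: measurable_restrict_pos; case: hg. Qed.

Let rho (r : R) := expR (- (r ^+ 2 / 2)) * gT (r ^+ 2).

Let rho0 r : 0 <= rho r. Proof. by rewrite mulr_ge0 ?expR_ge0. Qed.

Let mrho : measurable_fun setT rho.
Proof.
apply: measurable_funM; last exact: measurableT_comp.
by apply: measurableT_comp => //; apply: measurableT_comp => //; exact: measurable_funM.
Qed.

(** By the polar formula, the integral of [exp (<x, th> - |th|^2 / 2)] against the prior when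
    [|x|^2 = s]. It is the common source of the marginal, at [s = |x|^2], and of [F], at
    [s = y^2]. *)
Let T (s : R) := (\int[leb]_(r in `]0%R, +oo[) (polar_kernel k s r * rho r)%:E)%E.
Let I (j : nat) := (\int[leb]_(r in `]0%R, +oo[) (r ^+ (k.-1 + j.*2) * rho r)%:E)%E.
Let C : R := 2 * pi `^ (k%:R / 2).

Let C0 : 0 < C. Proof. by rewrite mulr_gt0// powR_gt0// pi_gt0. Qed.

Let TE s : 0 <= s -> (T s = \sum_(0 <= j <oo) ((C * besc k j * s ^+ j)%:E * I j))%E.
Proof.
by move=> s0; rewrite /T integral_polar_series//; exact: measurable_funTS.
Qed.

Let I0 j : (0 <= I j)%E.
Proof.
apply: integral_ge0 => r; rewrite /= in_itv/= andbT => r0.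
by rewrite lee_fin mulr_ge0// exprn_ge0// ltW.
Qed.

Let T0 s : 0 <= s -> (0 <= T s)%E.
Proof.
move=> s0; apply: integral_ge0 => r; rewrite /= in_itv/= andbT => r0.
by rewrite lee_fin mulr_ge0// polar_kernel_ge0// ltW.
Qed.

Let c1 := 2 `^ (- nu) / Gamma (k%:R / 2 : R).

Let Gk : 0 < Gamma (k%:R / 2 : R).
Proof. by have := @Gamma_index_gt0 R k k0 0; rewrite addr0. Qed.

Let c10 : 0 < c1. Proof. by rewrite divr_gt0// powR_gt0. Qed.

Let weight_kernelE r y : 0 < r -> 0 < y ->
  radial_weight k (radial_density k g) r * I_kernel nu r y =
  c1 * y `^ ((k%:R - 1) / 2) * (polar_kernel k (y ^+ 2) r * rho r).
Proof.
move=> r0 y0; rewrite I_kernelE// /radial_weight /radial_density /polar_kernel /rho gTE ?sqr_ge0//.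
rewrite powRM ?ltW// exprMn /c1.
have er : r `^ ((1 - k%:R) / 2) * (r `^ ((k%:R - 1) / 2) * y `^ ((k%:R - 1) / 2)) = y `^ ((k%:R - 1) / 2).
  rewrite mulrA -powRD ?(gt_eqF r0) ?implybT//.
  have -> : (1 - k%:R) / 2 + (k%:R - 1) / 2 = 0 :> R by field.
  by rewrite powRr0 mul1r.
rewrite -[in RHS]er; have G0 := gt_eqF Gk.
move: (Gamma (k%:R / 2)) G0 => G G0; field.
by rewrite G0.
Qed.

Hypothesis hF : is_I_transform nu (radial_weight k (radial_density k g)) F.

(** The integrand of the I-transform at [y = sqrt s] is nonnegative, so its absolute convergence is
    exactly the finiteness of [T s]. *)
Let T_lty s : 0 < s -> (T s < +oo)%E.
Proof.
move=> s0; set y := Num.sqrt s; have y0 : 0 < y by rewrite sqrtr_gt0.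
have ys : s = y ^+ 2 by rewrite sqr_sqrtr// ltW.
have [/integrableP[_ +] _] := hF y0.
have cy : 0 < c1 * y `^ ((k%:R - 1) / 2) by rewrite mulr_gt0// powR_gt0.
have -> : (\int[leb]_(x in `]0%R, +oo[) `|(radial_weight k (radial_density k g) x * I_kernel nu x y)%:E| =
    (c1 * y `^ ((k%:R - 1) / 2))%:E * T s)%E.
  rewrite /T -ge0_integralZl//; last 3 first.
  - apply/measurable_EFinP; apply: measurable_funTS; apply: measurable_funM => //.
    by apply: measurable_polar_kernel => //; exact: ltW.
  - move=> r; rewrite /= in_itv/= andbT => r0.
    by rewrite lee_fin mulr_ge0// polar_kernel_ge0// ltW.
  - by rewrite lee_fin ltW.
  apply: eq_integral => r; rewrite inE/= in_itv/= andbT => r0.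
  rewrite weight_kernelE// -ys -EFinM ger0_norm// mulr_ge0 ?(ltW cy)//.
  by rewrite mulr_ge0// polar_kernel_ge0// ltW.
case: (T s) (T0 (ltW s0)) => [t _ _|_|//]; first by rewrite ltry.
by rewrite gt0_muley ?lte_fin.
Qed.

(** [T 1] is a series of nonnegative terms in which [I j] has a positive coefficient, so its
    finiteness bounds each moment. *)
Let I_fin j : I j \is a fin_num.
Proof.
rewrite ge0_fin_numE//; have := T_lty ltr01; rewrite TE//.
have b0 : 0 < C * besc k j * 1 ^+ j by rewrite expr1n mulr1 mulr_gt0// besc_gt0.
move=> /(le_lt_trans _) h.
have : ((C * besc k j * 1 ^+ j)%:E * I j < +oo)%E.
  apply: h; apply: (le_trans _ (@nneseries_lim_ge _ _ xpredT 0 j.+1 _)).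
    rewrite big_nat_recr//= leeDr// sume_ge0// => i _.
    by rewrite mule_ge0// lee_fin mulr_ge0 ?exprn_ge0// mulr_ge0 ?(ltW C0)// besc_ge0.
  move=> i _ _.
  by rewrite mule_ge0// lee_fin mulr_ge0 ?exprn_ge0// mulr_ge0 ?(ltW C0)// besc_ge0.
case: (I j) (I0 j) => [t _ _|_|//]; first by rewrite ltry.
by rewrite gt0_muley ?lte_fin.
Qed.

Let a (j : nat) : R := C * besc k j * fine (I j).

Let a0 j : 0 <= a j.
Proof. by rewrite mulr_ge0 ?fine_ge0// mulr_ge0 ?(ltW C0)// besc_ge0. Qed.

Let TaE s : 0 <= s -> (T s = \sum_(0 <= j <oo) (a j * s ^+ j)%:E)%E.
Proof.
move=> s0; rewrite TE//; apply: eq_eseriesr => j _.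
by rewrite -(fineK (I_fin j)) -EFinM /a; congr EFin; ring.
Qed.

(** Convergence at positive points is finiteness of [T]; the point 0 is reached by comparison with
    the series at 1. *)
Let entire_a : entire a.
Proof.
split => // K K0; have [K1|K1] := ltP 0 K.
  apply: cvg_series_lty => [j|]; first by rewrite mulr_ge0 ?exprn_ge0.
  by rewrite -TaE// T_lty.
have h : cvgn (series (fun j => a j * 1 ^+ j)).
  apply: cvg_series_lty => [j|]; first by rewrite expr1n mulr1.
  by rewrite -TaE// T_lty.
apply: series_le_cvg h => j; rewrite ?expr1n ?mulr1//.
  by rewrite mulr_ge0 ?exprn_ge0.
by rewrite ler_piMr// exprn_ile1// (le_trans K1).
Qed.

Let TP s : 0 <= s -> T s = (limn (pseries a s))%:E.
Proof.
by move=> s0; rewrite TaE// nneseries_EFin_lim//; case: entire_a => _; apply.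
Qed.

Let H (t : R) : \bar R := (expR (- (t / 2)) * gT t)%:E.

Let mH : measurable_fun setT H.
Proof.
apply/measurable_EFinP; apply: measurable_funM => //.
by apply: measurableT_comp => //; apply: measurableT_comp => //; exact: measurable_funM.
Qed.

Let polarT (x : 'rV[R]_k) :
  (\int[lebesgue_row k]_th ((expR (dotr x th))%:E * H (sqnorm th)) = T (sqnorm x))%E.
Proof.
rewrite polar_exp//; last by move=> t; rewrite lee_fin mulr_ge0 ?expR_ge0.
Qed.

(** If [a 0] vanished, so would [T 0], the integral of the prior against a positive Gaussian weight.
    The prior density would then be zero almost everywhere, against its positive mass. *)
Let a0_gt0 : 0 < a 0%N.
Proof.
rewrite lt_neqAle a0 andbT; apply/negP => /eqP a00.
have gm : measurable_fun setT (fun th : 'rV[R]_k => (gT (sqnorm th))%:E).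
  by apply/measurable_EFinP; apply: measurableT_comp => //; exact: measurable_sqnormT.
have Hm : measurable_fun setT (fun th : 'rV[R]_k => H (sqnorm th)).
  by apply: measurableT_comp => //; exact: measurable_sqnormT.
have d0 (th : 'rV[R]_k) : dotr 0 th = 0.
  by rewrite /dotr big1// => i _; rewrite mxE mul0r.
have s0 : sqnorm (0 : 'rV[R]_k) = 0.
  by rewrite /sqnorm big1// => i _; rewrite mxE expr0n.
have h : (\int[lebesgue_row k]_th `|H (sqnorm th)| = 0)%E.
  transitivity (T (sqnorm (0 : 'rV[R]_k))).
    rewrite -polarT; apply: eq_integral => th _.
    by rewrite d0 expR0 mul1e gee0_abs// lee_fin mulr_ge0 ?expR_ge0.
  rewrite s0 TaE// eseries0// => j _ _; case: j => [|j]; last by rewrite expr0n mulr0.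
  by rewrite -a00 mul0r.
have := (ae_eq_integral_abs (lebesgue_row k) measurableT Hm).1 h.
move=> ae0; case: hg => _ _; apply/negP; rewrite -leNgt.
rewrite (_ : (\int[_]_x _ = 0)%E)//.
rewrite (_ : (\int[_]_x _ = \int[lebesgue_row k]_th `|(gT (sqnorm th))%:E|)%E); last first.
  by apply: eq_integral => th _; rewrite gTE ?sqnorm_ge0// gee0_abs// lee_fin -gTE ?sqnorm_ge0.
apply/(ae_eq_integral_abs (lebesgue_row k) measurableT gm).
apply: filterS ae0 => th /(_ Logic.I)[] /eqP; rewrite mulf_eq0 gt_eqF ?expR_gt0//= => /eqP h' _.
by rewrite h'.
Qed.

Lemma marginal_series : exists (b : nat -> R) (c : R),
  [/\ entire b, 0 < b 0%N, 0 < c,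
      forall x : 'rV[R]_k, marginal g x =
        (2 * pi) `^ (- (k%:R / 2)) * (expR (- (sqnorm x / 2)) * limn (pseries b (sqnorm x))) &
      forall y, 0 < y -> F y = c * y `^ ((k%:R - 1) / 2) * limn (pseries b (y ^+ 2))].
Proof.
exists a, c1; split => //.
- move=> x; rewrite /marginal.
  set C2 : R := (2 * pi) `^ _.
  have -> : (\int[lebesgue_row k]_th (gauss_pdf th x * g (sqnorm th))%:E =
      (C2 * expR (- (sqnorm x / 2)))%:E * T (sqnorm x))%E.
    rewrite -polarT -ge0_integralZl//; last 3 first.
    - apply: emeasurable_funM.
        apply/measurable_EFinP; apply: measurableT_comp => //; exact: measurable_dotr.
      by apply: measurableT_comp => //; exact: measurable_sqnormT.
    - by move=> th _; rewrite -EFinM lee_fin !mulr_ge0 ?expR_ge0.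
    - by rewrite lee_fin mulr_ge0 ?expR_ge0 ?powR_ge0.
    apply: eq_integral => th _; rewrite /H -!EFinM gTE ?sqnorm_ge0//; congr EFin.
    rewrite /gauss_pdf -/C2 !mulrA; congr (_ * _); rewrite -!mulrA; congr (_ * _).
    by rewrite -!expRD; congr expR; rewrite sqnorm_sub; field.
  by rewrite TP ?sqnorm_ge0// -EFinM/= mulrA.
- move=> y y0; have [_ ->] := hF y0.
  have y20 : 0 <= y ^+ 2 by exact: sqr_ge0.
  rewrite /Rintegral.
  have -> : (\int[leb]_(x in `]0%R, +oo[) (radial_weight k (radial_density k g) x * I_kernel nu x y)%:E =
    (c1 * y `^ ((k%:R - 1) / 2))%:E * T (y ^+ 2))%E.
    rewrite /T -ge0_integralZl//; last 3 first.
    - apply/measurable_EFinP; apply: measurable_funTS; apply: measurable_funM => //.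
      exact: measurable_polar_kernel.
    - move=> r; rewrite /= in_itv/= andbT => r0.
      by rewrite lee_fin mulr_ge0// polar_kernel_ge0// ltW.
    - by rewrite lee_fin mulr_ge0 ?powR_ge0// ltW.
    apply: eq_integral => r; rewrite inE/= in_itv/= andbT => r0.
    by rewrite weight_kernelE// -EFinM.
  by rewrite TP// -EFinM.
Qed.

End I_transform_radial.

Section derivative_rules.
Context {R : realType}.
Implicit Types (f g : R -> R) (u a b : R).

Lemma is_deriveM_fun f g u a b : is_derive u 1 f a -> is_derive u 1 g b ->
  is_derive u 1 (fun y => f y * g y) (a * g u + f u * b).
Proof.
move=> df dg; rewrite -[fun y => _]/(f * g).
by apply: is_derive_eq; rewrite /GRing.scale/=; ring.
Qed.

Lemma is_deriveD_fun f g u a b : is_derive u 1 f a -> is_derive u 1 g b ->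
  is_derive u 1 (fun y => f y + g y) (a + b).
Proof. by move=> df dg; rewrite -[fun y => _]/(f + g); exact: is_deriveD. Qed.

Lemma is_deriveZ_fun f u c a : is_derive u 1 f a ->
  is_derive u 1 (fun y => c * f y) (c * a).
Proof.
move=> df; apply: is_derive_eq (is_deriveM_fun (is_derive_cst c u 1) df) _.
by rewrite mul0r add0r.
Qed.

Lemma is_derive_sqr u : is_derive u 1 (fun y : R => y ^+ 2) (2 * u).
Proof.
apply: is_derive_eq (is_deriveM_fun (is_derive_id u 1) (is_derive_id u 1)) _.
by ring.
Qed.

Lemma is_derive_comp_sqr f u a : is_derive (u ^+ 2) 1 f a ->
  is_derive u 1 (fun y => f (y ^+ 2)) (a * (2 * u)).
Proof.
by move=> df; apply: (is_derive1_comp (f := f) (g := fun y => y ^+ 2)) => //; exact: is_derive_sqr.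
Qed.

Lemma is_derive_expR f u a : is_derive u 1 f a ->
  is_derive u 1 (fun y => expR (f y)) (a * expR (f u)).
Proof.
move=> df; apply: is_derive_eq (is_derive1_comp (is_derive_expR (f u)) df) _.
by rewrite mulrC.
Qed.

Lemma is_derive_near f g u a : (forall y : R, 0 < y -> f y = g y) -> 0 < u ->
  is_derive u 1 g a -> 'D_1 f u = a.
Proof.
move=> fg u0 dg; rewrite -(@derive_val _ _ _ _ _ _ _ dg).
apply: near_eq_derive; near=> y; apply: fg; near: y; exact: lt_nbhsr.
Unshelve. all: by end_near. Qed.

End derivative_rules.

(** * The differential inequality in terms of the marginal *)

Section condition.
Context {R : realType} (k : nat).
Local Notation q := ((k%:R - 1) / 2 : R).

(** Naming the expression lets its transformation be an equality, used with the marginal for the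
    first part and with a squared solution for the second. *)
Definition condition_lhs (F : R -> R) (u : R) : R :=
  derive1n 2 F u / F u - 1 / 2 * (derive1 F u / F u) ^+ 2
    + derive1 F u / F u * ((k%:R - 1) / 2 * (1 / u) - u)
    + (k%:R - 1) * (7 - 3 * k%:R) / 8 * (1 / u ^+ 2)
    + 1 / 2 * u ^+ 2 - (k%:R + 1) / 2.

(* With [F = A m u^q e^(u^2/2)] the condition is [Delta (sqrt m) <= 0] for the
   radial function [m]. *)
Lemma condition_transform (F m m1 m2 : R -> R) (A u : R) : A != 0 ->
  (forall y : R, 0 < y -> F y = A * (m y * (y `^ q * expR (y ^+ 2 / 2)))) ->
  (forall y : R, 0 < y -> is_derive y 1 m (m1 y)) ->
  (forall y : R, 0 < y -> is_derive y 1 m1 (m2 y)) ->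
  0 < u -> m u != 0 ->
  condition_lhs F u =
  m2 u / m u - 1 / 2 * (m1 u / m u) ^+ 2 + (k%:R - 1) / u * (m1 u / m u).
Proof.
move=> A0 FE dm dm1 u0 mu0.
pose w (y : R) := y `^ q * expR (y ^+ 2 / 2).
(* [v] is the logarithmic derivative of [w], so both derivatives of [F] keep [w] as a factor and it
   cancels in the quotients. *)
pose v (y : R) := q * y^-1 + y.
have dw (y : R) : 0 < y -> is_derive y 1 w (w y * v y).
  move=> y0; have d2 : is_derive y 1 (fun y : R => y ^+ 2 / 2) y.
    have := is_deriveZ_fun 2^-1 (is_derive_sqr y); rewrite mulKf//.
    by rewrite (_ : (fun x : R => 2^-1 * x ^+ 2) = (fun x => x ^+ 2 / 2))//; apply/funext => x; rewrite mulrC.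
  apply: is_derive_eq (is_deriveM_fun (is_derive1_powR q y0) (is_derive_expR d2)) _.
  rewrite powRB ?(gt_eqF y0) ?implybT// powRr1 ?ltW// /w /v; field.
  by rewrite gt_eqF.
have dv (y : R) : 0 < y -> is_derive y 1 v (- q / y ^+ 2 + 1).
  move=> y0; have yn : (id y : R) != 0 by rewrite gt_eqF.
  have di := @is_deriveV _ id y 1 1 yn (is_derive_id y 1).
  apply: is_derive_eq (is_deriveD_fun (is_deriveZ_fun q di) (is_derive_id y 1)) _.
  by rewrite /GRing.scale/= mulr1 mulrN mulNr.
pose F1 y := A * (m1 y * w y + m y * (w y * v y)).
have F1E (y : R) : 0 < y -> derive1 F y = F1 y.
  move=> y0; rewrite derive1E; apply: (is_derive_near FE y0).
  by apply: is_deriveZ_fun; apply: is_deriveM_fun; [exact: dm|exact: dw].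
have F2E : derive1n 2 F u = A * ((m2 u * w u + m1 u * (w u * v u)) +
    (m1 u * (w u * v u) + m u * (w u * v u * v u + w u * (- q / u ^+ 2 + 1)))).
  rewrite [LHS]derive1E; apply: (is_derive_near F1E u0).
  apply: is_deriveZ_fun; apply: is_deriveD_fun.
    by apply: is_deriveM_fun; [exact: dm1|exact: dw].
  apply: is_deriveM_fun; first exact: dm.
  by apply: is_deriveM_fun; [exact: dw|exact: dv].
have w0 : w u != 0 by rewrite gt_eqF// mulr_gt0 ?powR_gt0 ?expR_gt0.
rewrite /condition_lhs F2E F1E// FE// -/(w u) /F1 /v.
move: (w u) w0 (m u) mu0 (m1 u) (m2 u) => W W0 M M0 M1 M2; field.
by rewrite A0 W0 M0 gt_eqF.
Qed.

End condition.

Section bayes_estimator.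
Context {R : realType} (k : nat).
Hypothesis k0 : (0 < k)%N.
Variables (g : R -> R) (b : nat -> R).
Hypothesis eb : entire b.
Hypothesis b0 : 0 < b 0%N.

Let P (t : R) : R := limn (pseries b t).
Let P1 (t : R) : R := limn (pseries (pseries_diffs b) t).
Let P2 (t : R) : R := limn (pseries (pseries_diffs (pseries_diffs b)) t).

Let dP (t : R) : is_derive t 1 P (P1 t). Proof. exact: entire_derive. Qed.
Let dP1 (t : R) : is_derive t 1 P1 (P2 t).
Proof. by apply: entire_derive; exact: entire_diffs. Qed.

Let P_gt0 t : 0 <= t -> 0 < P t.
Proof. by move=> t0; apply: lt_le_trans b0 _; exact: entire_ge. Qed.

Let P1_ge0 t : 0 <= t -> 0 <= P1 t.
Proof.
move=> t0; have e1 := entire_diffs eb.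
by apply: le_trans (entire_ge e1 t0); case: e1.
Qed.

Let c (t : R) : R := 2 * (P1 t / P t) - 1.
Let c' (t : R) : R := 2 * (P2 t / P t - (P1 t / P t) ^+ 2).

Let dc (t : R) : 0 <= t -> is_derive t 1 c (c' t).
Proof.
move=> t0; have Pn : P t != 0 by rewrite gt_eqF// P_gt0.
have di := is_deriveV Pn (dP t).
have h := is_deriveD_fun (is_deriveZ_fun 2 (is_deriveM_fun (dP1 t) di)) (is_derive_cst (-1 : R) t 1).
rewrite -[c]/(fun y => 2 * (P1 y / P y) + cst (-1) y).
apply: is_derive_eq h _.
by rewrite /GRing.scale/= addr0 /c'; congr (_ * _); field.
Qed.

Let c_ge t : 0 <= t -> -1 <= c t.
Proof.
move=> t0; rewrite /c lerBrDl subrr mulr_ge0// divr_ge0 ?P1_ge0//.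
exact/ltW/P_gt0.
Qed.

Let mc : measurable_fun setT (fun x : 'rV[R]_k => c (sqnorm x)).
Proof.
have mcr : measurable_fun (`[0, +oo[ : set R) c.
  apply: subspace_continuous_measurable_fun; first exact: measurable_itv.
  apply: continuous_in_subspaceT => t; rewrite inE/= in_itv/= andbT => t0.
  apply/differentiable_continuous/derivable1_diffP.
  by have [] := dc t0.
have := measurableT_comp (measurable_restrict_pos mcr) (@measurable_sqnormT R k).
rewrite (_ : _ \o _ = (fun x => c (sqnorm x)))//; apply/funext => x /=.
by rewrite patchE ifT// inE/= in_itv/= sqnorm_ge0.
Qed.

Variable C : R.
Hypothesis C0 : 0 < C.
Hypothesis gE : forall x : 'rV[R]_k,
  marginal g x = C * (expR (- (sqnorm x / 2)) * limn (pseries b (sqnorm x))).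

Lemma sqnorm_shift (x : 'rV[R]_k) (i : 'I_k) (h : R) :
  sqnorm (h *: delta_mx ord0 i + x) = sqnorm x + (2 * x ord0 i * h + h ^+ 2).
Proof.
rewrite /sqnorm (bigD1 i)//= [in RHS](bigD1 i)//= !mxE !eqxx /=.
rewrite (eq_bigr (fun j => x ord0 j ^+ 2)); last first.
  by move=> j ji; rewrite !mxE (negbTE ji) andbF mulr0 add0r.
ring.
Qed.

Lemma bayes_estimatorE (x : 'rV[R]_k) :
  bayes_estimator k g x = (1 + c (sqnorm x)) *: x.
Proof.
rewrite /bayes_estimator scalerDl scale1r; congr (_ + _).
apply/rowP => i; rewrite !mxE.
pose L t := ln (C * (expR (- (t / 2)) * P t)).
(* Along a coordinate direction the squared norm is a quadratic polynomial in the step, so the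
   partial derivative is an ordinary derivative at 0. *)
pose phi (h : R) := L (sqnorm x + (2 * x ord0 i * h + h ^+ 2)).
have s0 := sqnorm_ge0 x.
have Ps := P_gt0 s0.
have e0 : 0 < C * (expR (- (sqnorm x / 2)) * P (sqnorm x)).
  by rewrite !mulr_gt0 ?expR_gt0.
transitivity ('D_1 phi (0 : R)).
  have E : (fun h : R => h^-1 *: (((fun y => ln (marginal g y)) \o shift x) (h *: delta_mx ord0 i) -
      ln (marginal g x))) = (fun h : R => h^-1 *: ((phi \o shift 0) (h *: (1 : R)) - phi 0)).
    apply/funext => h; congr (_ *: (_ - _)).
      rewrite /= gE sqnorm_shift /phi /L addr0.
      by rewrite (_ : h *: 1 = h)// /GRing.scale/= mulr1.
    by rewrite gE /phi /L mulr0 expr0n !addr0.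
  by rewrite /derive E.
have dL : is_derive (sqnorm x) 1 L (- 2^-1 + P1 (sqnorm x) / P (sqnorm x)).
  have dh : is_derive (sqnorm x) 1 (fun t : R => - (t / 2)) (- 2^-1).
    rewrite (_ : (fun t : R => - (t / 2)) = (fun t => (- 2^-1) * t)); last first.
      by apply/funext => t; rewrite mulNr mulrC.
    have h := is_deriveZ_fun (- 2^-1) (is_derive_id (sqnorm x) (1 : R)).
    by rewrite mulr1 in h.
  have din := is_deriveZ_fun C (is_deriveM_fun (is_derive_expR dh) (dP (sqnorm x))).
  have dl : is_derive ((fun t : R => C * (expR (- (t / 2)) * P t)) (sqnorm x)) 1 (@ln R)
    (C * (expR (- (sqnorm x / 2)) * P (sqnorm x)))^-1 by exact: is_derive1_ln.
  have h := is_derive1_comp (f := @ln R) (g := fun t : R => C * (expR (- (t / 2)) * P t)) dl din.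
  apply: is_derive_eq h _.
  by field; rewrite !gt_eqF ?expR_gt0.
have dp : is_derive (0 : R) 1 (fun h : R => sqnorm x + (2 * x ord0 i * h + h ^+ 2)) (2 * x ord0 i).
  have h := is_deriveD_fun (is_derive_cst (sqnorm x) (0 : R) 1)
    (is_deriveD_fun (is_deriveZ_fun (2 * x ord0 i) (is_derive_id (0 : R) 1)) (is_derive_sqr 0)).
  by apply: is_derive_eq h _; ring.
have dL0 : is_derive (sqnorm x + (2 * x ord0 i * 0 + 0 ^+ 2)) 1 L (- 2^-1 + P1 (sqnorm x) / P (sqnorm x)).
  by rewrite mulr0 expr0n !addr0.
have dphi := is_derive1_comp (f := L) (g := fun h : R => sqnorm x + (2 * x ord0 i * h + h ^+ 2)) dL0 dp.
rewrite (@derive_val _ _ _ _ _ _ _ dphi) /c; field.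
by rewrite gt_eqF.
Qed.

Lemma measurable_bayes_estimator : measurable_fun setT (bayes_estimator k g).
Proof.
rewrite (_ : bayes_estimator k g = (fun x => (1 + c (sqnorm x)) *: x)); last first.
  by apply/funext => x; exact: bayes_estimatorE.
apply: measurable_rowP => i; under eq_fun do rewrite mxE.
apply: measurable_funM; last exact: measurable_coord.
exact: measurable_funD.
Qed.

Variables (F : R -> R) (A : R).
Hypothesis A0 : 0 < A.
Hypothesis FE : forall y, 0 < y -> F y = A * y `^ ((k%:R - 1) / 2) * limn (pseries b (y ^+ 2)).
Hypothesis cond : minimaxity_condition k F.

Let cineq (t : R) : 0 < t -> k%:R * c t + 2 * t * c' t + t * c t ^+ 2 / 2 <= 0.
Proof.
move=> t0; set u := Num.sqrt t; have u0 : 0 < u by rewrite sqrtr_gt0.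
have tu : t = u ^+ 2 by rewrite sqr_sqrtr// ltW.
have Pu y : 0 < P (y ^+ 2) by rewrite P_gt0// sqr_ge0.
pose e (y : R) := expR (- (y ^+ 2 / 2)).
have e0 y : 0 < e y by exact: expR_gt0.
have de (y : R) : is_derive y 1 e (- y * e y).
  apply: (is_derive_expR (f := fun y => - (y ^+ 2 / 2))).
  rewrite (_ : (fun y : R => - (y ^+ 2 / 2)) = (fun y => (- 2^-1) * y ^+ 2)); last first.
    by apply/funext => z; rewrite mulNr mulrC.
  have h := is_deriveZ_fun (- 2^-1) (is_derive_sqr y).
  by apply: is_derive_eq h _; field.
(* [m] is the radial marginal up to a constant, with logarithmic derivative [y c(y^2)]. Hence
   [m2 / m = c + 2 t c' + t c^2] at [t = y^2]; subtracting [t c^2 / 2] and adding [(k - 1) c] gives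
   the target. *)
pose m y := e y * P (y ^+ 2).
pose m1 y := e y * ((- y) * P (y ^+ 2) + 2 * y * P1 (y ^+ 2)).
pose m2 y := - y * e y * ((- y) * P (y ^+ 2) + 2 * y * P1 (y ^+ 2)) +
  e y * ((- P (y ^+ 2) + (- y) * (P1 (y ^+ 2) * (2 * y))) +
         (2 * P1 (y ^+ 2) + 2 * y * (P2 (y ^+ 2) * (2 * y)))).
have dm (y : R) : is_derive y 1 m (m1 y).
  have h := is_deriveM_fun (de y) (is_derive_comp_sqr (dP (y ^+ 2))).
  apply: is_derive_eq h _.
  by rewrite /m1; ring.
have dm1 (y : R) : is_derive y 1 m1 (m2 y).
  have dN : is_derive y 1 (fun z : R => - z) (- 1) by exact: is_deriveN (is_derive_id y 1).
  have h := is_deriveM_fun (de y) (is_deriveD_fun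
    (is_deriveM_fun dN (is_derive_comp_sqr (dP (y ^+ 2))))
    (is_deriveM_fun (is_deriveZ_fun 2 (is_derive_id y 1)) (is_derive_comp_sqr (dP1 (y ^+ 2))))).
  apply: is_derive_eq h _.
  by rewrite /m2/=; ring.
have FE' (y : R) : 0 < y -> F y = A * (m y * (y `^ ((k%:R - 1) / 2) * expR (y ^+ 2 / 2))).
  move=> y0; rewrite FE// /m /e -/(P _) expRN; field.
  by rewrite gt_eqF ?expR_gt0.
have m0 : m u != 0 by rewrite gt_eqF// mulr_gt0.
have Fu : F u != 0.
  by rewrite FE' // mulf_neq0 ?(gt_eqF A0)// mulf_neq0// mulf_neq0 ?gt_eqF ?powR_gt0 ?expR_gt0.
have An : A != 0 by rewrite gt_eqF.
have := cond u0 Fu; rewrite -/(condition_lhs k F u).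
rewrite (condition_transform An FE' (fun y _ => dm y) (fun y _ => dm1 y) u0 m0).
apply: le_trans; rewrite le_eqVlt; apply/orP; left; apply/eqP.
rewrite tu /m /m1 /m2 /c /c'.
move: (P (u ^+ 2)) (Pu u) (e u) (e0 u) (P1 (u ^+ 2)) (P2 (u ^+ 2)) => p p0 E E0 p1 p2; field.
by rewrite !gt_eqF.
Qed.

Lemma minimax_bayes : minimax (bayes_estimator k g).
Proof.
apply: minimaxW; first exact: measurable_bayes_estimator.
move=> th.
rewrite (_ : bayes_estimator k g = (fun x => (1 + c (sqnorm x)) *: x)); last first.
  by apply/funext => x; exact: bayes_estimatorE.
exact: (risk_radial_le th k0 dc cineq c_ge mc).
Qed.

End bayes_estimator.

Section main_parts.
Context {R : realType} (k : nat).
Hypothesis k0 : (0 < k)%N.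

Lemma minimax_of_condition (g F : R -> R) : spherical_prior k g ->
  is_I_transform ((k%:R - 2) / 2) (radial_weight k (radial_density k g)) F ->
  minimaxity_condition k F -> minimax (bayes_estimator k g).
Proof.
move=> hg hF cond; have [b [A [eb b0 A0 gE FE]]] := marginal_series k0 hg hF.
apply: (minimax_bayes k0 eb b0 _ gE A0 FE cond).
by rewrite powR_gt0// mulr_gt0// pi_gt0.
Qed.

Lemma squared_solution_condition (phi z1 z2 : R -> R) (c1 c2 : R) :
  nonpositive_generalized_series phi ->
  ode_solution k phi z1 -> ode_solution k phi z2 ->
  minimaxity_condition k (squared_solution k z1 z2 c1 c2).
Proof.
move=> [b hb] o1 o2 u u0 Fu.
pose z y := c1 * z1 y + c2 * z2 y.
pose z' y := c1 * derive1 z1 y + c2 * derive1 z2 y.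
pose z'' y := c1 * derive1n 2 z1 y + c2 * derive1n 2 z2 y.
have d1 (zz : R -> R) (y : R) : derivable zz y 1 -> is_derive y 1 zz (derive1 zz y).
  by move=> h; rewrite derive1E; exact: derivableP.
have dz (y : R) : 0 < y -> is_derive y 1 z (z' y).
  move=> y0; have [h1 _ _] := o1 _ y0; have [h2 _ _] := o2 _ y0.
  by apply: is_deriveD_fun; apply: is_deriveZ_fun; exact: d1.
have dz' (y : R) : 0 < y -> is_derive y 1 z' (z'' y).
  move=> y0; have [_ h1 _] := o1 _ y0; have [_ h2 _] := o2 _ y0.
  exact: (is_deriveD_fun (is_deriveZ_fun c1 (d1 (derive1 z1) y h1))
    (is_deriveZ_fun c2 (d1 (derive1 z2) y h2))).
have zu0 : z u != 0.
  by apply: contra Fu => /eqP h; rewrite /squared_solution -/(z u) h expr0n !mul0r.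
pose m y := z y * z y.
pose m1 y := z' y * z y + z y * z' y.
pose m2 y := (z'' y * z y + z' y * z' y) + (z' y * z' y + z y * z'' y).
have dm (y : R) : 0 < y -> is_derive y 1 m (m1 y).
  by move=> y0; apply: is_deriveM_fun; exact: dz.
have dm1 (y : R) : 0 < y -> is_derive y 1 m1 (m2 y).
  by move=> y0; apply: is_deriveD_fun; apply: is_deriveM_fun; do ?[exact: dz|exact: dz'].
have FE (y : R) : 0 < y -> squared_solution k z1 z2 c1 c2 y =
    1 * (m y * (y `^ ((k%:R - 1) / 2) * expR (y ^+ 2 / 2))).
  by move=> _; rewrite /squared_solution -/(z y) mul1r mulrA expr2.
have mu0 : m u != 0 by rewrite mulf_neq0.
(* For [m = z^2] the term [2 (z' / z)^2] coming from [m2 / m] cancels half of the square of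
   [2 z' / z], which makes the expression linear in the second-order operator. *)
rewrite -/(condition_lhs k _ u).
rewrite (condition_transform (oner_neq0 _) FE dm dm1 u0 mu0).
have [_ _ ph] := hb _ u0.
have [_ _ e1] := o1 _ u0; have [_ _ e2] := o2 _ u0.
have e : z'' u + (k%:R - 1) / u * z' u = 1 / 2 * phi u * z u.
  apply/eqP; rewrite -subr_eq0; apply/eqP.
  rewrite /z'' /z' /z.
  transitivity (c1 * (derive1n 2 z1 u + (k%:R - 1) / u * derive1 z1 u - 1 / 2 * phi u * z1 u) +
    c2 * (derive1n 2 z2 u + (k%:R - 1) / u * derive1 z2 u - 1 / 2 * phi u * z2 u)); first by ring.
  by rewrite e1 e2 !mulr0 addr0.
rewrite (_ : _ + _ = phi u)//.
have -> : phi u = 2 * (z'' u + (k%:R - 1) / u * z' u) / z u by rewrite e; field.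
rewrite /m /m1 /m2; field.
by rewrite zu0 gt_eqF.
Qed.

End main_parts.

(** * Uniqueness of the I-transform *)

Section integrable_real.
Context d (T : measurableType d) (R : realType).
Variables (mu : {measure set T -> \bar R}) (D : set T).
Hypothesis mD : measurable D.
Implicit Types f : T -> R.

Lemma integrableZ_real (s : R) f : mu.-integrable D (EFin \o f) ->
  mu.-integrable D (EFin \o (fun x => s * f x)).
Proof. exact: integrableZl. Qed.

Lemma integrableD_real f1 f2 : mu.-integrable D (EFin \o f1) ->
  mu.-integrable D (EFin \o f2) -> mu.-integrable D (EFin \o (fun x => f1 x + f2 x)).
Proof. exact: integrableD. Qed.

Lemma integrableB_real f1 f2 : mu.-integrable D (EFin \o f1) ->
  mu.-integrable D (EFin \o f2) -> mu.-integrable D (EFin \o (fun x => f1 x - f2 x)).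
Proof. exact: integrableB. Qed.

End integrable_real.

Lemma cvg_Rintegral d (T : measurableType d) (R : realType)
    (mu : {sigma_finite_measure set T -> \bar R}) (f_ : nat -> T -> R) (f G : T -> R) :
  (forall n, measurable_fun setT (f_ n)) -> measurable_fun setT f ->
  (forall x, f_ n x @[n --> \oo] --> f x) ->
  mu.-integrable setT (EFin \o G) -> (forall n x, `|f_ n x| <= G x) ->
  \int[mu]_x f_ n x @[n --> \oo] --> \int[mu]_x f x.
Proof.
move=> mf_ mf f_f iG fG.
have [||| |ig _] := @dominated_convergence _ _ _ mu setT measurableT
  (fun n x => (f_ n x)%:E) (fun x => (f x)%:E) (EFin \o G) _ _ _ iG _.
- by move=> n; apply/measurable_EFinP; exact: mf_.
- exact/measurable_EFinP.
- by apply: aeW => x _; apply: cvg_EFin; [exact: nearW|exact: f_f].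
- by apply: aeW => x n _; rewrite lee_fin.
- by rewrite -(fineK (integrable_fin_num measurableT ig)) => /fine_cvg; exact.
Qed.

Section null_density.
Context {R : realType}.
Local Notation leb := (@lebesgue_measure R).

(** The positive and negative parts of [h] have equal integrals over rays, hence over all measurable
    sets. So [h] integrates to zero over each of them. *)
Lemma null_of_rays (h : R -> R) : leb.-integrable setT (EFin \o h) ->
  (forall b, \int[leb]_(x in [set x | x < b]) h x = 0) ->
  ae_eq leb setT (EFin \o h) (cst 0%E).
Proof.
move=> ih h0.
have mh : measurable_fun setT h by apply/measurable_EFinP; exact: measurable_int ih.
have ip := integrable_funrpos measurableT ih.
have iN : leb.-integrable setT (EFin \o h^\-).
  rewrite -funrposN; apply: integrable_funrpos => //; exact: (integrableN ih).
have mid : measurable_fun setT (id : measurableTypeR R -> R) by exact: measurable_id.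
have rays a : \int[leb]_(x in [set x | x < a]) h^\+ x = \int[leb]_(x in [set x | x < a]) h^\- x.
  have mA : measurable ([set x | x < a] : set (measurableTypeR R)).
    by rewrite -[X in measurable X]setTI; exact: measurable_fun_ltr.
  apply/eqP; rewrite -subr_eq0 -RintegralB//; last 2 first.
  - exact: integrableS ip.
  - exact: integrableS iN.
  by rewrite -[X in _ == X](h0 a); apply/eqP/eq_Rintegral => x _; rewrite -[in RHS](funrposBneg h).
have key (A : set R) : measurable A ->
    (\int[leb]_(x in A) (h^\+ x)%:E = \int[leb]_(x in A) (h^\- x)%:E)%E.
  move=> mA; rewrite [LHS]integral_mkcond [RHS]integral_mkcond.
  have := eq_integral_rays ip iN mid mid (@funrpos_ge0 _ _ h) (@funrneg_ge0 _ _ h) rays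
    (H := fun t => (\1_A t : R)%:E).
  have mi : measurable_fun setT (fun t : R => (\1_A t : R)%:E).
    by apply/measurable_EFinP; exact: measurable_indic.
  move=> /(_ _ mi) e; under eq_integral do rewrite epatch_indic muleC/=.
  rewrite e; last by move=> t; rewrite lee_fin.
  by apply: eq_integral => x _; rewrite epatch_indic muleC.
apply: integral_ae_eq => // E _ mE; rewrite integral0.
have -> : EFin \o h = (fun x => ((h^\+ x)%:E - (h^\- x)%:E)%E).
  by apply/funext => x /=; rewrite -[in LHS](funrposBneg h).
rewrite integralB//; last 2 first.
- exact: integrableS ip.
- exact: integrableS iN.
rewrite key// subee//; apply: integrable_fin_num => //; exact: integrableS iN.
Qed.

End null_density.

Section null_cosine_transform.
Context {R : realType}.
Local Notation leb := (@lebesgue_measure R).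
Variable h : R -> R.
Hypothesis ih : leb.-integrable setT (EFin \o h).
Hypothesis h_le0 : forall r, r <= 0 -> h r = 0.
Hypothesis hcos : forall z, \int[leb]_r (h r * cos (z * r)) = 0.

(** This is [sin^2 (c r / 2)]: it takes values in [0, 1] and is increasing while [c r] runs over
    [0, pi]. *)
Let w (c r : R) : R := (1 - cos (c * r)) / 2.

Let w01 c r : 0 <= w c r <= 1.
Proof.
have h1 := cos_le1 (c * r); have h2 := cos_geN1 (c * r).
by rewrite /w; apply/andP; split; lra.
Qed.

Let mcos (z : R) : measurable_fun setT (fun r : R => cos (z * r)).
Proof. by apply: continuous_measurable_fun; move=> x; apply: continuous_comp; [exact: mulrl_continuous|exact: continuous_cos]. Qed.

Let mw (c : R) : measurable_fun setT (w c).
Proof.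
rewrite /w; apply: measurable_funM; last exact: measurable_cst.
by apply: measurable_funB => //; exact: mcos.
Qed.

Let iwcos c n z : leb.-integrable setT (EFin \o (fun r => h r * (w c r ^+ n * cos (z * r)))).
Proof.
apply: (integrable_mul_bounded (M := 1)) => //.
  by apply: measurable_funM; [apply: measurable_funX; exact: mw|exact: mcos].
move=> r; have /andP[a b] := w01 c r.
rewrite normrM mulr_ile1// ?normr_ge0//.
  by rewrite ger0_norm ?exprn_ge0// exprn_ile1.
by rewrite ler_norml cos_geN1 cos_le1.
Qed.

(** The product [w c r * cos (z * r)] is a combination of cosines of frequencies [z], [z + c] and
    [z - c], so the induction on [n] keeps [z] general. *)
Let wcos0 c n z : \int[leb]_r (h r * (w c r ^+ n * cos (z * r))) = 0.
Proof.
elim: n z => [|n ihn] z.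
  by rewrite -[RHS](hcos z); apply: eq_Rintegral => r _; rewrite expr0 mul1r.
transitivity (\int[leb]_r (2^-1 * (h r * (w c r ^+ n * cos (z * r))) -
   4^-1 * ((h r * (w c r ^+ n * cos ((z + c) * r))) + h r * (w c r ^+ n * cos ((z - c) * r))))).
  by apply: eq_Rintegral => r _; rewrite mulrDl mulrBl cosD cosB exprS /w; field.
rewrite RintegralB//; last 2 first.
- by apply: integrableZ_real => //; exact: iwcos.
- by apply: integrableZ_real => //; apply: integrableD_real => //; exact: iwcos.
rewrite !RintegralZl//; try by [exact: iwcos|apply: integrableD_real => //; exact: iwcos].
rewrite RintegralD//; try exact: iwcos.
by rewrite !ihn !mulr0 addr0 mulr0 subr0.
Qed.

(* [w (c m) r < w (c m) b] holds exactly on [0, b[ once [c m * r <= pi], so rays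
   of the variable [w (c m)] tend to rays of [r]. *)
Lemma null_of_cosine_transform : ae_eq leb setT (EFin \o h) (cst 0%E).
Proof.
have mh : measurable_fun setT h by apply/measurable_EFinP; exact: measurable_int ih.
apply: null_of_rays => // b.
have z0 (D : set R) : \int[leb]_(x in D) (0 : R) = 0 by rewrite /Rintegral integral0.
have [b0|b0] := leP b 0.
  rewrite -[RHS](z0 [set x | x < b]).
  by apply: eq_Rintegral => x; rewrite inE/= => xb; rewrite h_le0// ltW// (lt_le_trans xb).
(* [c m * b <= 1 <= pi] keeps [b] in the range where [w] is increasing, for every [m]; as [c m]
   tends to 0, each [r > 0] eventually enters it. *)
pose c (m : nat) : R := (b * m.+1%:R)^-1.
have c0 m : 0 < c m by rewrite invr_gt0 mulr_gt0.
have cb m : 0 < c m * b <= 1.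
  rewrite mulr_gt0//= /c invfM mulrAC mulVf ?gt_eqF// mul1r invf_le1//.
  by rewrite ler1n.
pose a m := w (c m) b.
have dcos (x y : R) : 0 <= x <= pi -> 0 <= y <= pi -> (cos x < cos y) = (y < x).
  by move=> hx hy; rewrite ltr_cos// in_itv.
have pi1 : 1 <= pi :> R by apply: le_trans (pi_ge2 R); rewrite ler1n.
have a01 m : 0 < a m <= 1.
  have /andP[_ ->] := w01 (c m) b; rewrite andbT /a /w divr_gt0// subr_gt0.
  have /andP[h1 h2] := cb m.
  rewrite -[ltRHS]cos0 dcos// ?lexx ?pi_ge0// ltW//=; exact: le_trans h2 pi1.
have mA (m : nat) : measurable ([set r | w (c m) r < a m] : set (measurableTypeR R)).
  rewrite -[X in measurable X]setTI; apply: measurable_fun_ltr => //; exact: mw.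
have mB : measurable ([set r | r < b] : set (measurableTypeR R)).
  by rewrite -[X in measurable X]setTI; exact: measurable_fun_ltr.
(* All moments of [h] in the variable [w (c m)] vanish, so [hausdorff_ray] compares [h] with the
   zero density. *)
have zero m : \int[leb]_r (h \_ [set r | w (c m) r < a m]) r = 0.
  rewrite -Rintegral_mkcond.
  have i0 : leb.-integrable setT (EFin \o (fun=> 0 : R)) by exact: integrable0.
  have moments n : \int[leb]_r (h r * w (c m) r ^+ n) = \int[leb]_r (0 * w (c m) r ^+ n).
    transitivity (0 : R).
      by rewrite -[RHS](wcos0 (c m) n 0); apply: eq_Rintegral => r _; rewrite mul0r cos0 mulr1.
    by rewrite -[LHS](z0 setT); apply: eq_Rintegral => r _; rewrite mul0r.
  by rewrite (hausdorff_ray ih i0 (mw (c m)) (mw (c m)) (w01 _) (w01 _) moments (a01 m)) z0.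
rewrite Rintegral_mkcond.
have : \int[leb]_r (h \_ [set r | w (c m) r < a m]) r @[m --> \oo] -->
    \int[leb]_r (h \_ [set r | r < b]) r.
  apply: (@cvg_Rintegral _ _ _ leb (fun m => h \_ [set r | w (c m) r < a m])
    (h \_ [set r | r < b]) (fun r => `|h r|)).
  - by move=> m; rewrite patch_indic; apply: measurable_funM.
  - by rewrite patch_indic; apply: measurable_funM.
  - move=> r; apply: cvg_near_cst; near=> m.
    have [r0|r0] := leP r 0; first by rewrite !patchE !h_le0// !if_same.
    have crp : 0 <= c m * r <= pi.
      rewrite (mulr_ge0 (ltW (c0 m)) (ltW r0))/=; apply: le_trans pi1.
      rewrite /c mulrC ler_pdivrMr ?mulr_gt0// mul1r mulrC -ler_pdivrMr//.
      apply: (@le_trans _ _ m%:R); last by rewrite ler_nat.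
      near: m; exact: nbhs_infty_ger.
    rewrite !patchE; congr (if _ then _ else _).
    have e : (w (c m) r < a m) = (r < b).
      have /andP[h1 h2] := cb m.
      rewrite /a /w ltr_pM2r// ltrD2l ltrN2 dcos//; last by rewrite (ltW h1)/=; exact: le_trans h2 pi1.
      by rewrite ltr_pM2l.
    by apply/idP/idP; rewrite !inE/= e.
  - exact: integrable_abse ih.
  - move=> m r; rewrite patchE; case: ifP => // _; by rewrite normr0.
rewrite (_ : (fun m => _) = cst 0); last by apply/funext => m; exact: zero.
by move=> h1; apply: (cvg_unique _ h1 (cvg_cst _)).
Unshelve. all: by end_near. Qed.

End null_cosine_transform.

Section null_bessel_transform.
Context {R : realType} (k : nat).
Hypothesis k0 : (0 < k)%N.
Local Notation leb := (@lebesgue_measure R).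
Local Notation besc := (@besc R k).
Local Notation besB := (@besB R k).

Lemma besB_partial_le (w : R) n : 0 <= w ->
  \sum_(0 <= j < n) besc j * w ^+ j <= besB w.
Proof.
move=> w0; apply: (@nondecreasing_cvgn_le _ (series (fun j => besc j * w ^+ j))).
  apply/nondecreasing_seqP => m; rewrite /series/= big_nat_recr//= lerDl.
  exact: (bescX_ge0 k0).
exact: (is_cvg_besB k0).
Qed.

Lemma besB_term_le (w : R) j : 0 <= w -> besc j * w ^+ j <= besB w.
Proof.
move=> w0; apply: le_trans (besB_partial_le j.+1 w0).
rewrite big_nat_recr//= lerDr sumr_ge0// => i _; exact: (bescX_ge0 k0).
Qed.

(** Each omitted term carries a factor [s^j <= s^n]. The error is thus of order [s^n] with a
    coefficient independent of [s], which can be integrated against [h]. *)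
Lemma besB_tail (w s : R) n : 0 <= w -> 0 <= s <= 1 ->
  `|\sum_(0 <= j < n) besc j * (w * s) ^+ j - besB (w * s)| <= s ^+ n * besB w.
Proof.
move=> w0 /andP[s0 s1]; have ws0 : 0 <= w * s by rewrite mulr_ge0.
rewrite ler0_norm ?subr_le0 ?besB_partial_le// opprB lerBlDl.
apply: limr_le; first exact: (is_cvg_besB k0).
exists n => // m /= nm; rewrite /series/= (big_cat_nat (leq0n n) nm)//= lerD2l.
apply: (@le_trans _ _ (s ^+ n * \sum_(n <= j < m) besc j * w ^+ j)).
  rewrite mulr_sumr big_nat [leRHS]big_nat ler_sum// => j /andP[nj _].
  have -> : besc j * (w * s) ^+ j = s ^+ j * (besc j * w ^+ j) by rewrite exprMn; ring.
  rewrite ler_wpM2r ?(bescX_ge0 k0)//.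
  by rewrite ler_wiXn2l.
rewrite ler_wpM2l ?exprn_ge0//; apply: le_trans (besB_partial_le m w0).
rewrite (big_cat_nat (leq0n n) nm)//= lerDr sumr_ge0// => j _; exact: (bescX_ge0 k0).
Qed.

Variable h : R -> R.
Hypothesis mh : measurable_fun setT h.
Hypothesis ib : forall s, 0 < s ->
  leb.-integrable setT (EFin \o (fun r => h r * besB (r ^+ 2 * s))).
Hypothesis i0 : forall s, 0 < s -> \int[leb]_r (h r * besB (r ^+ 2 * s)) = 0.

Let imom j : leb.-integrable setT (EFin \o (fun r => h r * (r ^+ 2) ^+ j)).
Proof.
have i1 : leb.-integrable setT (EFin \o (fun r => (besc j)^-1 * (h r * besB (r ^+ 2 * 1)))).
  by apply: integrableZ_real => //; exact: ib.
apply: le_integrable i1 => //.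
  apply/measurable_EFinP; apply: measurable_funM => //.
  by apply: measurable_funX; apply: measurable_funX.
move=> r _ /=; rewrite lee_fin !normrM mulrCA ler_wpM2l//.
have r0 := sqr_ge0 r.
rewrite mulr1 (ger0_norm (exprn_ge0 j r0)).
rewrite [X in _ * X]ger0_norm; last exact: (besB_ge0 k0 r0).
rewrite ger0_norm; last by rewrite invr_ge0; exact: (besc_ge0 k0).
rewrite mulrC ler_pdivlMr ?(besc_gt0 k0)// mulrC; exact: besB_term_le.
Qed.

Let M j := \int[leb]_r (h r * (r ^+ 2) ^+ j).

Let partial (c : nat -> R) n :
  leb.-integrable setT (EFin \o (fun r => h r * \sum_(0 <= j < n) c j * (r ^+ 2) ^+ j)) /\
  \int[leb]_r (h r * \sum_(0 <= j < n) c j * (r ^+ 2) ^+ j) = \sum_(0 <= j < n) c j * M j.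
Proof.
elim: n => [|n [ihi ihe]].
  rewrite (_ : (fun r => _) = (fun=> 0)); last first.
    by apply/funext => r; rewrite big_geq// mulr0.
  by split; [exact: integrable0|rewrite big_geq// /Rintegral integral0].
have e : (fun r => h r * \sum_(0 <= j < n.+1) c j * (r ^+ 2) ^+ j) =
    (fun r => h r * (\sum_(0 <= j < n) c j * (r ^+ 2) ^+ j) + c n * (h r * (r ^+ 2) ^+ n)).
  by apply/funext => r; rewrite big_nat_recr//= mulrDr mulrCA.
have iZ : leb.-integrable setT (EFin \o (fun r => c n * (h r * (r ^+ 2) ^+ n))).
  by apply: integrableZ_real => //; exact: imom.
rewrite e; split.
  exact: integrableD_real.
rewrite RintegralD// RintegralZl//; try exact: imom.
by rewrite ihe big_nat_recr.
Qed.

(** Identification of power series coefficients at 0: once the lower moments vanish,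
    [s^n besc n M n] is the integral of [h] against a truncation error, hence at most [s^(n+1) K].
    Dividing by [s^n] leaves a bound linear in [s]. *)
Let moment0 j : M j = 0.
Proof.
pose K := \int[leb]_r `|h r * besB (r ^+ 2 * 1)|.
have K0 : 0 <= K by apply: Rintegral_ge0.
elim/ltn_ind: j => n ihn.
have bound s : 0 < s <= 1 -> `|besc n * M n| <= s * K.
  move=> /andP[s0 s1].
  have [pi pe] := partial (fun j => besc j * s ^+ j) n.+1.
  have e : \int[leb]_r (h r * (\sum_(0 <= j < n.+1) besc j * (r ^+ 2 * s) ^+ j - besB (r ^+ 2 * s))) =
      s ^+ n * (besc n * M n).
    transitivity (\int[leb]_r (h r * (\sum_(0 <= j < n.+1) besc j * s ^+ j * (r ^+ 2) ^+ j) -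
        h r * besB (r ^+ 2 * s))).
      apply: eq_Rintegral => r _; rewrite mulrBr; congr (_ * _ - _).
      by apply: eq_bigr => j _; rewrite exprMn; ring.
    rewrite RintegralB ?pe ?i0 ?subr0//; last exact: ib.
    rewrite big_nat_recr//= big_nat big1 ?add0r; first by ring.
    by move=> j /andP[_ jn]; rewrite ihn// mulr0.
  have ii : leb.-integrable setT (EFin \o (fun r => h r *
      (\sum_(0 <= j < n.+1) besc j * (r ^+ 2 * s) ^+ j - besB (r ^+ 2 * s)))).
    rewrite (_ : (fun r => _) = (fun r => h r * (\sum_(0 <= j < n.+1) besc j * s ^+ j * (r ^+ 2) ^+ j) -
        h r * besB (r ^+ 2 * s))).
      by apply: integrableB_real => //; exact: ib.
    apply/funext => r /=; rewrite mulrBr; congr (_ * _ - _).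
    by apply: eq_bigr => j _; rewrite exprMn; ring.
  have iK : leb.-integrable setT (EFin \o (fun r => `|h r * besB (r ^+ 2 * 1)|)).
    exact: integrable_abse (ib ltr01).
  have := le_normr_Rintegral measurableT ii.
  rewrite e => h1.
  have h2 : \int[leb]_r `|h r * (\sum_(0 <= j < n.+1) besc j * (r ^+ 2 * s) ^+ j - besB (r ^+ 2 * s))|
      <= \int[leb]_r (s ^+ n.+1 * `|h r * besB (r ^+ 2 * 1)|).
    apply: le_Rintegral => //.
    - exact: integrable_abse ii.
    - by apply: integrableZ_real.
    - move=> r _; rewrite !normrM mulrCA ler_wpM2l//.
      rewrite mulr1 (ger0_norm (besB_ge0 k0 (sqr_ge0 r))).
      by apply: besB_tail; rewrite ?sqr_ge0// ltW.
  move: (le_trans h1 h2); rewrite RintegralZl// normrM (ger0_norm (exprn_ge0 n (ltW s0))).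
  by rewrite exprSr -mulrA ler_pM2l// exprn_gt0.
have [//|Mn] := eqVneq (M n) 0.
set x := `|besc n * M n| in bound.
have x0 : 0 < x by rewrite normr_gt0 mulf_neq0// gt_eqF// (besc_gt0 k0).
have d0 : 0 < x + K + 1 by lra.
(* This value of [s] would give [x (x + K + 1) <= x K], impossible for [x > 0]. *)
have := bound (x / (x + K + 1)); rewrite divr_gt0//= ler_pdivrMr// mul1r.
have -> : x <= x + K + 1 by lra.
move=> /(_ isT); rewrite mulrAC ler_pdivlMr// ler_pM2l//; lra.
Qed.

(** From [(2j)! >= (j!)^2] and [Gamma_half_le], with [8 = 4 * 2] joining the power in [besc] to that
    of the Gamma bound. The [+ 1] keeps the argument positive at [z = 0], as [ib] requires. *)
Let cos_bound (z : R) : exists2 C : R, 0 < C & forall j,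
  (z ^+ 2) ^+ j / (j.*2)`!%:R <= C * (besc j * (8 * z ^+ 2 + 1) ^+ j).
Proof.
have [C C0 hC] := @Gamma_half_le R k.-1.
exists C => // j; have z0 := sqr_ge0 z.
have fle : j`!%:R * j`!%:R <= (j.*2)`!%:R :> R.
  rewrite -natrM ler_nat -addnn -(bin_fact (leq_addr j j)) addnK.
  by rewrite leq_pmull// bin_gt0 leq_addr.
have f0 : 0 < j`!%:R :> R by rewrite ltr0n fact_gt0.
apply: (@le_trans _ _ ((z ^+ 2) ^+ j / (j`!%:R * j`!%:R))).
  rewrite (ler_wpM2l (exprn_ge0 j z0))// lef_pV2 ?posrE//.
have hb : (8 ^+ j * (j`!%:R * j`!%:R))^-1 <= C * besc j.
  have -> : C * besc j = (C^-1 * (4 ^+ j * j`!%:R * Gamma (k%:R / 2 + j%:R)))^-1.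
    by rewrite [RHS]invfM invrK.
  have G0 := @Gamma_index_gt0 R k k0 j.
  rewrite lef_pV2 ?posrE; last 2 first.
  - by rewrite !mulr_gt0 ?exprn_gt0.
  - by rewrite !mulr_gt0 ?exprn_gt0 ?invr_gt0.
  rewrite mulrC ler_pdivrMr//.
  have := hC j; rewrite -half_index// => hG.
  have -> : 8 ^+ j * (j`!%:R * j`!%:R) * C = 4 ^+ j * j`!%:R * (C * 2 ^+ j * j`!%:R) :> R.
    by rewrite (_ : 8 = 4 * 2 :> R) ?exprMn; ring.
  by rewrite ler_wpM2l// !mulr_ge0 ?exprn_ge0 ?ltW.
apply: (@le_trans _ _ ((8 * z ^+ 2) ^+ j * (C * besc j))).
  have -> : (z ^+ 2) ^+ j / (j`!%:R * j`!%:R) =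
      (8 * z ^+ 2) ^+ j * (8 ^+ j * (j`!%:R * j`!%:R))^-1.
    rewrite [in RHS]exprMn; field.
    by rewrite gt_eqF// expf_neq0.
  by rewrite ler_wpM2l//; apply: exprn_ge0; rewrite mulr_ge0.
rewrite [leRHS]mulrA [leRHS]mulrC ler_wpM2r//.
  by rewrite mulr_ge0 ?(ltW C0)//; exact: (besc_ge0 k0).
have z8 : 0 <= 8 * z ^+ 2 by rewrite mulr_ge0.
by apply: lerXn2r; rewrite ?nnegrE//; lra.
Qed.

(* The even moments vanish and [z^(2j) / (2j)! <= C besc j (8 z^2 + 1)^j], so the
   cosine series can be integrated term by term. *)
Lemma null_of_bessel_transform : (forall r, r <= 0 -> h r = 0) ->
  ae_eq leb setT (EFin \o h) (cst 0%E).
Proof.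
move=> h_le0; apply: null_of_cosine_transform => //.
  by have := imom 0; under eq_fun do rewrite expr0 mulr1.
move=> z; have [C C0 hC] := cos_bound z.
pose c j : R := (-1) ^+ j * ((z ^+ 2) ^+ j / (j.*2)`!%:R).
pose s := 8 * z ^+ 2 + 1.
have s0 : 0 < s by have := sqr_ge0 z; rewrite /s; lra.
have cv : \int[leb]_r (h r * \sum_(0 <= j < n) c j * (r ^+ 2) ^+ j) @[n --> \oo] -->
    \int[leb]_r (h r * cos (z * r)).
  apply: (@cvg_Rintegral _ _ _ leb (fun n r => h r * \sum_(0 <= j < n) c j * (r ^+ 2) ^+ j)
    (fun r => h r * cos (z * r)) (fun r => C * `|h r * besB (r ^+ 2 * s)|)).
  - by move=> n; apply/measurable_EFinP; have [/measurable_int] := partial c n.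
  - apply: measurable_funM => //; apply: continuous_measurable_fun => x.
    by apply: continuous_comp; [exact: mulrl_continuous|exact: continuous_cos].
  - move=> r; apply: cvgMr; rewrite (_ : (fun n => _) = series (cos_coeff' (z * r))).
      exact: cvg_cos_coeff'.
    apply/funext => n; apply: eq_bigr => j _.
    have -> : cos_coeff' (z * r) j =
        (-1) ^+ j * ((z ^+ 2) ^+ j * (r ^+ 2) ^+ j) / (j.*2)`!%:R.
      rewrite /cos_coeff'; have -> // : (z * r) ^+ j.*2 = (z ^+ 2) ^+ j * (r ^+ 2) ^+ j.
      by rewrite -[RHS]exprMn -[X in _ = X ^+ _]exprMn -exprM mul2n.
    by rewrite /c; ring.
  - by apply: integrableZ_real => //; exact: integrable_abse (ib s0).
  - move=> n r; rewrite !normrM mulrCA ler_wpM2l//.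
    have r2 := sqr_ge0 r.
    rewrite (ger0_norm (besB_ge0 k0 (mulr_ge0 r2 (ltW s0)))).
    apply: le_trans (ler_norm_sum _ _ _) _.
    apply: (@le_trans _ _ (C * \sum_(0 <= j < n) besc j * (r ^+ 2 * s) ^+ j)); last first.
      rewrite (ler_wpM2l (ltW C0))//; exact: besB_partial_le (mulr_ge0 r2 (ltW s0)).
    rewrite mulr_sumr ler_sum// => j _.
    rewrite /c normrM normrM normrX normrN normr1 expr1n mul1r.
    rewrite (ger0_norm (exprn_ge0 j r2)).
    rewrite (ger0_norm (divr_ge0 (exprn_ge0 j (sqr_ge0 z)) (ler0n _ _))).
    apply: le_trans (ler_wpM2r (exprn_ge0 j r2) (hC j)) _.
    rewrite -/s le_eqVlt; apply/orP; left; apply/eqP.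
    have -> : (r ^+ 2 * s) ^+ j = (r ^+ 2) ^+ j * s ^+ j by exact: exprMn.
    by rewrite -/s; move: (s ^+ j) ((r ^+ 2) ^+ j) (besc j) => x y w; ring.
have e n : \int[leb]_r (h r * \sum_(0 <= j < n) c j * (r ^+ 2) ^+ j) = 0.
  have [_ ->] := partial c n.
  by rewrite big1// => j _; rewrite moment0 mulr0.
move: cv; under eq_fun do rewrite e.
by move=> cv; apply: (cvg_unique _ cv (cvg_cst _)).
Qed.

End null_bessel_transform.

Section I_transform.
Context {R : realType} (k : nat).
Hypothesis k0 : (0 < k)%N.
Local Notation leb := (@lebesgue_measure R).
Local Notation nu := ((k%:R - 2) / 2 : R).
Local Notation q := ((k%:R - 1) / 2 : R).
Local Notation D := (`]0, +oo[%classic : set R).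

Let inD (r : R) : (r \in D) = (0 < r).
Proof. by apply/idP/idP; rewrite inE/= in_itv/= andbT. Qed.

Let mD : measurable (`]0, +oo[%classic : set (measurableTypeR R)).
Proof. exact: measurable_itv. Qed.

Let besB_gt0 (w : R) : 0 <= w -> 0 < besB k w.
Proof.
move=> w0; apply: lt_le_trans (besB_term_le k0 0 w0).
by rewrite expr0 mulr1; exact: (besc_gt0 k0).
Qed.

Lemma measurable_I_kernel y : 0 < y -> measurable_fun D (fun x => I_kernel nu x y).
Proof.
move=> y0; apply: (@eq_measurable_fun _ _ R R D (fun x =>
    2 `^ (- nu) * (x * y) `^ q * besB k (x ^+ 2 * y ^+ 2))).
  by move=> x; rewrite inD => x0; rewrite I_kernelE// exprMn.
apply: measurable_funTS; apply: measurable_funM; last exact: (measurable_besB k0 (sqr_ge0 y)).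
apply: measurable_funM => //.
apply: (measurableT_comp (measurable_powR q)).
exact: measurable_funM.
Qed.

(** Multiplying the difference by [r^((k-1)/2)] absorbs the power of [r] in the kernel: at
    [y = sqrt s], only [besB k (r ^+ 2 * s)] and a constant remain. *)
Lemma I_transform_unique (f1 f2 F : R -> R) :
  is_I_transform nu f1 F -> is_I_transform nu f2 F ->
  \forall r \ae leb, 0 < r -> f1 r = f2 r.
Proof.
move=> h1 h2.
pose A : R := 2 `^ (- nu).
have A0 : 0 < A by rewrite powR_gt0.
pose d r y := f1 r * I_kernel nu r y - f2 r * I_kernel nu r y.
have id (y : R) : 0 < y -> leb.-integrable D (EFin \o (d ^~ y)).
  by move=> y0; apply: integrableB_real; [exact: mD|have [] := h1 _ y0|have [] := h2 _ y0].
pose h := (fun r => (f1 r - f2 r) * r `^ q) \_ D.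
have hd (s r : R) : 0 < s ->
    h r * besB k (r ^+ 2 * s) = (A * Num.sqrt s `^ q)^-1 * ((d ^~ (Num.sqrt s)) \_ D) r.
  move=> s0; rewrite /h !patchE; case: ifPn; last by rewrite mul0r mulr0.
  rewrite inD => r0; have s0' : 0 < Num.sqrt s by rewrite sqrtr_gt0.
  rewrite /d I_kernelE// -/A powRM ?ltW// exprMn sqr_sqrtr ?ltW//.
  have : Num.sqrt s `^ q != 0 by rewrite gt_eqF// powR_gt0.
  move: (Num.sqrt s `^ q) (r `^ q) (besB k (r ^+ 2 * s)) => x y z x0; field.
  by rewrite x0 gt_eqF.
(* Measurability is known only for products with the kernel, through their integrability. Dividing
   the product at [y = 1] by the positive function [besB] recovers it for [h]. *)
have mh : measurable_fun setT h.
  rewrite (_ : h = fun r => ((A * Num.sqrt 1 `^ q)^-1 * ((d ^~ (Num.sqrt 1)) \_ D) r) *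
      besB k (r ^+ 2 * 1) `^ (- 1)); last first.
    apply/funext => r; have b0 : 0 < besB k (r ^+ 2 * 1) by rewrite besB_gt0// mulr1 sqr_ge0.
    by rewrite -hd// powR_inv1 ?ltW// mulfK// gt_eqF.
  apply: measurable_funM.
    apply: measurable_funM => //; apply/(measurable_restrictT _ _).1; first exact: mD.
    by apply/measurable_EFinP; apply: measurable_int (id _ _); rewrite sqrtr1.
  exact: (measurableT_comp (measurable_powR _) (measurable_besB k0 ler01)).
have : ae_eq leb setT (EFin \o h) (cst 0%E).
  apply: (null_of_bessel_transform k0 mh).
  - move=> s s0; have y0 : 0 < Num.sqrt s by rewrite sqrtr_gt0.
    rewrite (_ : (fun r => _) = (fun r => (A * Num.sqrt s `^ q)^-1 * ((d ^~ (Num.sqrt s)) \_ D) r)).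
      apply: integrableZ_real => //; have /(integrable_mkcond _ mD).1 := id _ y0.
      by rewrite restrict_EFin.
    by apply/funext => r; rewrite hd.
  - move=> s s0; have y0 : 0 < Num.sqrt s by rewrite sqrtr_gt0.
    under eq_Rintegral do rewrite hd//.
    have [i1 e1] := h1 _ y0; have [i2 e2] := h2 _ y0.
    rewrite RintegralZl//; last first.
      by have /(integrable_mkcond _ mD).1 := id _ y0; rewrite restrict_EFin.
    by rewrite -Rintegral_mkcond RintegralB// -e1 -e2 subrr mulr0.
  - by move=> r r0; rewrite /h patchE inD ltNge r0.
apply: (@filterS _ _ (ae_filter_ringOfSetsType leb)) => r /(_ I) /= [hr] r0; apply/eqP; rewrite -subr_eq0; apply/eqP.
move: hr; rewrite /h patchE inD r0 => /eqP; rewrite mulf_eq0.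
by rewrite (gt_eqF (powR_gt0 _ r0)) orbF => /eqP.
Qed.

Lemma radial_weightK (f : R -> R) r : 0 < r ->
  radial_weight k (radial_unweight k f) r = f r.
Proof.
move=> r0; rewrite /radial_weight /radial_unweight.
have -> : (1 - k%:R) / 2 = - q :> R by field.
rewrite powRN expRN; field.
by rewrite !gt_eqF ?expR_gt0 ?powR_gt0.
Qed.

Lemma radial_unweightK (l : R -> R) r : 0 < r ->
  radial_unweight k (radial_weight k l) r = l r.
Proof.
move=> r0; rewrite /radial_weight /radial_unweight.
have -> : (1 - k%:R) / 2 = - q :> R by field.
rewrite powRN expRN; field.
by rewrite !gt_eqF ?expR_gt0 ?powR_gt0.
Qed.

Lemma eq_I_transform (f1 f2 F : R -> R) : (forall r, 0 < r -> f1 r = f2 r) ->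
  is_I_transform nu f1 F -> is_I_transform nu f2 F.
Proof.
move=> e h y y0; have [i1 e1] := h y y0; split.
  apply: eq_integrable i1 => // r; rewrite inD => r0.
  by rewrite e.
by rewrite e1; apply: eq_Rintegral => r; rewrite inD => r0; rewrite e.
Qed.

(** Integrability includes Borel measurability, which does not pass through almost everywhere
    equality; for priors it is supplied by [measurable_radial_weight]. *)
Lemma ae_eq_I_transform (f1 f2 F : R -> R) : measurable_fun D f2 ->
  (\forall r \ae leb, 0 < r -> f1 r = f2 r) ->
  is_I_transform nu f1 F -> is_I_transform nu f2 F.
Proof.
move=> m2 e h y y0; have [i1 e1] := h y y0.
have m2y : measurable_fun D (fun x => (f2 x * I_kernel nu x y)%:E).
  by apply/measurable_EFinP; apply: measurable_funM => //; exact: measurable_I_kernel.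
have ee : ae_eq leb D (fun x => (f1 x * I_kernel nu x y)%:E) (fun x => (f2 x * I_kernel nu x y)%:E).
  by move: e; apply: (@filterS _ _ (ae_filter_ringOfSetsType leb)) => r er /=; rewrite in_itv/= andbT => r0; rewrite er.
have ea : ae_eq leb D (fun x => `|(f1 x * I_kernel nu x y)%:E|%E) (fun x => `|(f2 x * I_kernel nu x y)%:E|%E).
  exact: ae_eq_abse ee.
have m1 := measurable_int _ i1.
split.
  apply/integrableP; split => //.
  rewrite -(ae_eq_integral _ _ mD (measurableT_comp (@abse_measurable R setT) m1)
    (measurableT_comp (@abse_measurable R setT) m2y) ea).
  by have /integrableP[] := i1.
rewrite e1 /Rintegral; congr fine.
exact: (ae_eq_integral _ _ mD m1 m2y ee).
Qed.

Lemma measurable_radial_weight (g : R -> R) : spherical_prior k g ->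
  measurable_fun D (radial_weight k (radial_density k g)).
Proof.
move=> [mg _ _].
apply: measurable_funM.
  apply: measurable_funTS; apply: measurable_funM; first exact: measurable_powR.
  by apply: measurableT_comp => //; apply: measurableT_comp => //; exact: measurable_funM.
apply: measurable_funM; first by apply: measurable_funTS; apply: measurable_funM.
apply: (@eq_measurable_fun _ _ R R D (fun r => (g \_ `[0, +oo[) (r ^+ 2))).
  by move=> r _; rewrite patchE ifT// inE/= in_itv/= andbT sqr_ge0.
apply: measurable_funTS; apply: measurableT_comp; first exact: measurable_restrict_pos.
exact: measurable_funX.
Qed.

End I_transform.

(** An inverse I-transform is a function [f] with transform [F], determined up to null sets only.
    The formula for the radial density is therefore an equivalence: a prior has its weighted radial
    density transformed into [F] exactly when that density is almost everywhere [lambda]. *)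
Theorem theorem1 (R : realType) (k : nat) (hk : (0 < k)%N) :
  (forall g F : R -> R,
     spherical_prior k g ->
     (bayes_risk g (bayes_estimator k g) < +oo)%E ->
     is_I_transform ((k%:R - 2) / 2) (radial_weight k (radial_density k g)) F ->
     minimaxity_condition k F ->
     minimax (bayes_estimator k g))
  /\
  (forall (phi z1 z2 : R -> R) (c1 c2 : R),
     nonpositive_generalized_series phi ->
     ode_solution k phi z1 ->
     ode_solution k phi z2 ->
     linearly_independent z1 z2 ->
     let F := squared_solution k z1 z2 c1 c2 in
     minimaxity_condition k F
     /\
     (forall f : R -> R,
        is_I_transform ((k%:R - 2) / 2) f F ->
        let lambda := radial_unweight k f in
        (forall g : R -> R, spherical_prior k g ->
           (is_I_transform ((k%:R - 2) / 2)
              (radial_weight k (radial_density k g)) F <->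
            \forall r \ae @lebesgue_measure R,
              0 < r -> radial_density k g r = lambda r))
        /\
        (forall g : R -> R, spherical_prior k g ->
           (forall r, 0 < r -> radial_density k g r = lambda r) ->
           (@lebesgue_measure R).-integrable `]0, +oo[
             (fun r => (lambda r)%:E) ->
           minimax (bayes_estimator k g)))).
Proof.
split=> [g F hg _ hF hc|phi z1 z2 c1 c2 hphi o1 o2 _ F].
  exact: (minimax_of_condition hk hg hF hc).
have hc : minimaxity_condition k F by exact: squared_solution_condition hphi o1 o2.
split=> // f hf lambda; split=> g hg; [split=> h|move=> h _].
- have := I_transform_unique hk h hf; apply: (@filterS _ _ (ae_filter_ringOfSetsType (@lebesgue_measure R))) => r e r0.
  by rewrite -(radial_unweightK k (radial_density k g) r0) /lambda /radial_unweight e.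
- apply: (ae_eq_I_transform hk (measurable_radial_weight hg) _ hf).
  move: h; apply: (@filterS _ _ (ae_filter_ringOfSetsType (@lebesgue_measure R))) => r e r0.
  by rewrite -(radial_weightK k f r0) -/lambda /radial_weight e.
- apply: (minimax_of_condition hk hg _ hc); apply: eq_I_transform hf => r r0.
  by rewrite -(radial_weightK k f r0) -/lambda /radial_weight h.
Qed.
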